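(* Let $G$ be a compact connected Lie group with Lie algebra $\mathfrak{g}$, let $M$ be a compact connected smooth manifold, and let $\pi\colon P\to M$ be a (smooth) principal $G$-bundle. Fix a bi-invariant metric $\langle -,-\rangle$ on $G$, a real number $T>0$, and a family $\{g_M(t)\}_{t\in[0,T)}$ of Riemannian metrics on $M$. Let $\theta\in\Omega^1(P,\mathfrak{g})$ be a principal connection and let $u\in P$ be such that the holonomy group $\mathrm{Hol}_u(\theta)\subset G$ is a closed subgroup. For $t\in[0,T)$ let $g_P(t):=\pi^*g_M(t)+\langle\theta,\theta\rangle$, a Riemannian metric on $P$, and let $g_T$ be the $G$-invariant Riemannian metric on $G/\mathrm{Hol}_u(\theta)$ induced by $\langle-,-\rangle$ which makes the projection $G\to G/\mathrm{Hol}_u(\theta)$ a Riemannian submersion. Then, for every $t\in[0,T)$, $$d_{GH}\big((P,d_{g_P(t)}),(G/\mathrm{Hol}_u(\theta),d_{g_T})\big)\le\frac{\mathrm{diam}\big(P_u(\theta),\mathrm{dist}_{\mathcal H}(t)\big)}{2},$$ where $P_u(\theta)$ is the holonomy bundle of $\theta$ through $u$ and $\mathrm{dist}_{\mathcal H}(t)$ is the Carnot-Carathéodory distance on $P_u(\theta)$ induced by the restriction to $P_u(\theta)$ of the sub-Riemannian structure $(\ker\theta,\,g_P(t)|_{\ker\theta})$.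
   Context: $G$ acts smoothly and freely on $P$ on the right, with $R_g(x)=xg$. A principal connection is a $\mathfrak{g}$-valued 1-form $\theta$ on $P$ with $R_g^*\theta=\mathrm{Ad}(g^{-1})\theta$ for all $g\in G$ and $\theta(\xi_* )=\xi$ for all $\xi\in\mathfrak{g}$, where $\xi_*$ is the vector field on $P$ generated by $\xi$. A curve in $P$ is $\theta$-horizontal if its velocity lies in $\ker\theta$. Write $p\sim q$ if $p,q\in P$ can be joined by a piecewise smooth $\theta$-horizontal path. The holonomy group is $\mathrm{Hol}_u(\theta)=\{g\in G: u\sim ug\}$ and the holonomy bundle is $P_u(\theta)=\{x\in P: u\sim x\}$, which is a principal $\mathrm{Hol}_u(\theta)$-bundle over $M$ on which $\theta$ restricts to a principal connection. In $\langle\theta,\theta\rangle$, the symbol $\langle-,-\rangle$ denotes the corresponding $\mathrm{Ad}$-invariant inner product on $\mathfrak{g}$, so $\langle\theta,\theta\rangle(V,W)=\langle\theta(V),\theta(W)\rangle$. For a Riemannian metric $g$, $d_g$ denotes its Riemannian distance. (The subscript in $g_T$ is only notation; $g_T$ is not a member of a family in $t$.) Put $\mathcal H:=\ker(\theta)|_{P_u(\theta)}$, a subbundle of $T(P_u(\theta))$. For $a,b\in P_u(\theta)$, $\mathrm{dist}_{\mathcal H}(t)(a,b)$ is the infimum of the $g_P(t)$-lengths of $\mathcal H$-horizontal curves in $P_u(\theta)$ joining $a$ and $b$. $d_{GH}$ is the Gromov-Hausdorff distance between compact metric spaces: $d_{GH}((X,d_X),(Y,d_Y))=\frac12\inf_{\mathscr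 R}\mathrm{dis}(\mathscr R)$, where $\mathscr R$ ranges over correspondences between $X$ and $Y$ (subsets of $X\times Y$ projecting onto both factors) and $\mathrm{dis}(\mathscr R)=\sup\{|d_X(x,x')-d_Y(y,y')|:(x,y),(x',y')\in\mathscr R\}$. *)

(* Defs.v *)
From HB Require Import structures.
From mathcomp Require Import all_boot all_order all_algebra.
From mathcomp Require Import all_classical all_reals all_analysis.

Set Implicit Arguments.
Unset Strict Implicit.
Unset Printing Implicit Defensive.

Import Order.TTheory GRing.Theory Num.Theory.
Import numFieldNormedType.Exports.

Local Open Scope classical_set_scope.
Local Open Scope ring_scope.

Section SmoothMaps.
Context {R : realType} {V W : normedModType R}.

(* C^k at every point of D; meaningful for D open and V finite-dimensional,
   which is the only way it is used. *)
Fixpoint Ck (k : nat) (D : set V) (f : V -> W) : Prop :=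
  match k with
  | 0 => forall x, D x -> {for x, continuous f}
  | k'.+1 => (forall x, D x -> differentiable f x) /\
             forall v : V, Ck k' D (fun x => 'd f x v)
  end.

Definition Cinf (D : set V) (f : V -> W) : Prop := forall k, Ck k D f.

End SmoothMaps.

Section Manifolds.
Context (R : realType).

(* A chart is a homeomorphism from the open set cdom onto the open set
   cmap @` cdom; cmap and cinv are total functions, irrelevant elsewhere. *)
Record chart (T : topologicalType) (n : nat) := Chart {
  cdom : set T;
  cmap : T -> 'rV[R]_n;
  cinv : 'rV[R]_n -> T;
  cdom_open : open cdom;
  crange_open : open (cmap @` cdom);
  cmapK : forall x, cdom x -> cinv (cmap x) = x;
  cmap_continuous : forall x, cdom x -> {for x, continuous cmap};
  cinv_continuous : forall y, (cmap @` cdom) y -> {for y, continuous cinv}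
}.

(* The atlas need not be maximal. The preferred chart around each point
   serves to identify the tangent space at that point with 'rV[R]_n: a
   tangent vector at x : A is its coordinate vector in [chart_at A x]. *)
Record manifold (n : nat) := Manifold {
  mcarrier :> topologicalType;
  atlas : set (chart mcarrier n);
  chart_at : mcarrier -> chart mcarrier n;
  chart_at_atlas : forall x, atlas (chart_at x);
  chart_at_dom : forall x, cdom (chart_at x) x;
  atlas_compatible : forall a b, atlas a -> atlas b ->
    Cinf (cmap a @` (cdom a `&` cdom b)) (cmap b \o cinv a);
  manifold_hausdorff : hausdorff_space mcarrier;
  manifold_second_countable : @second_countable mcarrier
}.

End Manifolds.

Section Calculus.
Context {R : realType}.

Definition smooth_on {m n} {A : manifold R m} {B : manifold R n}
    (D : set A) (f : A -> B) : Prop :=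
  (forall x, D x -> {for x, continuous f}) /\
  forall a b, atlas a -> atlas b ->
    Cinf (cmap a @` [set x | [/\ D x, cdom a x & cdom b (f x)]])
         (cmap b \o f \o cinv a).

Definition smooth {m n} {A : manifold R m} {B : manifold R n} (f : A -> B) :=
  smooth_on setT f.

(* Smoothness of a map of two variables on an open subset of the product
   manifold A * B, read in product charts. *)
Definition smooth2_on {m n k} {A : manifold R m} {B : manifold R n}
    {C : manifold R k} (D : set (A * B)) (f : A -> B -> C) : Prop :=
  (forall z, D z -> {for z, continuous (fun z : A * B => f z.1 z.2)}) /\
  forall a b c, atlas a -> atlas b -> atlas c ->
    Cinf [set w : 'rV[R]_m * 'rV[R]_n | exists x y,
            [/\ D (x, y), cdom a x, cdom b y, cdom c (f x y) &
                w = (cmap a x, cmap b y)]]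
         (fun w => cmap c (f (cinv a w.1) (cinv b w.2))).

Definition smooth2 {m n k} {A : manifold R m} {B : manifold R n}
    {C : manifold R k} (f : A -> B -> C) := smooth2_on setT f.

(* The tangent map of f at x, from T_x A to T_(f x) B. *)
Definition tmap {m n} {A : manifold R m} {B : manifold R n}
    (f : A -> B) (x : A) : 'rV[R]_m -> 'rV[R]_n :=
  'd (cmap (chart_at (f x)) \o f \o cinv (chart_at x)) (cmap (chart_at x) x).

(* The value at the point of A with a-coordinates y of the vector field whose
   components in the chart a are constantly v. *)
Definition chart_field {n} {A : manifold R n} (a : chart R A n)
    (y v : 'rV[R]_n) : 'rV[R]_n :=
  'd (cmap (chart_at (cinv a y)) \o cinv a) y v.

Definition velocity {n} {A : manifold R n} (c : R -> A) (t : R) : 'rV[R]_n :=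
  derive1 (cmap (chart_at (c t)) \o c) t.

Definition smooth_curve_on {n} {A : manifold R n} (D : set R) (c : R -> A) :
    Prop :=
  (forall t, D t -> {for t, continuous c}) /\
  forall a, atlas a -> Cinf [set t | D t /\ cdom a (c t)] (cmap a \o c).

(* c is smooth on the closed interval [a, b], i.e. extends smoothly to a
   neighbourhood of it, and its velocity satisfies Q along [a, b] (this
   includes the one-sided velocities at a and b). *)
Definition smooth_arc {n} {A : manifold R n} (Q : A -> 'rV[R]_n -> Prop)
    (c : R -> A) (a b : R) : Prop :=
  exists (s : R -> A) (e : R),
    [/\ 0 < e, smooth_curve_on [set t | a - e < t < b + e] s &
        forall t, a <= t <= b -> s t = c t /\ Q (s t) (velocity s t)].

(* Curves on [a, b] that are piecewise smooth with all velocities in Q. *)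
Inductive pw_smooth {n} {A : manifold R n} (Q : A -> 'rV[R]_n -> Prop)
    (c : R -> A) : R -> R -> Prop :=
| pw_smooth_arc a b : a < b -> smooth_arc Q c a b -> pw_smooth Q c a b
| pw_smooth_cat a b d :
    pw_smooth Q c a b -> pw_smooth Q c b d -> pw_smooth Q c a d.

End Calculus.

Section Metrics.
Context {R : realType}.

Definition tensor2 {n} (A : manifold R n) := A -> 'rV[R]_n -> 'rV[R]_n -> R.

Definition riemannian {n} {A : manifold R n} (g : tensor2 A) : Prop :=
  [/\ forall x v, scalar (g x v),
      forall x v w, g x v w = g x w v,
      forall x v, v != 0 -> 0 < g x v v &
      forall a, atlas a -> forall v w : 'rV[R]_n,
        Cinf (cmap a @` cdom a)
          (fun y => g (cinv a y) (chart_field a y v) (chart_field a y w))].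

Definition preserves {n} {A : manifold R n} (g : tensor2 A) (f : A -> A) :=
  forall x v w, g (f x) (tmap f x v) (tmap f x w) = g x v w.

Definition riemannian_submersion {m n} {A : manifold R m} {B : manifold R n}
    (gA : tensor2 A) (gB : tensor2 B) (f : A -> B) : Prop :=
  let vertical x k := tmap f x k = 0 in
  let horizontal x v := forall k, vertical x k -> gA x v k = 0 in
  [/\ smooth f,
      forall x w, exists v, tmap f x v = w &
      forall x v w, horizontal x v -> horizontal x w ->
        gB (f x) (tmap f x v) (tmap f x w) = gA x v w].

(* Velocities at the finitely many break points of a piecewise smooth curve
   may be meaningless; they do not affect the integral. *)
Definition curve_length {n} {A : manifold R n} (g : tensor2 A)
    (c : R -> A) (a b : R) : \bar R :=
  (\int[lebesgue_measure]_(t in `[a, b])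
     (Num.sqrt (g (c t) (velocity c t) (velocity c t)))%:E)%E.

Definition riem_dist {n} {A : manifold R n} (g : tensor2 A) (x y : A) :
    \bar R :=
  ereal_inf [set l | exists c a b,
    [/\ pw_smooth (fun _ _ => True) c a b, c a = x, c b = y &
        l = curve_length g c a b]].

(* Carnot-Caratheodory distance on S: infimum of the g-lengths of the curves
   contained in S whose velocities satisfy H. *)
Definition cc_dist {n} {A : manifold R n} (g : tensor2 A)
    (H : A -> 'rV[R]_n -> Prop) (S : set A) (x y : A) : \bar R :=
  ereal_inf [set l | exists c a b,
    [/\ pw_smooth H c a b, forall t, a <= t <= b -> S (c t),
        c a = x, c b = y & l = curve_length g c a b]].

Definition diameter {X : Type} (S : set X) (d : X -> X -> \bar R) : \bar R :=
  ereal_sup [set l | exists x y, [/\ S x, S y & l = d x y]].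

Definition correspondence {X Y : Type} (C : set (X * Y)) : Prop :=
  (forall x, exists y, C (x, y)) /\ (forall y, exists x, C (x, y)).

Definition distortion {X Y : Type} (dX : X -> X -> \bar R)
    (dY : Y -> Y -> \bar R) (C : set (X * Y)) : \bar R :=
  ereal_sup [set l | exists x x' y y',
    [/\ C (x, y), C (x', y') & l = `|dX x x' - dY y y'|%E]].

Definition GH_dist {X Y : Type} (dX : X -> X -> \bar R)
    (dY : Y -> Y -> \bar R) : \bar R :=
  ((2^-1)%:E * ereal_inf [set distortion dX dY C | C in correspondence])%E.

End Metrics.

Section Bundles.
Context (R : realType).

Record lie_group (k : nat) := LieGroup {
  lie_manifold :> manifold R k;
  lmul : lie_manifold -> lie_manifold -> lie_manifold;
  linv : lie_manifold -> lie_manifold;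
  lone : lie_manifold;
  lmulA : associative lmul;
  lmul1 : left_id lone lmul;
  lmulV : left_inverse lone linv lmul;
  lmul_smooth : smooth2 lmul;
  linv_smooth : smooth linv
}.

Definition Ad {k} {G : lie_group k} (g : G) : 'rV[R]_k -> 'rV[R]_k :=
  tmap (fun h : G => lmul (lmul g h) (linv g)) (lone G).

Definition biinvariant {k} {G : lie_group k} (b : tensor2 G) : Prop :=
  [/\ riemannian b,
      forall g, preserves b (fun h => lmul g h) &
      forall g, preserves b (fun h => lmul h g)].

Record principal_bundle {p m k} (P : manifold R p) (M : manifold R m)
    (G : lie_group k) := PrincipalBundle {
  bproj : P -> M;
  bact : P -> G -> P;
  bproj_smooth : smooth bproj;
  bact_smooth : smooth2 bact;
  bact1 : forall x, bact x (lone G) = x;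
  bactM : forall x g h, bact x (lmul g h) = bact (bact x g) h;
  bact_free : forall x g, bact x g = x -> g = lone G;
  bproj_act : forall x g, bproj (bact x g) = bproj x;
  (* local triviality: (bproj, chi) is an equivariant diffeomorphism from
     bproj @^-1` U onto U * G, with inverse psi *)
  btrivial : forall z : M, exists (U : set M) (chi : P -> G) (psi : M -> G -> P),
    [/\ open U, U z, smooth_on (bproj @^-1` U) chi &
        smooth2_on (U `*` setT) psi] /\
    [/\ forall x, U (bproj x) -> psi (bproj x) (chi x) = x,
        forall y g, U y -> bproj (psi y g) = y /\ chi (psi y g) = g &
        forall x g, U (bproj x) -> chi (bact x g) = lmul (chi x) g]
}.

Section Connection.
Context {p m k : nat} {P : manifold R p} {M : manifold R m} {G : lie_group k}.
Context (E : principal_bundle P M G).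

(* The Lie algebra of G is the tangent space at lone G, in coordinates. The
   fundamental field of xi at x is the derivative at 0 of t |-> x exp(t xi),
   i.e. the image of xi under the tangent map at lone G of g |-> x g. *)
Definition principal_connection
    (theta : P -> {linear 'rV[R]_p -> 'rV[R]_k}) : Prop :=
  [/\ forall a, atlas a -> forall v : 'rV[R]_p,
        Cinf (cmap a @` cdom a)
          (fun y => theta (cinv a y) (chart_field a y v)),
      forall g x v, theta (bact E x g) (tmap (fun z => bact E z g) x v) =
                    Ad (linv g) (theta x v) &
      forall x xi, theta x (tmap (fun g => bact E x g) (lone G) xi) = xi].

Context (theta : P -> {linear 'rV[R]_p -> 'rV[R]_k}).

Definition horizontal (x : P) (v : 'rV[R]_p) : Prop := theta x v = 0.

Definition hjoined (x y : P) : Prop :=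
  exists c a b, [/\ pw_smooth horizontal c a b, c a = x & c b = y].

Definition holonomy_group (u : P) : set G := [set g | hjoined u (bact E u g)].

Definition holonomy_bundle (u : P) : set P := [set x | hjoined u x].

(* pi^* gM + <theta, theta> *)
Definition bundle_metric (gM : tensor2 M) (b : tensor2 G) : tensor2 P :=
  fun x v w =>
    gM (bproj E x) (tmap (bproj E) x v) (tmap (bproj E) x w) +
    b (lone G) (theta x v) (theta x w).

End Connection.

(* pr : G -> Q presents Q as the manifold of left cosets G / H, with the smooth
   structure (unique, and existing for H closed) making pr a submersion. *)
Definition coset_manifold {k q} {G : lie_group k} (H : set G)
    {Q : manifold R q} (pr : G -> Q) : Prop :=
  [/\ smooth pr,
      forall y, exists g, pr g = y,
      forall g h, pr g = pr h <-> H (lmul (linv g) h) &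
      forall g w, exists v, tmap pr g v = w].

(* Invariance under the left translations pr g |-> pr (h g) of G / H. *)
Definition translation_invariant {k q} {G : lie_group k} {Q : manifold R q}
    (pr : G -> Q) (gQ : tensor2 Q) : Prop :=
  forall (h : G) (f : Q -> Q), (forall g, f (pr g) = pr (lmul h g)) ->
    preserves gQ f.

End Bundles.

(* Main.v *)
(* Put H = Hol_u. Sending x to g H, where x g lies in the holonomy bundle P_u,
   defines a map F from P onto G/H whose fibres are the translates of P_u; it is
   defined everywhere because curves in M lift horizontally and M is connected.
   The graph of F is a correspondence of distortion at most D, the diameter of
   P_u for the Carnot-Caratheodory distance:
   - F does not increase lengths. Locally a curve c in P is h g with h
     horizontal and g in G, so F c = pr (g^-1 g1) with g1 constant, and the
     speed of g is that of the theta-part of c'.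
   - Conversely a curve in G/H lifts horizontally to a curve h in G, and then
     t |-> x h(a) h(t)^-1 is a curve in P of the same length lying over it. It
     ends in the fibre of F of the prescribed end point; two points of one fibre
     are joined by a right translate of a horizontal curve of P_u, and right
     translations preserve the lengths of horizontal curves, so this costs at
     most D more. *)

Require Import Defs.
From HB Require Import structures.
From mathcomp Require Import all_boot all_order all_algebra.
From mathcomp Require Import all_classical all_reals all_analysis.
From mathcomp Require Import ring lra measurable_realfun.

Set Implicit Arguments.
Unset Strict Implicit.
Unset Printing Implicit Defensive.

Import Order.TTheory GRing.Theory Num.Theory.
Import numFieldNormedType.Exports.

Local Open Scope classical_set_scope.
Local Open Scope ring_scope.

(** * Functions of class C^k near a point *)

(** The map F is never differentiated, and the holonomy bundle gets no manifold structure: F is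
    tested only along smooth curves of P, where the formula pr (g^-1 g1) shows both smoothness and
    speed. Lifts exist only near a parameter value, as solutions of h' = g' L(h) in a chart, with L
    a smooth right inverse supplied by linear algebra; they are chained along the interval by a
    supremum argument. Chaining requires a neighbourhood that does not depend on the starting point,
    and symmetry provides it: a horizontal lift in P can be translated by G to any other point of
    the fibre, and one lift h of a curve of G/H serves every x, because x enters only through x h(a)
    h(t)^-1. Distances are extended reals; the one on G/H is finite because G, hence G/H, is
    connected, which allows the two inequalities to be read as a bound on a difference. *)

Lemma near_comp (T S : topologicalType) (f : T -> S) (x : T) (P : set S) :
  {for x, continuous f} -> (\forall z \near f x, P z) -> \forall y \near x, P (f y).
Proof. exact. Qed.

Section Regularity.
Context {R : realType}.
Implicit Types U V W : normedModType R.

(** A first-order expansion of f at x is also one of g, and the expansion determines the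
    differential. *)
Lemma near_differentiable V W (f g : V -> W) (x : V) :
  (\forall y \near x, f y = g y) -> differentiable f x ->
  differentiable g x /\ 'd g x = 'd f x :> (V -> W).
Proof.
move=> fg df.
have fgx : f x = g x by exact: nbhs_singleton fg.
have [cdf _] := (diff_locallyP x f).1 df.
have go : g \o shift x = cst (g x) + 'd f x +o_ 0 id.
  have /eqaddoP fo := diff_locally df.
  apply/eqaddoP => e e0; have := fo e e0.
  have fg0 : \forall h \near (0 : V), f (h + x) = g (h + x).
    by have := fg; rewrite (near_shift 0) /=; apply: filterS => h /=; rewrite subr0.
  move=> H; near=> h.
  have -> : (g \o shift x - (cst (g x) + 'd f x)) h =
            (f \o shift x - (cst (f x) + 'd f x)) h.
    rewrite !fctE /= fgx; congr (_ - _).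
    by apply/esym; near: h.
  by near: h.
have dgf := diff_unique cdf go.
split; last exact: dgf.
by apply/diff_locallyP; rewrite dgf.
Unshelve. all: by end_near. Qed.

(** Limits and differentials in [Ck] are taken in the whole space, not relative to D, so the
    condition splits over the points of D and a singleton is a meaningful domain. *)
Lemma Ck_set1 V W k (D : set V) (f : V -> W) :
  Ck k D f <-> forall x, D x -> Ck k [set x] f.
Proof.
elim: k f => [|k IH] f /=; first by split=> [H x Dx _ ->|H x Dx]; [exact: H|exact: (H x)].
split=> [[H1 H2] x Dx|H].
  by split=> [_ ->|v]; [exact: H1|have /IH := H2 v; exact].
by split=> [x Dx|v]; [have [+ _] := H x Dx; exact|apply/IH => x /H[_]; exact].
Qed.

Lemma CkW V W k (D : set V) (f : V -> W) : Ck k.+1 D f -> Ck k D f.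
Proof.
elim: k f => [|k IH] f /= [H1 H2].
  by move=> x /H1; exact: differentiable_continuous.
by split => // v; exact: IH.
Qed.

(* Outside differentiability points ['d f x] is the default element, so it
   still depends only on the germ of f. *)
Lemma not_differentiable V W (f : V -> W) (x : V) :
  ~ differentiable f x -> 'd f x = point.
Proof.
move=> ndf; rewrite /diff; apply: xgetPN => df Pdf; apply: ndf; apply/diffP.
exact: (@getPex _ (fun d : {linear V -> W} => continuous d /\ forall y,
  f y = f (lim (nbhs_filter_on x)) + d (y - lim (nbhs_filter_on x)) +o_(y \near nbhs_filter_on
    x) (y - lim (nbhs_filter_on x))) (ex_intro _ df Pdf)).
Qed.

Lemma Ck_near_eq V W k (f g : V -> W) (x : V) :
  (\forall y \near x, f y = g y) -> Ck k [set x] f -> Ck k [set x] g.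
Proof.
elim: k f g => [|k IH] f g fg /=.
  move=> /(_ x erefl) cf _ ->.
  have fgx := nbhs_singleton fg.
  rewrite /prop_for /continuous_at -fgx; apply: cvg_trans cf.
  by apply: near_eq_cvg; exact: fg.
move=> [df Cf]; split => [_ ->|v].
  by have [] := near_differentiable fg (df x erefl).
apply: IH (Cf v); move/near_join: fg; apply: filterS => y fg.
have gf : \forall z \near y, g z = f z by apply: filterS fg.
(* Being of class C^(k+1) at x alone does not make f differentiable at nearby y; where f fails to
   be, so does g, and both differentials are the default value. *)
have [dfy|ndf] := pselect (differentiable f y).
  by have [_ ->] := near_differentiable fg dfy.
rewrite (not_differentiable ndf) not_differentiable // => dg; apply: ndf.
by have [] := near_differentiable gf dg.
Qed.

(** C^k at a single point is too weak for the calculus rules: a formula for the differential must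
    hold on a neighbourhood before it can be differentiated again. *)
Definition nCk V W k (f : V -> W) (x : V) := \forall y \near x, Ck k [set y] f.

(** One neighbourhood serves all orders k; [smooth_at_nCk] reduces closure properties to those of
    [nCk]. *)
Definition smooth_at V W (f : V -> W) (x : V) :=
  \forall y \near x, forall k, Ck k [set y] f.

Lemma nCk_near V W k (f : V -> W) x : nCk k f x -> \forall y \near x, nCk k f y.
Proof. exact: near_join. Qed.

Lemma nCk_at V W k (f : V -> W) x : nCk k f x -> Ck k [set x] f.
Proof. by move/nbhs_singleton. Qed.

Lemma smooth_at_near V W (f : V -> W) x :
  smooth_at f x -> \forall y \near x, smooth_at f y.
Proof. exact: near_join. Qed.

Lemma smooth_at_nCk V W (f : V -> W) x :
  smooth_at f x <-> \forall y \near x, forall k, nCk k f y.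
Proof.
split; last by apply: filterS => y H k; exact: nbhs_singleton (H k).
by move/near_join; apply: filterS => y; rewrite /nCk => H k; apply: filterS H => z; exact.
Qed.

Lemma smooth_atW V W k (f : V -> W) x : smooth_at f x -> nCk k f x.
Proof. by apply: filterS => y; exact. Qed.

Lemma nCkW V W k (f : V -> W) x : nCk k.+1 f x -> nCk k f x.
Proof. by apply: filterS => y; exact: CkW. Qed.

Lemma nCk_differentiable V W k (f : V -> W) x :
  nCk k.+1 f x -> \forall y \near x, differentiable f y.
Proof. by apply: filterS => y [+ _]; exact. Qed.

Lemma smooth_at_differentiable V W (f : V -> W) x :
  smooth_at f x -> differentiable f x.
Proof.
by move/(smooth_atW 1)/nCk_differentiable; exact: nbhs_singleton.
Qed.

Lemma nCk0P V W (f : V -> W) x :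
  nCk 0 f x <-> \forall y \near x, {for y, continuous f}.
Proof. by split; apply: filterS => y H; [exact: (H y)|move=> _ ->]. Qed.

Lemma nCk_continuous V W k (f : V -> W) x : nCk k f x -> {for x, continuous f}.
Proof.
elim: k => [|k IH]; last by move/nCkW.
by move/nbhs_singleton; exact.
Qed.

Lemma smooth_at_continuous V W (f : V -> W) x :
  smooth_at f x -> {for x, continuous f}.
Proof. by move/(smooth_atW 0)/nCk_continuous. Qed.

Lemma nCk_diff V W k (f : V -> W) x v :
  nCk k.+1 f x -> nCk k (fun y => 'd f y v) x.
Proof. by apply: filterS => y [_]; exact. Qed.

Lemma smooth_at_diff V W (f : V -> W) x v :
  smooth_at f x -> smooth_at (fun y => 'd f y v) x.
Proof. by apply: filterS => y H k; have [_] := H k.+1; exact. Qed.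

Lemma nCk_near_eq V W k (f g : V -> W) (x : V) :
  (\forall y \near x, f y = g y) -> nCk k f x -> nCk k g x.
Proof.
move=> /near_join fg Cf; near=> y; apply: (@Ck_near_eq _ _ _ f); first by near: y.
by near: y.
Unshelve. all: by end_near. Qed.

Lemma smooth_at_near_eq V W (f g : V -> W) (x : V) :
  (\forall y \near x, f y = g y) -> smooth_at f x -> smooth_at g x.
Proof.
move=> /near_join fg Cf; near=> y => k; apply: (@Ck_near_eq _ _ _ f); first by near: y.
by move: k; near: y.
Unshelve. all: by end_near. Qed.

Lemma nCk_ind V W k (f : V -> W) (x : V) :
  (\forall y \near x, differentiable f y) ->
  (\forall y \near x, forall v, Ck k [set y] (fun y => 'd f y v)) -> nCk k.+1 f x.
Proof.
by move=> H1 H2; near=> y; split=> [_ ->|v]; [near: y|move: v; near: y].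
Unshelve. all: by end_near. Qed.

Lemma Ck_cst V W k (c : W) (x : V) : Ck k [set x] (fun=> c).
Proof.
elim: k c => [|k IH] c; first by move=> z _; exact: cvg_cst.
split => [z _|v]; first exact: differentiable_cst.
have -> : (fun y : V => 'd (fun=> c) y v) = fun=> (0 : W).
  by apply/funext => z; rewrite -[LHS]/('d (cst c) z v) diff_cst.
exact: IH.
Qed.

Lemma nCk_cst V W k (c : W) (x : V) : nCk k (fun=> c) x.
Proof. by near do exact: Ck_cst.
Unshelve. all: by end_near. Qed.

Lemma Ck_lin V W k (f : {linear V -> W}) (x : V) : continuous f -> Ck k [set x] f.
Proof.
move=> cf; case: k => [|k]; first by move=> z _; exact: cf.
split => [z _|v]; first exact: linear_differentiable.
have -> : (fun y : V => 'd f y v) = fun=> f v.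
  by apply/funext => z; rewrite (diff_lin z cf).
exact: Ck_cst.
Qed.

(** The pattern of the closure lemmas below: near each y close to x a calculus rule rewrites the
    differential into an expression covered by the induction hypothesis, and [Ck_near_eq] carries
    the regularity back. *)
Lemma nCkL U V W k (l : {linear V -> W}) (f : U -> V) (x : U) : continuous l ->
  nCk k f x -> nCk k (l \o f) x.
Proof.
move=> cl; elim: k f x => [|k IH] f x Cf.
  apply/nCk0P; move/nCk0P: Cf; apply: filterS => y Cf.
  by apply: continuous_comp; last exact: cl.
have df := nCk_differentiable Cf.
apply: nCk_ind.
  near=> y; apply: differentiable_comp; first by near: y.
  exact: linear_differentiable.
have := nCk_near Cf; apply: filterS => y Cfy v.
have dfy := nCk_differentiable Cfy.
apply: (@Ck_near_eq _ _ _ (l \o (fun z => 'd f z v))); last first.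
  by apply: nCk_at; apply: IH; exact: nCk_diff.
near=> z; rewrite diff_comp ?diff_lin //=; first by near: z.
exact: linear_differentiable.
Unshelve. all: by end_near. Qed.

Lemma nCkD V W k (f g : V -> W) (x : V) :
  nCk k f x -> nCk k g x -> nCk k (fun y => f y + g y) x.
Proof.
elim: k f g x => [|k IH] f g x Cf Cg.
  move/nCk0P: Cf => Cf; move/nCk0P: Cg => Cg; apply/nCk0P.
  by near=> y; apply: cvgD; near: y.
have df := nCk_differentiable Cf; have dg := nCk_differentiable Cg.
apply: nCk_ind.
  by near=> y; apply: differentiableD; near: y.
near=> y => v.
have Cfy : nCk k.+1 f y by near: y; exact: nCk_near.
have Cgy : nCk k.+1 g y by near: y; exact: nCk_near.
apply: (@Ck_near_eq _ _ _ (fun z => 'd f z v + 'd g z v)); last first.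
  by apply: nCk_at; apply: IH; exact: nCk_diff.
have dfy := nCk_differentiable Cfy; have dgy := nCk_differentiable Cgy.
by near=> z; rewrite diffD //; near: z.
Unshelve. all: by end_near. Qed.

Lemma scaler_bilinear W : bilinear_for
  (GRing.Scale.Law.clone _ _ *:%R _) (GRing.Scale.Law.clone _ _ *:%R _)
  (fun (r : R) (w : W) => r *: w).
Proof.
split=> [u'|u] a x y /=.
- by rewrite scalerDl scalerA.
- by rewrite scalerDr !scalerA mulrC.
Qed.

(** Scaling is a continuous bilinear map, so the product is its composite with y |-> (a y, f y) and
    the Leibniz rule is the chain rule. *)
Lemma is_diffZr V W (a : V -> R) (f : V -> W) (x : V) :
  differentiable a x -> differentiable f x ->
  differentiable (fun y => a y *: f y) x /\
  forall v, 'd (fun y => a y *: f y) x v = 'd a x v *: f x + a x *: 'd f x v.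
Proof.
move=> da df.
pose sb := bilinear_isBilinear.Build R R W W _ _ _ (scaler_bilinear W).
pose s : {bilinear R -> W -> W} := HB.pack (fun (r : R) (w : W) => r *: w) sb.
have cs : continuous (fun p : R * W => s p.1 p.2) by exact: scale_continuous.
have ds := differentiable_bilin (a x, f x) cs.
have dp : differentiable (fun y => (a y, f y)) x by exact: differentiable_pair.
split; first exact: (differentiable_comp dp ds).
move=> v; rewrite -[LHS]/('d ((fun p : R * W => s p.1 p.2) \o (fun y => (a y, f y))) x v).
by rewrite diff_comp // diff_bilin // diff_pair //= addrC.
Qed.

Lemma nCkZ V W k (a : V -> R) (f : V -> W) (x : V) :
  nCk k a x -> nCk k f x -> nCk k (fun y => a y *: f y) x.
Proof.
elim: k a f x => [|k IH] a f x Ca Cf.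
  move/nCk0P: Cf => Cf; move/nCk0P: Ca => Ca; apply/nCk0P.
  by near=> y; apply: cvgZ; near: y.
have df := nCk_differentiable Cf; have da := nCk_differentiable Ca.
apply: nCk_ind.
  by near=> y; apply: (is_diffZr _ _).1; near: y.
near=> y => v.
have Cfy : nCk k.+1 f y by near: y; exact: nCk_near.
have Cay : nCk k.+1 a y by near: y; exact: nCk_near.
apply: (@Ck_near_eq _ _ _ (fun z => 'd a z v *: f z + a z *: 'd f z v)); last first.
  apply: nCk_at; apply: nCkD; apply: IH; try exact: nCk_diff; exact: nCkW.
have dfy := nCk_differentiable Cfy; have day := nCk_differentiable Cay.
by near=> z; rewrite (is_diffZr _ _).2 //; near: z.
Unshelve. all: by end_near. Qed.

Lemma near_neq0 V (a : V -> R) (x : V) :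
  a x != 0 -> {for x, continuous a} -> \forall y \near x, a y != 0.
Proof.
by move=> ax ca; apply: (ca [set r | r != 0]); apply: open_nbhs_nbhs; split => //; exact: open_neq.
Qed.

Lemma nCkV V k (a : V -> R) (x : V) :
  a x != 0 -> nCk k a x -> nCk k (fun y => (a y)^-1) x.
Proof.
elim: k a x => [|k IH] a x ax Ca.
  have a0 := near_neq0 ax (nCk_continuous Ca).
  move/nCk0P: Ca => Ca; apply/nCk0P.
  by near=> y; apply: cvgV; near: y.
have da := nCk_differentiable Ca.
have a0 := near_neq0 ax (nCk_continuous Ca).
apply: nCk_ind.
  by near=> y; apply: differentiableV; near: y.
have a0' := near_join a0.
near=> y => v.
have Cay : nCk k.+1 a y by near: y; exact: nCk_near.
(* The factor a^-2 is written as a product of two inverses so that the induction hypothesis applies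
   to each. *)
apply: (@Ck_near_eq _ _ _ (fun z => ((-1) * ((a z)^-1 * (a z)^-1)) *: 'd a z v)); last first.
  have ? : nCk k (fun z => (a z)^-1) y by apply: IH (nCkW Cay); near: y.
  apply: nCk_at; apply: (@nCkZ V R^o); last exact: nCk_diff.
  apply: (@nCkZ _ R^o); first exact: nCk_cst.
  by apply: (@nCkZ _ R^o).
have day := nCk_differentiable Cay.
have a0y : \forall z \near y, a z != 0 by near: y.
near=> z; rewrite diffV //; try by near: z.
by rewrite mulN1r /= expr2 invfM.
Unshelve. all: by end_near. Qed.

Lemma nCk_sum V W k n (f : 'I_n -> V -> W) (x : V) :
  (forall i, nCk k (f i) x) -> nCk k (fun y => \sum_i f i y) x.
Proof.
elim: n f => [|n IH] f Cf.
  by under eq_fun do rewrite big_ord0; exact: nCk_cst.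
by under eq_fun do rewrite big_ord_recl; apply: nCkD => //; exact: IH.
Qed.

Lemma nCkM V k (a b : V -> R) (x : V) :
  nCk k a x -> nCk k b x -> nCk k (fun y => a y * b y) x.
Proof. exact: (@nCkZ _ R^o). Qed.

Lemma coord_linear m n (i : 'I_m) (j : 'I_n) :
  linear (fun M : 'M[R]_(m, n) => M i j).
Proof. by move=> a A B; rewrite !mxE. Qed.

Definition mxcoord m n (i : 'I_m) (j : 'I_n) : {linear 'M[R]_(m, n) -> R} :=
  HB.pack (fun M : 'M[R]_(m, n) => M i j)
    (GRing.isLinear.Build _ _ _ _ _ (coord_linear i j)).

Lemma mxcoord_continuous m n (i : 'I_m) (j : 'I_n) : continuous (mxcoord i j).
Proof. exact: coord_continuous. Qed.

Lemma nCk_coord V k m n (f : V -> 'M[R]_(m, n)) (x : V) i j :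
  nCk k f x -> nCk k (fun y => f y i j) x.
Proof. exact: (nCkL (@mxcoord_continuous m n i j)). Qed.

Lemma nCk_mx V k m n (f : V -> 'M[R]_(m, n)) (x : V) :
  (forall i j, nCk k (fun y => f y i j) x) -> nCk k f x.
Proof.
move=> Cf; rewrite (_ : f = fun y => \sum_i \sum_j f y i j *: delta_mx i j); last first.
  by apply/funext => y; exact: matrix_sum_delta.
by apply: nCk_sum => i; apply: nCk_sum => j; apply: nCkZ => //; exact: nCk_cst.
Qed.

Lemma nCk_mulmx V k m n p (f : V -> 'M[R]_(m, n)) (g : V -> 'M[R]_(n, p)) (x : V) :
  nCk k f x -> nCk k g x -> nCk k (fun y => f y *m g y) x.
Proof.
move=> Cf Cg; apply: nCk_mx => i j; under eq_fun do rewrite mxE.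
by apply: nCk_sum => l; apply: nCkM; exact: nCk_coord.
Qed.

Lemma nCk_trmx V k m n (f : V -> 'M[R]_(m, n)) (x : V) :
  nCk k f x -> nCk k (fun y => (f y)^T) x.
Proof.
by move=> Cf; apply: nCk_mx => i j; under eq_fun do rewrite mxE; exact: nCk_coord.
Qed.

Lemma nCk_det V k n (f : V -> 'M[R]_n) (x : V) :
  nCk k f x -> nCk k (fun y => \det (f y)) x.
Proof.
elim: n f => [|n IH] f Cf.
  by under eq_fun do rewrite det_mx00; exact: nCk_cst.
under eq_fun do rewrite (expand_det_row _ ord0).
apply: nCk_sum => j; apply: nCkM; first exact: nCk_coord.
apply: nCkM; first exact: nCk_cst.
by apply: IH; apply: nCk_mx => i l; under eq_fun do rewrite !mxE; exact: nCk_coord.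
Qed.

(** Cramer's formula, which computes [invmx] only where the determinant is nonzero; this persists
    near x by continuity. *)
Lemma nCk_invmx V k n (f : V -> 'M[R]_n) (x : V) :
  f x \in unitmx -> nCk k f x -> nCk k (fun y => invmx (f y)) x.
Proof.
rewrite unitmxE unitfE => fx Cf.
have Cd := nCk_det Cf.
have H : nCk k (fun y => (\det (f y))^-1 *: \adj (f y)) x.
  apply: nCkZ; first exact: nCkV.
  apply: nCk_mx => i j; under eq_fun do rewrite mxE.
  apply: nCkM; first exact: nCk_cst.
  by apply: nCk_det; apply: nCk_mx => i' l; under eq_fun do rewrite !mxE; exact: nCk_coord.
apply: nCk_near_eq H; have := @near_neq0 _ (fun y => \det (f y)) x fx (nCk_continuous Cd).
by apply: filterS => y dy; rewrite /invmx unitmxE unitfE dy.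
Qed.

Lemma nCk_pair U V W k (f : U -> V) (g : U -> W) (x : U) :
  nCk k f x -> nCk k g x -> nCk k (fun y => (f y, g y)) x.
Proof.
elim: k f g x => [|k IH] f g x Cf Cg.
  move/nCk0P: Cf => Cf; move/nCk0P: Cg => Cg; apply/nCk0P.
  by near=> y; apply: cvg_pair; near: y.
have df := nCk_differentiable Cf; have dg := nCk_differentiable Cg.
apply: nCk_ind.
  by near=> y; apply: differentiable_pair; near: y.
near=> y => v.
have Cfy : nCk k.+1 f y by near: y; exact: nCk_near.
have Cgy : nCk k.+1 g y by near: y; exact: nCk_near.
apply: (@Ck_near_eq _ _ _ (fun z => ('d f z v, 'd g z v))); last first.
  by apply: nCk_at; apply: IH; exact: nCk_diff.
have dfy := nCk_differentiable Cfy; have dgy := nCk_differentiable Cgy.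
by near=> z; rewrite diff_pair //; near: z.
Unshelve. all: by end_near. Qed.

(* The spaces through which [nCk] functions can be composed: continuous
   coordinates turn the chain rule into a finite sum. *)
Definition has_coords V := exists (n : nat) (e : 'I_n -> V)
  (phi : 'I_n -> {linear V -> R}), (forall i, continuous (phi i)) /\
  forall z, z = \sum_i phi i z *: e i.

Lemma has_coordsR : has_coords R.
Proof.
exists 1%N, (fun=> 1), (fun=> [the {linear R -> R} of idfun]); split=> [i x|z].
  exact: cvg_id.
by rewrite big_ord1 /= [_ *: _]mulr1.
Qed.

Lemma has_coords_mx m n : has_coords 'M[R]_(m, n).
Proof.
exists #|{: 'I_m * 'I_n}|, (fun k => let: (i, j) := enum_val k in delta_mx i j).
exists (fun k => mxcoord (enum_val k).1 (enum_val k).2); split=> [k|z].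
  exact: mxcoord_continuous.
rewrite [LHS]matrix_sum_delta pair_big /= (reindex (fun k : 'I_#|{: 'I_m * 'I_n}| =>
  enum_val k)) /=; last first.
  by apply: onW_bij; exact: enum_val_bij.
by apply: eq_bigr => k _; case: (enum_val k).
Qed.

Lemma has_coords_prod V W : has_coords V -> has_coords W -> has_coords (V * W)%type.
Proof.
move=> [n [e [phi [cphi He]]]] [m [e' [phi' [cphi' He']]]].
pose l1 i : {linear (V * W)%type -> R} := [the {linear _ -> _} of phi i \o fst].
pose l2 i : {linear (V * W)%type -> R} := [the {linear _ -> _} of phi' i \o snd].
exists (n + m)%N, (fun i => match fintype.split i with inl j => (e j, 0) | inr j => (0, e' j) end).
exists (fun i => match fintype.split i with inl j => l1 j | inr j => l2 j end); split=> [i|[z w]].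
  case: (fintype.split i) => j z.
    by apply: continuous_comp; [exact: cvg_fst|exact: cphi].
  by apply: continuous_comp; [exact: cvg_snd|exact: cphi'].
rewrite big_split_ord /=.
under eq_bigr do rewrite (unsplitK (inl _)) /=.
under [X in _ = _ + X]eq_bigr do rewrite (unsplitK (inr _)) /=.
rewrite [in LHS](He z) [in LHS](He' w).
rewrite [RHS]surjective_pairing; congr pair.
  rewrite /= !(raddf_sum fst) /= [X in _ + X]big1 ?addr0 // => i _.
  by rewrite scaler0.
rewrite /= !(raddf_sum snd) /= [X in X + _]big1 ?add0r // => i _.
by rewrite scaler0.
Qed.

Lemma nCk_comp U V W k (f : U -> V) (g : V -> W) (x : U) : has_coords V ->
  nCk k f x -> nCk k g (f x) -> nCk k (g \o f) x.
Proof.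
move=> [n [e [phi [cphi He]]]]; elim: k f g x => [|k IH] f g x Cf Cg.
  have cf := nCk_continuous Cf.
  move/nCk0P: Cf => Cf; move/nCk0P: Cg => /cf Cg; apply/nCk0P.
  by near=> y; apply: continuous_comp; near: y.
have cf := nCk_continuous Cf.
have df := nCk_differentiable Cf; have /cf dg := nCk_differentiable Cg.
apply: nCk_ind.
  by near=> y; apply: differentiable_comp; near: y.
near=> y => v.
have Cfy : nCk k.+1 f y by near: y; exact: nCk_near.
have Cgy : nCk k.+1 g (f y) by near: y; exact: (cf _ (nCk_near Cg)).
(* [nCk_diff] controls differentials of g along fixed vectors only, whereas 'd f z v moves with z:
   its coordinates become scalar factors, and g is differentiated along the fixed e i. *)
apply: (@Ck_near_eq _ _ _
  (fun z => \sum_i phi i ('d f z v) *: ('d g (f z) (e i)))); last first.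
  apply: nCk_at; apply: nCk_sum => i; apply: nCkZ.
    by apply: (nCkL (cphi i)); exact: nCk_diff.
  by apply: (IH f (fun z => 'd g z (e i))); [exact: nCkW|exact: nCk_diff].
have dfy := nCk_differentiable Cfy.
have dgy : \forall z \near y, differentiable g (f z).
  exact: (near_comp (nCk_continuous Cfy) (nCk_differentiable Cgy)).
near=> z.
have -> : 'd (g \o f) z v = 'd g (f z) ('d f z v).
  by rewrite diff_comp //; near: z.
rewrite [X in _ = 'd g (f z) X]He linear_sum.
by apply: eq_bigr => i _; rewrite linearZ.
Unshelve. all: by end_near. Qed.

End Regularity.

(** * Smooth maps between normed spaces *)

Section SmoothAt.
Context {R : realType}.
Implicit Types U V W : normedModType R.

Lemma Cinf_smooth_at V W (D : set V) (f : V -> W) (x : V) :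
  nbhs x D -> Cinf D f -> smooth_at f x.
Proof. by move=> Dx Df; apply: filterS Dx => y Dy k; have /Ck_set1 := Df k; exact. Qed.

Lemma smooth_at_Cinf V W (D : set V) (f : V -> W) :
  (forall x, D x -> smooth_at f x) -> Cinf D f.
Proof.
by move=> Df k; apply/Ck_set1 => x /Df /(smooth_atW k); exact: nCk_at.
Qed.

Lemma smooth_at_comp U V W (f : U -> V) (g : V -> W) (x : U) : has_coords V ->
  smooth_at f x -> smooth_at g (f x) -> smooth_at (g \o f) x.
Proof.
move=> cV /[dup] /smooth_at_continuous cf /smooth_at_nCk Cf /smooth_at_nCk Cg.
have {}Cg := near_comp cf Cg.
apply/smooth_at_nCk; near=> y => k; apply: nCk_comp => //.
  by move: k; near: y.
by move: k; near: y.
Unshelve. all: by end_near. Qed.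

Lemma smooth_at_pair U V W (f : U -> V) (g : U -> W) (x : U) :
  smooth_at f x -> smooth_at g x -> smooth_at (fun y => (f y, g y)) x.
Proof.
move=> /smooth_at_nCk Cf /smooth_at_nCk Cg; apply/smooth_at_nCk; near=> y => k.
by apply: nCk_pair; move: k; near: y.
Unshelve. all: by end_near. Qed.

Lemma smooth_at_cst V W (c : W) (x : V) : smooth_at (fun=> c) x.
Proof. by near=> y => k; exact: Ck_cst.
Unshelve. all: by end_near. Qed.

Lemma smooth_at_derive1 V (f : R -> V) (t : R) :
  smooth_at f t -> smooth_at (derive1 f) t.
Proof.
move=> Cf; apply: (@smooth_at_near_eq _ _ _ (fun s => 'd f s 1)); last exact: smooth_at_diff.
have := smooth_at_near Cf; apply: filterS => s Cfs.
by rewrite derive1E' //; exact: smooth_at_differentiable.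
Qed.

Lemma derive1_chain V W (f : R -> V) (g : V -> W) (t : R) :
  differentiable f t -> differentiable g (f t) ->
  derive1 (g \o f) t = 'd g (f t) (derive1 f t).
Proof.
move=> df dg; rewrite (derive1E' (differentiable_comp df dg)) (derive1E' df).
by rewrite (diff_comp df dg).
Qed.

Lemma near_derive1 V (f g : R -> V) (t : R) :
  (\forall s \near t, f s = g s) -> derive1 f t = derive1 g t.
Proof. by move=> fg; rewrite !derive1E; apply: near_eq_derive. Qed.

Lemma nCk_id V k (x : V) : nCk k (fun y => y) x.
Proof. by near=> y; apply: (@Ck_lin _ _ _ _ [the {linear V -> V} of idfun]) => z; exact: cvg_id.
Unshelve. all: by end_near. Qed.

Lemma line_smooth n (w v : 'rV[R]_n) (t : R) :
  smooth_at (fun s : R => w + s *: v) t /\ derive1 (fun s : R => w + s *: v) t = v.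
Proof.
split.
  near=> s => k; apply: nCk_at; apply: nCkD; first exact: nCk_cst.
  by apply: nCkZ; [exact: nCk_id|exact: nCk_cst].
have D : is_diff t (cst w + ( *:%R^~ v)) (0 + ( *:%R^~ v)) by exact: is_diffD.
rewrite -[X in derive1 X _]/(cst w + ( *:%R^~ v)) derive1E' // diff_val.
by rewrite /= !fctE add0r scale1r.
Unshelve. all: by end_near. Qed.

End SmoothAt.

(** * Smooth curves and maps in charts *)

Section Charts.
Context {R : realType}.
Context {n : nat} {A : manifold R n}.

Lemma chart_near (a : chart R A n) (x : A) : cdom a x -> \forall y \near x, cdom a y.
Proof. by move=> ax; apply: open_nbhs_nbhs; split => //; exact: cdom_open. Qed.

Lemma cmap_cvg (a : chart R A n) (x : A) : cdom a x -> {for x, continuous (cmap a)}.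
Proof. exact: cmap_continuous. Qed.

Lemma cinv_cvg (a : chart R A n) (x : A) : cdom a x ->
  {for cmap a x, continuous (cinv a)}.
Proof. by move=> ax; apply: cinv_continuous; exists x. Qed.

Lemma cinv_near (a : chart R A n) (x : A) (P : set A) : cdom a x ->
  (\forall y \near x, P y) -> \forall z \near cmap a x, P (cinv a z).
Proof.
by move=> ax Px; apply: near_comp (cinv_cvg ax) _; rewrite cmapK.
Qed.

Lemma crange_near (a : chart R A n) (x : A) : cdom a x ->
  \forall z \near cmap a x, cdom a (cinv a z) /\ cmap a (cinv a z) = z.
Proof.
move=> ax; have : open_nbhs (cmap a x) (cmap a @` cdom a).
  by split; [exact: crange_open|exists x].
move/open_nbhs_nbhs; apply: filterS => z [y ay <-].
by rewrite cmapK.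
Qed.

Lemma transition_smooth (a b : chart R A n) (x : A) : atlas a -> atlas b ->
  cdom a x -> cdom b x -> smooth_at (cmap b \o cinv a) (cmap a x).
Proof.
move=> Aa Ab ax bx; apply: Cinf_smooth_at (atlas_compatible Aa Ab).
have := cinv_near ax (chart_near bx).
have := crange_near ax; apply: filterS2 => z [az za] bz.
by exists (cinv a z).
Qed.

(** One chart suffices, since [curve_smooth_chart] passes to any other. Continuity is a clause of
    its own because [cmap a] is arbitrary outside [cdom a], so smoothness of [cmap a \o c] would not
    keep c in the domain. *)
Definition curve_smooth_at (c : R -> A) (t : R) :=
  {for t, continuous c} /\
  exists a, [/\ atlas a, cdom a (c t) & smooth_at (cmap a \o c) t].

Lemma curve_smooth_chart (c : R -> A) (t : R) (b : chart R A n) :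
  curve_smooth_at c t -> atlas b -> cdom b (c t) -> smooth_at (cmap b \o c) t.
Proof.
move=> [cc [a [Aa act Cc]]] Ab bct.
have Ct := transition_smooth Aa Ab act bct.
apply: smooth_at_near_eq (smooth_at_comp (has_coords_mx _ _) Cc Ct).
by have := near_comp cc (chart_near act); apply: filterS => s /= acs; rewrite cmapK.
Qed.

Lemma curve_smooth_continuous (c : R -> A) (t : R) :
  curve_smooth_at c t -> {for t, continuous c}.
Proof. by case. Qed.

Lemma curve_smooth_near (c : R -> A) (t : R) :
  curve_smooth_at c t -> \forall s \near t, curve_smooth_at c s.
Proof.
move=> [cc [a [Aa act Cc]]].
have acs := near_comp cc (chart_near act).
have acss := near_join acs.
have Cs := smooth_at_near Cc.
near=> s.
have as_ : cdom a (c s) by near: s.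
have Cas : smooth_at (cmap a \o c) s by near: s.
split; last by exists a; split.
have H : \forall z \near s, (cinv a \o (cmap a \o c)) z = c z.
  by near: s; apply: filterS acss => s; apply: filterS => z /= az; rewrite cmapK.
have : {for s, continuous (cinv a \o (cmap a \o c))}.
  apply: continuous_comp; first exact: smooth_at_continuous.
  exact: cinv_cvg.
rewrite /prop_for /continuous_at /= cmapK //.
by apply: cvg_trans; apply: near_eq_cvg; apply: filterS H => z.
Unshelve. all: by end_near. Qed.

Lemma curve_smooth_near_eq (c d : R -> A) (t : R) :
  (\forall s \near t, c s = d s) -> curve_smooth_at c t -> curve_smooth_at d t.
Proof.
move=> cd [cc [a [Aa act Cc]]]; have cdt := nbhs_singleton cd.
split; last first.
  exists a; split => //; first by rewrite -cdt.
  by apply: smooth_at_near_eq Cc; apply: filterS cd => s /= ->.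
rewrite /prop_for /continuous_at -cdt; apply: cvg_trans cc.
by apply: near_eq_cvg; exact: cd.
Qed.

Lemma smooth_curve_onP (D : set R) (c : R -> A) : open D ->
  smooth_curve_on D c <-> forall t, D t -> curve_smooth_at c t.
Proof.
move=> oD; split=> [[cc Cc] t Dt|H].
  split; first exact: cc.
  exists (chart_at (c t)).
  split; [exact: chart_at_atlas|exact: chart_at_dom|].
  apply: Cinf_smooth_at (Cc _ (chart_at_atlas _)).
  apply: filterI; first exact: open_nbhs_nbhs.
  by apply: near_comp (cc t Dt) _; apply: chart_near; exact: chart_at_dom.
split=> [t /H[]//|a Aa]; apply: smooth_at_Cinf => t [/H Ct at_].
exact: curve_smooth_chart.
Qed.

Lemma curve_smooth_cinv (a : chart R A n) (x : A) (c : R -> 'rV[R]_n) (t : R) :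
  atlas a -> cdom a x -> c t = cmap a x -> smooth_at c t ->
  curve_smooth_at (cinv a \o c) t /\
  \forall s \near t, cdom a (cinv a (c s)) /\ cmap a (cinv a (c s)) = c s.
Proof.
move=> Aa ax ct Cc.
have H : \forall s \near t, cdom a (cinv a (c s)) /\ cmap a (cinv a (c s)) = c s.
  apply: (@near_comp _ _ c t (fun z => cdom a (cinv a z) /\ cmap a (cinv a z) = z)).
    exact: smooth_at_continuous.
  by rewrite ct; exact: crange_near.
split => //; split.
  apply: continuous_comp; first exact: smooth_at_continuous.
  by rewrite ct; exact: cinv_cvg.
exists a; split => //; first by have [] := nbhs_singleton H.
by apply: smooth_at_near_eq Cc; apply: filterS H => s /= [_ ->].
Qed.

(** [velocity] is read in a chart that changes with the point; comparing velocities at different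
    times needs one fixed chart, reached through the derivative of a transition map. *)
Lemma velocity_chart (c : R -> A) (t : R) (a : chart R A n) :
  curve_smooth_at c t -> atlas a -> cdom a (c t) ->
  velocity c t = chart_field a (cmap a (c t)) (derive1 (cmap a \o c) t).
Proof.
move=> Cc Aa act; rewrite /velocity /chart_field cmapK //.
have Ct := transition_smooth Aa (chart_at_atlas (c t)) act (chart_at_dom (c t)).
rewrite -[cmap a (c t)]/((cmap a \o c) t) -derive1_chain //; last 2 first.
- by apply: smooth_at_differentiable; exact: curve_smooth_chart.
- exact: smooth_at_differentiable.
apply: near_derive1.
have := near_comp (curve_smooth_continuous Cc) (chart_near act).
by apply: filterS => s /= acs; rewrite cmapK.
Qed.

Lemma velocity_near_eq (c d : R -> A) (t : R) :
  (\forall s \near t, c s = d s) -> velocity c t = velocity d t.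
Proof.
move=> cd; rewrite /velocity (nbhs_singleton cd).
by apply: near_derive1; apply: filterS cd => s /= ->.
Qed.

Lemma curve_smooth_cst (x : A) (t : R) : curve_smooth_at (fun=> x) t.
Proof.
split; first exact: cvg_cst.
exists (chart_at x); split; [exact: chart_at_atlas|exact: chart_at_dom|].
exact: smooth_at_cst.
Qed.

Lemma velocity_cst (x : A) (t : R) : velocity (fun=> x) t = 0.
Proof. by rewrite /velocity -[_ \o _]/(cst _) derive1_cst. Qed.

(** Identities about tangent maps can thus be proved by differentiating curves. *)
Lemma velocity_surj (x : A) (v : 'rV[R]_n) :
  exists c, [/\ curve_smooth_at c 0, c 0 = x & velocity c 0 = v].
Proof.
have Aa := chart_at_atlas x; have ax := chart_at_dom x.
pose l (s : R) : 'rV[R]_n := cmap (chart_at x) x + s *: v.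
have l0 : l 0 = cmap (chart_at x) x by rewrite /l scale0r addr0.
have [Cl dl] := line_smooth (cmap (chart_at x) x) v 0.
have [Cc H] := curve_smooth_cinv Aa ax l0 Cl.
exists (cinv (chart_at x) \o l); split => //; first by rewrite /= l0 cmapK.
rewrite /velocity /= l0 cmapK //.
by rewrite -[RHS]dl; apply: near_derive1; apply: filterS H => s /= [_ ->].
Qed.

End Charts.

(** * Tangent maps and the Leibniz rule along curves *)

Section SmoothMaps.
Context {R : realType}.

Definition map_smooth_at {m n} {A : manifold R m} {B : manifold R n}
    (f : A -> B) (x : A) :=
  {for x, continuous f} /\ forall a b, atlas a -> atlas b ->
    cdom a x -> cdom b (f x) -> smooth_at (cmap b \o f \o cinv a) (cmap a x).

Lemma smooth_on_at {m n} {A : manifold R m} {B : manifold R n} (D : set A)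
    (f : A -> B) (x : A) : nbhs x D -> smooth_on D f -> map_smooth_at f x.
Proof.
move=> Dx [cf Cf]; have cfx := cf _ (nbhs_singleton Dx); split => //.
move=> a b Aa Ab ax bfx; apply: Cinf_smooth_at (Cf a b Aa Ab).
have : \forall z \near cmap a x, D (cinv a z) /\ cdom b (f (cinv a z)).
  apply: (@cinv_near _ _ _ a x (fun y => D y /\ cdom b (f y))) => //.
  by apply: filterI => //; exact: near_comp cfx (chart_near bfx).
have := crange_near ax; apply: filterS2 => z [az za] [Dz bz].
by exists (cinv a z).
Qed.

Lemma smooth_at_of {m n} {A : manifold R m} {B : manifold R n}
    (f : A -> B) (x : A) : smooth f -> map_smooth_at f x.
Proof. by apply: smooth_on_at; exact: filterT. Qed.

Lemma curve_smooth_comp {m n} {A : manifold R m} {B : manifold R n}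
    (f : A -> B) (c : R -> A) (t : R) :
  curve_smooth_at c t -> map_smooth_at f (c t) ->
  curve_smooth_at (f \o c) t /\
  velocity (f \o c) t = tmap f (c t) (velocity c t).
Proof.
move=> Cc [cf Cf]; have [cc _] := Cc.
pose a := chart_at (c t); pose b := chart_at (f (c t)).
have Aa : atlas a := chart_at_atlas _; have act : cdom a (c t) := chart_at_dom _.
have Ab : atlas b := chart_at_atlas _; have bfct : cdom b (f (c t)) := chart_at_dom _.
have Cca := curve_smooth_chart Cc Aa act.
have Cfab := Cf a b Aa Ab act bfct.
have H : \forall s \near t, ((cmap b \o f \o cinv a) \o (cmap a \o c)) s = (cmap b \o (f \o c)) s.
  by have := near_comp cc (chart_near act); apply: filterS => s /= acs; rewrite cmapK.
split; first split.
- exact: continuous_comp.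
- exists b; split => //; apply: smooth_at_near_eq H _.
  exact: smooth_at_comp (has_coords_mx _ _) Cca Cfab.
- rewrite /velocity /tmap -/a -/b -[cmap a (c t)]/((cmap a \o c) t) -derive1_chain //; last 2 first.
  + exact: smooth_at_differentiable.
  + exact: smooth_at_differentiable.
  by apply: near_derive1; apply: filterS H => s.
Qed.

Definition map2_smooth_at {m n k} {A : manifold R m} {B : manifold R n}
    {C : manifold R k} (f : A -> B -> C) (x : A) (y : B) :=
  {for (x, y), continuous (fun z : A * B => f z.1 z.2)} /\
  forall a b c, atlas a -> atlas b -> atlas c ->
    cdom a x -> cdom b y -> cdom c (f x y) ->
    smooth_at (fun w : 'rV[R]_m * 'rV[R]_n => cmap c (f (cinv a w.1) (cinv b w.2)))
      (cmap a x, cmap b y).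

Lemma smooth2_on_at {m n k} {A : manifold R m} {B : manifold R n}
    {C : manifold R k} (D : set (A * B)) (f : A -> B -> C) (x : A) (y : B) :
  nbhs (x, y) D -> smooth2_on D f -> map2_smooth_at f x y.
Proof.
move=> Dxy [cf Cf]; have cfx := cf _ (nbhs_singleton Dxy); split => //.
move=> a b c Aa Ab Ac ax by_ cfxy; apply: Cinf_smooth_at (Cf a b c Aa Ab Ac).
have cI : {for (cmap a x, cmap b y), continuous
    (fun w : 'rV[R]_m * 'rV[R]_n => (cinv a w.1, cinv b w.2))}.
  apply: cvg_pair.
    by apply: (@continuous_comp _ _ _ fst (cinv a)); [exact: cvg_fst|exact: cinv_cvg].
  by apply: (@continuous_comp _ _ _ snd (cinv b)); [exact: cvg_snd|exact: cinv_cvg].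
have H1 : \forall z \near (x, y), D z /\ cdom c (f z.1 z.2).
  by apply: filterI => //; apply: (near_comp cfx); exact: chart_near.
have H2 : \forall w \near (cmap a x, cmap b y), D (cinv a w.1, cinv b w.2) /\
    cdom c (f (cinv a w.1) (cinv b w.2)).
  apply: (@near_comp _ _ _ _ (fun z => D z /\ cdom c (f z.1 z.2)) cI).
  by rewrite /= !cmapK.
have H3 : \forall w \near (cmap a x, cmap b y), cdom a (cinv a w.1) /\ cmap a (cinv a w.1) = w.1.
  apply: (@near_comp _ _ fst (cmap a x, cmap b y)
    (fun z => cdom a (cinv a z) /\ cmap a (cinv a z) = z)); first exact: cvg_fst.
  exact: crange_near.
have H4 : \forall w \near (cmap a x, cmap b y), cdom b (cinv b w.2) /\ cmap b (cinv b w.2) = w.2.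
  apply: (@near_comp _ _ snd (cmap a x, cmap b y)
    (fun z => cdom b (cinv b z) /\ cmap b (cinv b z) = z)); first exact: cvg_snd.
  exact: crange_near.
near=> w.
have [D1 D2] : D (cinv a w.1, cinv b w.2) /\ cdom c (f (cinv a w.1) (cinv b w.2)) by near: w.
have [D3 D4] : cdom a (cinv a w.1) /\ cmap a (cinv a w.1) = w.1 by near: w.
have [D5 D6] : cdom b (cinv b w.2) /\ cmap b (cinv b w.2) = w.2 by near: w.
by exists (cinv a w.1), (cinv b w.2); split => //; rewrite D4 D6; case: (w).
Unshelve. all: by end_near. Qed.

Lemma smooth2_at_of {m n k} {A : manifold R m} {B : manifold R n}
    {C : manifold R k} (f : A -> B -> C) (x : A) (y : B) :
  smooth2 f -> map2_smooth_at f x y.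
Proof. by apply: smooth2_on_at; exact: filterT. Qed.

(** The differential of f in product charts is applied to (v, w) = (v, 0) + (0, w). The instances
    are the multiplication of G, its action on P, and the local trivialisations. *)
Lemma curve_smooth_comp2 {m n k} {A : manifold R m} {B : manifold R n}
    {C : manifold R k} (f : A -> B -> C) (c : R -> A) (d : R -> B) (t : R) :
  curve_smooth_at c t -> curve_smooth_at d t -> map2_smooth_at f (c t) (d t) ->
  curve_smooth_at (fun s => f (c s) (d s)) t /\
  velocity (fun s => f (c s) (d s)) t =
    tmap (fun x => f x (d t)) (c t) (velocity c t) +
    tmap (fun y => f (c t) y) (d t) (velocity d t).
Proof.
move=> Cc Cd [cf Cf]; have [cc _] := Cc; have [cd _] := Cd.
pose a := chart_at (c t); pose b := chart_at (d t); pose e := chart_at (f (c t) (d t)).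
have Aa : atlas a := chart_at_atlas _; have act : cdom a (c t) := chart_at_dom _.
have Ab : atlas b := chart_at_atlas _; have bdt : cdom b (d t) := chart_at_dom _.
have Ae : atlas e := chart_at_atlas _; have et : cdom e (f (c t) (d t)) := chart_at_dom _.
have Cca := curve_smooth_chart Cc Aa act.
have Cdb := curve_smooth_chart Cd Ab bdt.
have CF := Cf a b e Aa Ab Ae act bdt et.
set F := (fun w : _ * _ => _) in CF.
have Cp := smooth_at_pair Cca Cdb.
have hc : has_coords ('rV[R]_m * 'rV[R]_n)%type.
  by apply: has_coords_prod; exact: has_coords_mx.
have H : \forall s \near t, (F \o (fun s => ((cmap a \o c) s, (cmap b \o d) s))) s =
    (cmap e \o (fun s => f (c s) (d s))) s.
  have := near_comp cc (chart_near act); have := near_comp cd (chart_near bdt).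
  by apply: filterS2 => s /= bds acs; rewrite /F /= !cmapK.
have dF := smooth_at_differentiable CF.
have dc := smooth_at_differentiable Cca.
have dd := smooth_at_differentiable Cdb.
split; first split.
- apply: (@continuous_comp _ _ _ (fun s => (c s, d s)) (fun z : A * B => f z.1 z.2)) => //.
  exact: cvg_pair.
- exists e; split => //; apply: smooth_at_near_eq H _.
  exact: smooth_at_comp hc Cp CF.
rewrite /velocity -/e -(near_derive1 H) derive1_chain //; last first.
  exact: differentiable_pair.
rewrite derive1E' ?diff_pair //=; last exact: differentiable_pair.
rewrite -!derive1E' //.
set v := derive1 _ t; set w := derive1 _ t.
rewrite (_ : (v, w) = (v, 0) + (0, w)) ?linearD; last first.
  by congr pair; rewrite /= ?addr0 ?add0r.
rewrite /tmap -/a -/b -/e; congr (_ + _).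
- rewrite (_ : cmap e \o _ \o _ = F \o (fun z => (z, cmap b (d t)))); last first.
    by apply/funext => z; rewrite /F /= cmapK.
  rewrite diff_comp //= diff_pair //.
  by rewrite diff_val -[X in (_, 'd X _ _)]/(cst _) diff_cst.
- rewrite (_ : cmap e \o _ \o _ = F \o (fun z => (cmap a (c t), z))); last first.
    by apply/funext => z; rewrite /F /= cmapK.
  rewrite diff_comp //= diff_pair //.
  by rewrite !diff_val.
Qed.

End SmoothMaps.

(** * Ordinary differential equations *)

Section ODE.
Context {R : realType}.

Lemma mx_norm_leP m n (A : 'M[R]_(m, n)) (M : R) : 0 <= M ->
  reflect (forall i j, `|A i j| <= M) (`|A| <= M).
Proof.
move=> M0; apply: (iffP idP) => [AM i j|H].
  apply: le_trans AM; rewrite [leRHS]/Num.Def.normr/= mx_normrE.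
  exact: (le_bigmax _ (fun ij : 'I_m * 'I_n => `|A ij.1 ij.2|) (i, j)).
by rewrite [leLHS]/Num.Def.normr/= mx_normrE; apply: bigmax_le => // ij _.
Qed.

Lemma mx_norm_coord m n (A : 'M[R]_(m, n)) i j : `|A i j| <= `|A|.
Proof. exact: (mx_norm_leP A (normr_ge0 A) (lexx _)). Qed.

Lemma mx_norm_mulmx m n p (A : 'M[R]_(m, n)) (B : 'M[R]_(n, p)) :
  `|A *m B| <= n%:R * `|A| * `|B|.
Proof.
apply/mx_norm_leP => [|i j]; first by rewrite !mulr_ge0.
rewrite mxE; apply: le_trans (ler_norm_sum _ _ _) _.
apply: (@le_trans _ _ (\sum_(l < n) `|A| * `|B|)).
  by apply: ler_sum => l _; rewrite normrM ler_pM // mx_norm_coord.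
by rewrite -mulrA mulr_natl sumr_const card_ord.
Qed.

(** The 1-Lipschitz retraction of the line onto [c - r, c + r]: composing with it extends a local
    field to a global one without worsening its bound or its Lipschitz constant. *)
Definition clamp (c r t : R) := Num.max (c - r) (Num.min (c + r) t).

Lemma clamp_near c r t : 0 <= r -> `|clamp c r t - c| <= r.
Proof.
move=> r0; rewrite /clamp ler_norml.
by case: (ltrP (c + r) t) => h1; [case: (ltrP (c - r) (c + r))|case: (ltrP (c - r) t)] => h2;
  apply/andP; split; lra.
Qed.

Lemma clamp_id c r t : `|t - c| <= r -> clamp c r t = t.
Proof.
rewrite ler_norml => /andP[h1 h2]; rewrite /clamp (min_idPr _) ?(max_idPr _) //; lra.
Qed.

Lemma clamp_lip c r s t : 0 <= r -> `|clamp c r s - clamp c r t| <= `|s - t|.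
Proof.
move=> r0; wlog st : s t / s <= t => [H|].
  case/orP: (le_total s t) => st; first exact: H.
  by rewrite distrC (distrC s); exact: H.
rewrite (distrC s) (ger0_norm (_ : 0 <= t - s)) ?subr_ge0 // /clamp ler_norml.
by case: (ltrP (c + r) s) => h1; case: (ltrP (c + r) t) => h2;
  repeat match goal with |- context [Num.max ?a ?b] => case: (ltrP a b) => ? end;
  apply/andP; split; lra.
Qed.

Lemma lip_continuous (V W : normedModType R) (f : V -> W) :
  (forall x y, `|f x - f y| <= `|x - y|) -> continuous f.
Proof.
move=> H x; apply/cvgrPdist_lt => e e0; near=> y.
apply: le_lt_trans (H _ _) _; near: y.
exact: cvgr_dist_lt (@cvg_id _ (nbhs x)) e e0.
Unshelve. all: by end_near. Qed.

Lemma clamp_continuous c r : 0 <= r -> continuous (clamp c r).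
Proof. by move=> r0; apply: lip_continuous => x y; exact: clamp_lip. Qed.

Lemma primitive_exists (f : R -> R) (t0 r : R) : continuous f ->
  exists P : R -> R, P t0 = 0 /\
    forall t, `|t - t0| < r -> is_derive t 1 P (f t).
Proof.
move=> cf.
(* The margin 1 puts every t of the ball in the interior of [a, u], as the fundamental theorem of
   calculus requires. *)
pose a := t0 - r - 1; pose u := t0 + r + 1.
pose P x := (\int[lebesgue_measure]_(t in `[a, x]) f t)%R.
exists (fun x => P x - P t0); split; first by rewrite subrr.
move=> t; rewrite ltr_norml => /andP[h1 h2].
have itg : lebesgue_measure.-integrable `[a, u] (EFin \o f).
  apply: continuous_compact_integrable; first exact: segment_compact.
  exact: continuous_subspaceT.
have [dP P'] : derivable P t 1 /\ P^`()%classic t = f t.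
  apply: (@continuous_FTC1_closed _ f a t u) => //; last exact: cf.
    by rewrite /u; lra.
  by rewrite /a; lra.
rewrite -[f t]subr0; apply: is_deriveB.
by rewrite -P' derive1E; exact: derivableP.
Qed.

Lemma is_derive_rV n (f : R -> 'rV[R]_n) (t : R) (v : 'rV[R]_n) :
  is_derive t 1 f v <-> forall i, is_derive t 1 (fun s => f s 0 i) (v 0 i).
Proof.
split=> [[df dv] i|H].
  have /derivable_mxP /(_ 0 i) dfi := df.
  by split => //; rewrite -dv derive_mx // mxE.
have df : derivable f t 1 by apply/derivable_mxP => i j; rewrite ord1; have [] := H j.
split => //; rewrite derive_mx //; apply/matrixP => i j; rewrite mxE ord1.
by have [_ ->] := H j.
Qed.

Lemma primitive_rV n (f : R -> 'rV[R]_n) (t0 r : R) : continuous f ->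
  exists P : R -> 'rV[R]_n, P t0 = 0 /\
    forall t, `|t - t0| < r -> is_derive t 1 P (f t).
Proof.
move=> cf.
have /choice[P HP] i : exists P : R -> R, P t0 = 0 /\
    forall t, `|t - t0| < r -> is_derive t 1 P (f t 0 i).
  apply: primitive_exists => t.
  apply: (@continuous_comp _ _ _ f (fun M : 'rV[R]_n => M 0 i)); first exact: cf.
  exact: coord_continuous.
exists (fun t => \row_i P i t); split=> [|t tr].
  by apply/rowP => i; rewrite !mxE; have [] := HP i.
apply/is_derive_rV => i; have [_ /(_ t tr)] := HP i.
by rewrite (_ : (fun s => _) = P i) //; apply/funext => s; rewrite mxE.
Qed.

Lemma mvt_bound_real (f df : R -> R) (s t M : R) :
  (forall x, Num.min s t <= x <= Num.max s t -> is_derive x 1 f (df x) /\ `|df x| <= M) ->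
  `|f t - f s| <= M * `|t - s|.
Proof.
wlog st : s t / s <= t => [H|] Hf.
  case/orP: (le_total s t) => st; first exact: H.
  rewrite distrC (distrC t); apply: H => //.
  by move=> x; rewrite minC maxC; exact: Hf.
move: st; rewrite le_eqVlt => /predU1P[->|st]; first by rewrite !subrr normr0 mulr0.
rewrite (min_idPl (ltW st)) (max_idPr (ltW st)) in Hf.
have [||x xst ->] := @MVT _ f df s t st.
- by move=> x /andP[/= h1 h2]; apply: (Hf x _).1; rewrite !ltW.
- apply/continuous_in_subspaceT => x; rewrite inE /= => /andP[/= h1 h2].
  apply: differentiable_continuous; apply/derivable1_diffP; case: (Hf x) => [|[]//].
  by move: h1 h2; rewrite !bnd_simp => -> ->.
- rewrite normrM ler_wpM2r //; apply: (Hf x _).2.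
  by move: xst => /andP[/= h1 h2]; rewrite !ltW.
Qed.

(** The matrix norm is the maximum of the entries, so the scalar mean value inequality applies
    coordinatewise with the same constant. *)
Lemma mvt_bound n (f df : R -> 'rV[R]_n) (s t M : R) : 0 <= M ->
  (forall x, Num.min s t <= x <= Num.max s t -> is_derive x 1 f (df x) /\ `|df x| <= M) ->
  `|f t - f s| <= M * `|t - s|.
Proof.
move=> M0 Hf; apply/mx_norm_leP => [|i j]; first by rewrite mulr_ge0.
rewrite ord1 !mxE; apply: (@mvt_bound_real (fun x => f x 0 j) (fun x => df x 0 j)) => x xst.
have [/is_derive_rV H1 H2] := Hf x xst; split => //.
exact: le_trans (mx_norm_coord _ _ _) H2.
Qed.

(** The tail of the series from n is at most 2 M 2^-n. Hence every u n - 2 M 2^-n lies below every u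
    m + 2 M 2^-m, and the supremum of the former is the limit. *)
Lemma geometric_cvg (u : nat -> R) (M : R) :
  (forall n, `|u n.+1 - u n| <= M * 2^-1 ^+ n) ->
  exists l, forall n, `|l - u n| <= 2 * M * 2^-1 ^+ n.
Proof.
move=> Hu.
have M0 : 0 <= M by have := Hu 0%N; rewrite expr0 mulr1; apply: le_trans.
have H n m : `|u (n + m)%N - u n| <= 2 * M * 2^-1 ^+ n - 2 * M * 2^-1 ^+ (n + m)%N.
  elim: m => [|m IH]; first by rewrite addn0 !subrr normr0.
  rewrite addnS -(subrKA (u (n + m)%N)) (le_trans (ler_normD _ _)) //.
  apply: le_trans (lerD (Hu _) IH) _; rewrite exprS; lra.
have {}H n m : `|u (n + m)%N - u n| <= 2 * M * 2^-1 ^+ n.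
  by apply: le_trans (H n m) _; rewrite gerBl !mulr_ge0 // exprn_ge0.
have B n m : u m - 2 * M * 2^-1 ^+ m <= u n + 2 * M * 2^-1 ^+ n.
  have Bn i : 0 <= 2 * M * 2^-1 ^+ i by rewrite !mulr_ge0 // exprn_ge0.
  have [nm|/ltnW mn] := leqP n m.
    have := H n (m - n)%N; rewrite subnKC // ler_norml => /andP[_].
    by have := Bn m; lra.
  have := H m (n - m)%N; rewrite subnKC // ler_norml => /andP[+ _].
  by have := Bn n; lra.
pose S := range (fun n => u n - 2 * M * 2^-1 ^+ n).
have hS : has_sup S.
  split; first by exists (u 0%N - 2 * M * 2^-1 ^+ 0), 0%N.
  by exists (u 0%N + 2 * M * 2^-1 ^+ 0) => _ [n _ <-].
exists (sup S) => n; rewrite ler_norml; apply/andP; split.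
  have : u n - 2 * M * 2^-1 ^+ n <= sup S by apply: ub_le_sup; [exact: hS.2|exists n].
  by lra.
have : sup S <= u n + 2 * M * 2^-1 ^+ n.
  by apply: ge_sup; [exact: hS.1|move=> _ [m _ <-]].
by lra.
Qed.

Lemma ode_lipschitz n (F : R -> 'rV[R]_n -> 'rV[R]_n) (t0 : R) (x0 : 'rV[R]_n)
    (K L : R) : 0 <= K -> 0 <= L ->
  continuous (fun p : R * 'rV[R]_n => F p.1 p.2) ->
  (forall s x, `|F s x| <= K) ->
  (forall s x y, `|F s x - F s y| <= L * `|x - y|) ->
  exists c : R -> 'rV[R]_n, exists2 r, 0 < r & c t0 = x0 /\
    forall t, `|t - t0| < r -> is_derive t 1 c (F t (c t)).
Proof.
move=> K0 L0 cF FK FL.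
(* The Picard iteration halves uniform distances on an interval of radius r. *)
pose r := (2 * (L + 1))^-1.
have r0 : 0 < r by rewrite invr_gt0 mulr_gt0 // ltr_pwDr.
have Lr : L * r <= 2^-1.
  rewrite /r ler_pdivrMr; last by rewrite mulr_gt0 // ltr_pwDr.
  by rewrite mulrA mulVf // mul1r lerDl.
(* [Pr] is made total, with the zero map for discontinuous g, so that the Picard operator acts on
   all functions and can be iterated. *)
have /choice[Pr HPr] (g : R -> 'rV[R]_n) : exists P : R -> 'rV[R]_n, continuous g ->
    P t0 = 0 /\ forall t, `|t - t0| < r + 1 -> is_derive t 1 P (g t).
  have [cg|ncg] := pselect (continuous g); last by exists (fun=> 0).
  by have [P HP] := primitive_rV t0 (r + 1) cg; exists P.
pose cl := clamp t0 r.
have clr t : `|cl t - t0| <= r by apply: clamp_near; exact: ltW.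
have clr1 t : `|cl t - t0| < r + 1 by apply: le_lt_trans (clr t) _; rewrite ltrDl.
have ccl : continuous cl by apply: clamp_continuous; exact: ltW.
have cG (d : R -> 'rV[R]_n) : continuous d -> continuous (fun s => F s (d s)).
  move=> cd s; apply: (@continuous_comp _ _ _ (fun s => (s, d s)) (fun p : R * 'rV[R]_n =>
    F p.1 p.2)).
    exact: (cvg_pair (@cvg_id _ (nbhs s)) (cd s)).
  exact: cF.
(* Evaluating at [cl t] freezes the iterates outside the interval, so that the estimates and
   continuity below hold on the whole line. *)
pose T (d : R -> 'rV[R]_n) t := x0 + Pr (fun s => F s (d s)) (cl t).
have cT d : continuous d -> continuous (T d).
  move=> cd t; apply: cvgD; first exact: cvg_cst.
  apply: (@continuous_comp _ _ _ cl (Pr (fun s => F s (d s)))); first exact: ccl.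
  have [_ /(_ _ (clr1 t)) H] := HPr _ (cG _ cd).
  by apply: differentiable_continuous; apply/derivable1_diffP; case: H.
have between (t x : R) : Num.min t0 (cl t) <= x <= Num.max t0 (cl t) -> `|x - t0| < r + 1.
  have := clr1 t; rewrite !ltr_norml; case: (lerP t0 (cl t)) => h1 /andP[h2 h3] /andP[h4 h5];
  by apply/andP; split; lra.
have TT d d' M : continuous d -> continuous d' -> 0 <= M ->
    (forall t, `|d t - d' t| <= M) -> forall t, `|T d t - T d' t| <= 2^-1 * M.
  move=> cd cd' M0 dd t.
  have [P0 HP] := HPr _ (cG _ cd); have [P0' HP'] := HPr _ (cG _ cd').
  rewrite /T opprD addrACA subrr add0r.
  set P := Pr _ in P0 HP *; set P' := Pr _ in P0' HP' *.
  have := @mvt_bound _ (fun s => P s - P' s) (fun s => F s (d s) - F s (d' s)) t0 (cl t) (L * M).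
  rewrite P0 P0' subrr subr0 => H.
  apply: le_trans (H _ _) _; first exact: mulr_ge0.
    move=> x /between xr; split; first by apply: is_deriveB; [exact: HP|exact: HP'].
    by apply: le_trans (FL _ _ _) _; rewrite ler_wpM2l.
  apply: (@le_trans _ _ (L * M * r)); first by rewrite ler_wpM2l ?mulr_ge0.
  by rewrite mulrAC ler_wpM2r.
pose u k := iter k T (fun=> x0).
have cu k : continuous (u k) by elim: k => [|k IH]; [move=> t; exact: cvg_cst|exact: cT].
pose M := K * r.
have M0 : 0 <= M by rewrite mulr_ge0 // ltW.
have Hu k t : `|u k.+1 t - u k t| <= M * 2^-1 ^+ k.
  elim: k t => [t|k IH t].
    rewrite /u /= /T expr0 mulr1 addrAC subrr add0r.
    have [P0 HP] := HPr _ (cG _ (cu 0%N)).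
    have := @mvt_bound _ (Pr (fun s => F s (u 0%N s))) (fun s => F s (u 0%N s)) t0 (cl t) K K0.
    rewrite P0 subr0 => H; apply: le_trans (H _) _; last by rewrite ler_wpM2l.
    by move=> x /between xr; split; [exact: HP|exact: FK].
  rewrite exprS mulrCA; apply: (TT (u k.+1) (u k)) => //.
  by rewrite mulr_ge0 // exprn_ge0.
clearbody M.
have /choice[l Hl] t : exists l : 'rV[R]_n, forall k, `|l - u k t| <= 2 * M * 2^-1 ^+ k.
  have /choice[l Hl] i : exists l, forall k, `|l - u k t 0 i| <= 2 * M * 2^-1 ^+ k.
    apply: geometric_cvg => k; apply: le_trans (Hu k t).
    by have := mx_norm_coord (u k.+1 t - u k t) 0 i; rewrite !mxE.
  exists (\row_i l i) => k; apply/mx_norm_leP => [|i j].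
    by rewrite !mulr_ge0 ?exprn_ge0.
  by rewrite ord1 !mxE.
have small e : 0 < e -> exists k, 2 * M * 2^-1 ^+ k < e.
  move=> e0.
  have : 2 * M * 2^-1 ^+ k @[k --> \oo] --> (0 : R).
    rewrite -[X in _ --> X](mulr0 (2 * M)); apply: cvgMl_tmp; apply: cvg_expr.
    by rewrite ger0_norm // invf_lt1 // ltr1n.
  move/cvgrPdist_lt => /(_ e e0) [k _ /(_ k (leqnn k))] /=.
  rewrite sub0r normrN ger0_norm => [?|]; first by exists k.
  by rewrite !mulr_ge0 // exprn_ge0.
have cl_ : continuous l.
  move=> t; apply/cvgrPdist_lt => e e0.
  have e3 : 0 < e / 3 by rewrite divr_gt0.
  have [k Hk] := small _ e3.
  have := cu k t => /cvgrPdist_lt /(_ _ e3); apply: filterS => s H.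
  rewrite -(subrKA (u k t)) -[u k t - l s](subrKA (u k s)).
  have h1 := le_lt_trans (Hl t k) Hk.
  have h2 := le_lt_trans (Hl s k) Hk; rewrite distrC in h2.
  apply: le_lt_trans (ler_normD _ _) _.
  rewrite (splitr e); have := ler_normD (u k t - u k s) (u k s - l s).
  by move: H h1 h2 => /=; lra.
have lT t : T l t = l t.
  apply/eqP; rewrite -subr_eq0 -normr_le0; apply/ler_addgt0Pl => e e0; rewrite addr0.
  have e2 : 0 < e / 2 by rewrite divr_gt0.
  have [k Hk] := small _ e2.
  have B0 : 0 <= 2 * M * 2^-1 ^+ k by rewrite !mulr_ge0 // exprn_ge0.
  have h1 := TT l (u k) _ cl_ (cu k) B0 (fun t => Hl t k) t.
  have := Hl t k.+1; rewrite -[u k.+1]/(T (u k)) exprS => h2; rewrite distrC in h2.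
  rewrite -(subrKA (T (u k) t)); apply: le_trans (ler_normD _ _) _.
  by move: h1 h2 Hk B0; lra.
have [P0 HP] := HPr _ (cG _ cl_).
exists l, r => //; split.
  by rewrite -lT /T /cl clamp_id ?P0 ?addr0 // subrr normr0 ltW.
move=> t tr.
have H : \forall s \near t, x0 + Pr (fun s => F s (l s)) s = l s.
  have : \forall s \near t, `|s - t0| < r.
    have ct : {for t, continuous (fun s => `|s - t0|)}.
      by apply: cvg_norm; apply: cvgB; [exact: cvg_id|exact: cvg_cst].
    by apply: (ct [set z | z < r]); apply: open_nbhs_nbhs; split => //; exact: open_lt.
  by apply: filterS => s sr; rewrite -lT /T /cl clamp_id // ltW.
apply: near_eq_is_derive H _.
rewrite -[X in is_derive _ _ _ X]add0r; apply: is_deriveD.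
by apply: HP; apply: lt_trans tr _; rewrite ltrDl.
Qed.

End ODE.

(** * Smoothness of solutions *)

Section SmoothODE.
Context {R : realType}.

Lemma near_closed_ball (V : normedModType R) (x : V) (P : set V) :
  (\forall y \near x, P y) -> exists2 r, 0 < r & forall y, `|y - x| <= r -> P y.
Proof.
move=> /nbhs_ballP[e /= e0 He]; exists (e / 2); first by rewrite divr_gt0.
move=> y yx; apply: He; rewrite -ball_normE /= distrC.
by apply: le_lt_trans yx _; rewrite ltr_pdivrMr // ltr_pMr // ltr1n.
Qed.

Lemma closed_ball_near (V : normedModType R) (x : V) (r : R) : 0 < r ->
  \forall y \near x, `|y - x| < r.
Proof.
by move=> r0; apply/nbhs_ballP; exists r => // y; rewrite -ball_normE /= distrC.
Qed.

Lemma near_norm_bound (V W : normedModType R) (f : V -> W) x :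
  {for x, continuous f} -> \forall y \near x, `|f y| <= `|f x| + 1.
Proof.
move=> /cvgrPdist_le /(_ 1 ltr01); apply: filterS => y H.
by rewrite -{1}(subKr (f x) (f y)) (le_trans (ler_normB _ _)) // lerD.
Qed.

Definition clampv n (x0 : 'rV[R]_n) (r : R) (x : 'rV[R]_n) : 'rV[R]_n :=
  \row_i clamp (x0 0 i) r (x 0 i).

Lemma clampv_near n (x0 : 'rV[R]_n) r x : 0 <= r -> `|clampv x0 r x - x0| <= r.
Proof.
by move=> r0; apply/mx_norm_leP => // i j; rewrite ord1 !mxE; exact: clamp_near.
Qed.

Lemma clampv_id n (x0 : 'rV[R]_n) r x : `|x - x0| <= r -> clampv x0 r x = x.
Proof.
move=> xr; apply/rowP => i; rewrite mxE clamp_id //; apply: le_trans xr.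
by have := mx_norm_coord (x - x0) 0 i; rewrite !mxE.
Qed.

Lemma clampv_lip n (x0 : 'rV[R]_n) r x y : 0 <= r ->
  `|clampv x0 r x - clampv x0 r y| <= `|x - y|.
Proof.
move=> r0; apply/mx_norm_leP => // i j; rewrite ord1 !mxE.
apply: le_trans (clamp_lip _ _ _ r0) _.
by have := mx_norm_coord (x - y) 0 j; rewrite !mxE.
Qed.

Lemma differentiable_bound n (W : normedModType R) (f : 'rV[R]_n -> W)
    (x : 'rV[R]_n) (B : R) : (forall i, `|'d f x (delta_mx 0 i)| <= B) ->
  forall h, `|'d f x h| <= n%:R * B * `|h|.
Proof.
move=> fB h; rewrite {1}(row_sum_delta h) linear_sum.
apply: le_trans (ler_norm_sum _ _ _) _.
apply: (@le_trans _ _ (\sum_(i < n) B * `|h|)); last first.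
  by rewrite sumr_const card_ord -mulrA mulr_natl.
apply: ler_sum => i _; rewrite linearZ normrZ mulrC ler_pM //.
exact: mx_norm_coord.
Qed.

Lemma smooth_lipschitz n a b (f : 'rV[R]_n -> 'M[R]_(a, b)) (x0 : 'rV[R]_n) :
  smooth_at f x0 -> exists K r, [/\ 0 <= K, 0 < r &
    forall x y, `|x - x0| <= r -> `|y - x0| <= r -> `|f x - f y| <= K * `|x - y|].
Proof.
move=> Cf.
(* Near x0 each partial derivative exceeds its norm at x0 by at most 1; the sum bounds them all at
   once, and the mean value inequality along the segment from y to x does the rest. *)
pose B := 1 + \sum_(i < n) `|'d f x0 (delta_mx 0 i)|.
have HB : \forall z \near x0, forall i, `|'d f z (delta_mx 0 i)| <= B.
  apply: (@filter_forall _ _ (fun i z => `|'d f z (delta_mx 0 i)| <= B) _ (nbhs_filter x0)) => i.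
  apply: filterS (near_norm_bound (smooth_at_continuous (smooth_at_diff (delta_mx 0 i) Cf))).
  move=> z Hz; apply: le_trans Hz _; rewrite addrC lerD2l (bigD1 i) //= lerDl.
  by apply: sumr_ge0.
have Hd : \forall z \near x0, differentiable f z.
  exact: nCk_differentiable (smooth_atW 1 Cf).
have [r r0 Hr] := near_closed_ball (filterI HB Hd).
have B0 : 0 <= B by rewrite addr_ge0 // sumr_ge0.
exists (n%:R * B), r; split => //; first by rewrite mulr_ge0.
move=> x y xr yr; apply/mx_norm_leP => [|i j]; first by rewrite !mulr_ge0.
pose g s : 'rV[R]_n := y + s *: (x - y).
have gr s : 0 <= s <= 1 -> `|g s - x0| <= r.
  move=> /andP[s0 s1].
  have -> : g s - x0 = s *: (x - x0) + (1 - s) *: (y - x0).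
    rewrite /g scalerBl scale1r !scalerBr; apply/rowP => l; rewrite !mxE; ring.
  apply: le_trans (ler_normD _ _) _; rewrite !normrZ !ger0_norm ?subr_ge0 //.
  have h1 : s * `|x - x0| <= s * r by rewrite ler_wpM2l.
  have h2 : (1 - s) * `|y - x0| <= (1 - s) * r by rewrite ler_wpM2l ?subr_ge0.
  by lra.
have := @mvt_bound_real _ (fun s => f (g s) i j) (fun s =>
  'd f (g s) (x - y) i j) 0 1 (n%:R * B * `|x - y|).
have g1 : g 1 = x by rewrite /g scale1r addrC subrK.
have g0 : g 0 = y by rewrite /g scale0r addr0.
rewrite g1 g0 subr0 normr1 mulr1 !mxE; apply => s.
rewrite (min_idPl ler01) (max_idPr ler01) => s01.
have [HBs Hds] := Hr _ (gr s s01).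
split; last by apply: le_trans (mx_norm_coord _ _ _) _; exact: differentiable_bound.
have [Cg dg] := line_smooth y (x - y) s.
have dgs : differentiable g s by exact: smooth_at_differentiable.
have dfg : differentiable (f \o g) s by exact: differentiable_comp.
have D : derivable (f \o g) s 1 by apply/derivable1_diffP.
have /derivable_mxP /(_ i j) Dij := D.
split => //.
have := derive_mx D; rewrite -derive1E derive1_chain // dg => /matrixP /(_ i j).
by rewrite mxE => ->.
Qed.

(** The right-hand side has the shape of a lifting equation: v is the velocity of the curve below,
    and L x sends it to a tangent vector at x. *)
Lemma ode_smooth n m (v : R -> 'rV[R]_m) (L : 'rV[R]_n -> 'M[R]_(m, n))
    (t0 : R) (x0 : 'rV[R]_n) : smooth_at v t0 -> smooth_at L x0 ->
  exists c : R -> 'rV[R]_n, [/\ c t0 = x0, smooth_at c t0 &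
    \forall t \near t0, derive1 c t = v t *m L (c t)].
Proof.
move=> Cv CL.
have [K [r1 [K0 r10 HK]]] := smooth_lipschitz CL.
have Hv : \forall t \near t0, {for t, continuous v} /\ `|v t| <= `|v t0| + 1.
  apply: filterS2 (smooth_at_near Cv) (near_norm_bound (smooth_at_continuous Cv)).
  by move=> t /smooth_at_continuous.
have HL : \forall x \near x0, {for x, continuous L} /\ `|L x| <= `|L x0| + 1.
  apply: filterS2 (smooth_at_near CL) (near_norm_bound (smooth_at_continuous CL)).
  by move=> t /smooth_at_continuous.
have [d d0 {}Hv] := near_closed_ball Hv.
have [r2 r20 {}HL] := near_closed_ball HL.
pose r := Num.min r1 r2.
have r0 : 0 < r by rewrite lt_min r10.
have rr1 : r <= r1 by rewrite ge_min lexx.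
have rr2 : r <= r2 by rewrite ge_min lexx orbT.
(* Clamping time and space makes the field globally bounded and Lipschitz. *)
pose F s x := v (clamp t0 d s) *m L (clampv x0 r x).
have cd s : `|clamp t0 d s - t0| <= d by apply: clamp_near; exact: ltW.
have cr x : `|clampv x0 r x - x0| <= r by apply: clampv_near; exact: ltW.
have cF : continuous (fun p : R * 'rV[R]_n => F p.1 p.2).
  move=> p; apply: (@nCk_continuous _ _ _ 0); apply: nCk_mulmx; apply/nCk0P; near=> q.
    apply: (@continuous_comp _ _ _ (fun q : R * 'rV[R]_n => clamp t0 d q.1) v); last first.
      by apply: (Hv _ _).1.
    apply: (@continuous_comp _ _ _ fst (clamp t0 d)); first exact: cvg_fst.
    by apply: clamp_continuous; exact: ltW.
  apply: (@continuous_comp _ _ _ (fun q : R * 'rV[R]_n => clampv x0 r q.2) L); last first.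
    by apply: (HL _ _).1; exact: le_trans rr2.
  apply: (@continuous_comp _ _ _ snd (clampv x0 r)); first exact: cvg_snd.
  by apply: lip_continuous => x y; apply: clampv_lip; exact: ltW.
have FK s x : `|F s x| <= m%:R * (`|v t0| + 1) * (`|L x0| + 1).
  apply: le_trans (mx_norm_mulmx _ _) _; rewrite ler_pM ?mulr_ge0 //.
    by rewrite ler_wpM2l //; apply: (Hv _ _).2.
  by apply: (HL _ _).2; exact: le_trans rr2.
have FL s x y : `|F s x - F s y| <= m%:R * (`|v t0| + 1) * K * `|x - y|.
  rewrite /F -mulmxBr; apply: le_trans (mx_norm_mulmx _ _) _;
    rewrite -[leRHS]mulrA ler_pM ?mulr_ge0 //.
    by rewrite ler_wpM2l //; apply: (Hv _ _).2.
  apply: le_trans (HK _ _ _ _) _; try by exact: le_trans rr1.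
  by rewrite ler_wpM2l //; apply: clampv_lip; exact: ltW.
have [||c [e e0 [ct0 Hc]]] := ode_lipschitz t0 x0 _ _ cF FK FL.
- by rewrite !mulr_ge0 // addr_ge0.
- by rewrite !mulr_ge0 // addr_ge0.
have near_t0 P : (forall t, `|t - t0| < e -> P t) -> \forall t \near t0, P t.
  by move=> HP; apply: filterS (closed_ball_near t0 e0).
have cc : \forall t \near t0, {for t, continuous c}.
  apply: near_t0 => t /Hc H; apply: differentiable_continuous.
  by apply/derivable1_diffP; case: H.
have cc0 := nbhs_singleton cc.
pose Q (s : R) := [/\ is_derive s 1 c (v s *m L (c s)), smooth_at v s & smooth_at L (c s)].
(* Close to t0 the solution stays where neither clamp acts, so it solves the original equation. *)
have HQ : \forall s \near t0, Q s.
  have h1 : \forall s \near t0, `|s - t0| < e by exact: closed_ball_near.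
  have h2 : \forall s \near t0, `|s - t0| < d by exact: closed_ball_near.
  have h3 : \forall s \near t0, `|c s - x0| < r.
    by apply: (@near_comp _ _ c t0 (fun x => `|x - x0| < r)) => //; rewrite ct0;
      exact: closed_ball_near.
  have h4 := smooth_at_near Cv.
  have h5 : \forall s \near t0, smooth_at L (c s).
    by apply: (@near_comp _ _ c t0 (smooth_at L)) => //; rewrite ct0; exact: smooth_at_near.
  near=> s.
  have s1 : `|s - t0| < e by near: s.
  have s2 : `|s - t0| < d by near: s.
  have s3 : `|c s - x0| < r by near: s.
  split; [|by near: s|by near: s].
  by have := Hc s s1; rewrite /F clamp_id ?clampv_id // ltW.
(* Bootstrapping: if c is C^k, so is the right-hand side of its equation, hence c is C^(k+1). The
   domain where Q holds does not shrink with k. *)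
have boot k t : (\forall s \near t, Q s) -> nCk k c t.
  elim: k t => [|k IH] t Qt.
    apply/nCk0P; apply: filterS Qt => s [[H _] _ _].
    by apply: differentiable_continuous; apply/derivable1_diffP.
  apply: nCk_ind; first by apply: filterS Qt => s [[H _] _ _]; apply/derivable1_diffP.
  apply: filterS (near_join Qt) => s Qs u.
  apply: (@Ck_near_eq _ _ _ _ (fun y => u *: (v y *m L (c y)))).
    apply: filterS Qs => y [[H1 H2] _ _].
    by rewrite diff1E ?derive1E ?H2 //; apply/derivable1_diffP.
  have Cc := IH s Qs; have [_ Cvs CLs] := nbhs_singleton Qs.
  apply: nCk_at; apply: nCkZ; first exact: nCk_cst.
  apply: nCk_mulmx; first exact: smooth_atW.
  by apply: (nCk_comp (has_coords_mx _ _) Cc); exact: smooth_atW.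
exists c; split => //.
  by apply/smooth_at_nCk; apply: filterS (near_join HQ) => s Qs k; exact: boot.
by apply: filterS HQ => s [[_ H] _ _]; rewrite derive1E.
Unshelve. all: by end_near. Qed.

End SmoothODE.

(** * Lifting curves along submersions *)

Section LinearAlgebra.
Context {R : realType}.

Definition posdef n (B : 'M[R]_n) := forall z : 'rV[R]_n, z != 0 -> 0 < (z *m B *m z^T) 0 0.

Lemma posdef_unit n (B : 'M[R]_n) : posdef B -> B \in unitmx.
Proof.
move=> pB; rewrite -row_free_unit; apply/inj_row_free => z zB.
have [//|/pB] := eqVneq z 0; by rewrite zB mul0mx mxE ltxx.
Qed.

Lemma posdef1 n : posdef (1%:M : 'M[R]_n).
Proof.
move=> z z0; rewrite mulmx1 mxE.
have [i zi] : exists i, z 0 i != 0 by apply/rV0Pn.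
rewrite (bigD1 i) //= mxE ltr_pwDl //; first by rewrite -expr2 exprn_even_gt0.
by apply: sumr_ge0 => j _; rewrite mxE -expr2 sqr_ge0.
Qed.

Lemma posdef_inv n (B : 'M[R]_n) : B^T = B -> posdef B -> posdef (invmx B).
Proof.
move=> BT pB z z0; have uB := posdef_unit pB.
have -> : z *m invmx B *m z^T = (z *m invmx B) *m B *m (z *m invmx B)^T.
  by rewrite trmx_mul trmx_inv BT mulmxA mulmxKV.
apply: pB; apply: contraNneq z0 => zB.
by rewrite -(mulmxKV uB z) zB mul0mx.
Qed.

(* For S the inverse of an inner product B, the rows of [rinv S A] are
   B-orthogonal to the kernel of A. *)
Definition rinv n m (S : 'M[R]_n) (A : 'M[R]_(n, m)) : 'M[R]_(m, n) :=
  invmx (A^T *m S *m A) *m A^T *m S.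

(** Since w |-> w A is onto, v |-> v A^T is injective: if v A^T = 0 and v = w A, then v v^T = 0. So
    A^T S A inherits positivity from S. *)
Lemma gram_unit n m (S : 'M[R]_n) (A : 'M[R]_(n, m)) : posdef S ->
  (forall v : 'rV_m, exists w, w *m A = v) -> A^T *m S *m A \in unitmx.
Proof.
move=> pS sA; apply: posdef_unit => v v0.
have -> : v *m (A^T *m S *m A) *m v^T = (v *m A^T) *m S *m (v *m A^T)^T.
  by rewrite trmx_mul trmxK !mulmxA.
apply: pS; apply: contraNneq v0 => vA.
have Av : A *m v^T = 0 by rewrite -[A]trmxK -trmx_mul vA trmx0.
have [w wA] := sA v.
have : v *m v^T = 0 by rewrite -{1}wA -mulmxA Av mulmx0.
move=> vv; have [//|/(@posdef1 m)] := eqVneq v 0.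
by rewrite mulmx1 vv mxE ltxx.
Qed.

Lemma rinvK n m (S : 'M[R]_n) (A : 'M[R]_(n, m)) (v : 'rV[R]_m) : posdef S ->
  (forall v : 'rV_m, exists w, w *m A = v) -> v *m rinv S A *m A = v.
Proof.
by move=> pS sA; rewrite /rinv -!mulmxA (mulmxA A^T) mulVmx ?mulmx1 // gram_unit.
Qed.

Lemma rinv_orth n m (B : 'M[R]_n) (A : 'M[R]_(n, m)) (v : 'rV[R]_m) (z : 'rV[R]_n) :
  posdef B -> z *m A = 0 -> v *m rinv (invmx B) A *m B *m z^T = 0.
Proof.
move=> pB zA; rewrite /rinv -!mulmxA (mulmxA (invmx B)) mulVmx ?posdef_unit // mul1mx.
by rewrite -trmx_mul zA trmx0 !mulmx0.
Qed.

Lemma nCk_rinv (V : normedModType R) k n m (S : V -> 'M[R]_n) (A : V -> 'M[R]_(n, m)) x :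
  posdef (S x) -> (forall v : 'rV_m, exists w, w *m A x = v) ->
  nCk k S x -> nCk k A x -> nCk k (fun y => rinv (S y) (A y)) x.
Proof.
move=> pS sA CS CA; apply: nCk_mulmx => //; apply: nCk_mulmx; last exact: nCk_trmx.
apply: nCk_invmx; first exact: gram_unit.
by apply: nCk_mulmx => //; apply: nCk_mulmx => //; exact: nCk_trmx.
Qed.

Lemma smooth_at_mx (V : normedModType R) m n (f : V -> 'M[R]_(m, n)) (x : V) :
  (forall i j, smooth_at (fun y => f y i j) x) -> smooth_at f x.
Proof.
move=> Cf; apply/smooth_at_nCk.
have H : \forall y \near x, forall ij : 'I_m * 'I_n, forall k, nCk k (fun y => f y ij.1 ij.2) y.
  apply: (@filter_forall _ _ (fun ij y => forall k, nCk k (fun y =>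
    f y ij.1 ij.2) y) _ (nbhs_filter x)).
  by move=> ij; apply/smooth_at_nCk.
by apply: filterS H => y H k; apply: nCk_mx => i j; have := H (i, j) k.
Qed.

Lemma smooth_at_coord (V : normedModType R) m n (f : V -> 'M[R]_(m, n)) (x : V) i j :
  smooth_at f x -> smooth_at (fun y => f y i j) x.
Proof.
by move=> /smooth_at_nCk Cf; apply/smooth_at_nCk; apply: filterS Cf => y H k; exact: nCk_coord.
Qed.

Lemma jacobian_smooth n m (f : 'rV[R]_n -> 'rV[R]_m) (x : 'rV[R]_n) :
  smooth_at f x -> smooth_at (jacobian f) x.
Proof.
move=> Cf; apply: smooth_at_mx => i j; rewrite /jacobian.
under eq_fun do rewrite mxE.
exact/smooth_at_coord/smooth_at_diff.
Qed.

Lemma mul_jacobian n m (f : 'rV[R]_n -> 'rV[R]_m) (x v : 'rV[R]_n) :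
  v *m 'J f x = 'd f x v.
Proof. by rewrite /jacobian mul_rV_lin1. Qed.

End LinearAlgebra.

Lemma diff_left_inverse {R : realType} (V W : normedModType R) (f : V -> W) (g : W -> V)
    (x w : V) : differentiable f x -> differentiable g (f x) ->
  (\forall z \near x, g (f z) = z) -> 'd f x w = 0 -> w = 0.
Proof.
move=> df dg H fw.
have dgf : differentiable (g \o f) x by exact: differentiable_comp.
have [_ /(congr1 (fun h => h w)) /=] := @near_differentiable _ _ _ (g \o f) idfun x H dgf.
rewrite diff_comp //= fw linear0 => <-.
by rewrite (_ : 'd idfun x = idfun :> (V -> V)) //; exact: diff_val.
Qed.

(** * Coordinate fields and local lifts *)

Section ChartFields.
Context {R : realType}.
Context {n : nat} {A : manifold R n}.

Lemma chart_field_surj (a : chart R A n) (x : A) (v : 'rV[R]_n) :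
  atlas a -> cdom a x -> exists w, chart_field a (cmap a x) w = v.
Proof.
move=> Aa ax; have [c [Cc c0 cv]] := velocity_surj x v.
exists (derive1 (cmap a \o c) 0).
by rewrite -c0 -velocity_chart ?c0.
Qed.

Lemma chart_field_inj (a : chart R A n) (x : A) (w : 'rV[R]_n) :
  atlas a -> cdom a x -> chart_field a (cmap a x) w = 0 -> w = 0.
Proof.
move=> Aa ax; rewrite /chart_field cmapK //.
pose b := chart_at x.
have Ab : atlas b := chart_at_atlas x; have bx : cdom b x := chart_at_dom x.
have Cab := transition_smooth Aa Ab ax bx.
have Cba := transition_smooth Ab Aa bx ax.
have Eb : (cmap b \o cinv a) (cmap a x) = cmap b x by rewrite /= cmapK.
have H : \forall z \near cmap a x, (cmap a \o cinv b) ((cmap b \o cinv a) z) = z.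
  have := crange_near ax; have := cinv_near ax (chart_near bx).
  by apply: filterS2 => z bz [az za] /=; rewrite cmapK.
apply: diff_left_inverse H; first exact: smooth_at_differentiable.
by rewrite Eb; exact: smooth_at_differentiable.
Qed.

(* In charts the lift is the solution of [h' = g' L(h)]. *)
Lemma local_lift {m} {B : manifold R m} (f : A -> B) (x0 : A)
    (a : chart R A n) (b : chart R B m) (L : 'rV[R]_n -> 'M[R]_(m, n))
    (g : R -> B) (s0 : R) :
  smooth f -> atlas a -> cdom a x0 -> atlas b -> cdom b (f x0) ->
  smooth_at L (cmap a x0) ->
  (\forall y \near cmap a x0, forall v, 'd (cmap b \o f \o cinv a) y (v *m L y) = v) ->
  curve_smooth_at g s0 -> g s0 = f x0 ->
  exists c : R -> A, [/\ curve_smooth_at c s0, c s0 = x0,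
    \forall s \near s0, f (c s) = g s &
    \forall s \near s0, cdom a (c s) /\ exists v,
      velocity c s = chart_field a (cmap a (c s)) (v *m L (cmap a (c s)))].
Proof.
move=> sf Aa ax Ab bfx CL HL Cg gs0.
have Cgb : smooth_at (cmap b \o g) s0 by apply: curve_smooth_chart => //; rewrite gs0.
have [h [h0 Ch Hh]] := ode_smooth (smooth_at_derive1 Cgb) CL.
have [Cc Hc] := curve_smooth_cinv Aa ax h0 Ch.
pose c := cinv a \o h.
have cs0 : c s0 = x0 by rewrite /c /= h0 cmapK.
have [cf Cf] := smooth_at_of x0 sf.
have Cfab := Cf a b Aa Ab ax bfx.
have ch := smooth_at_continuous Ch.
pose F := cmap b \o f \o cinv a.
have Hs : \forall s \near s0, [/\ differentiable h s, differentiable F (h s),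
    differentiable (cmap b \o g) s &
    derive1 (F \o h) s = derive1 (cmap b \o g) s].
  have D1 : \forall s \near s0, differentiable h s.
    exact: nCk_differentiable (smooth_atW 1 Ch).
  have D2 : \forall s \near s0, differentiable F (h s).
    apply: (@near_comp _ _ h s0 (fun z => differentiable F z) ch); rewrite h0.
    exact: nCk_differentiable (smooth_atW 1 Cfab).
  have D3 : \forall s \near s0, forall v, 'd F (h s) (v *m L (h s)) = v.
    by apply: (@near_comp _ _ h s0 (fun z => forall v, 'd F z (v *m L z) = v) ch); rewrite h0.
  have D4 : \forall s \near s0, differentiable (cmap b \o g) s.
    exact: nCk_differentiable (smooth_atW 1 Cgb).
  near=> s.
  have d1 : differentiable h s by near: s.
  have d2 : differentiable F (h s) by near: s.
  split=> //; first by near: s.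
  rewrite derive1_chain // (_ : derive1 h s = derive1 (cmap b \o g) s *m L (h s)); last by near: s.
  by move: (derive1 _ s); near: s.
have [r r0 Hr] := near_closed_ball Hs.
(* Both sides have the same value at s0 and the same derivative nearby; the mean value inequality
   with constant 0 identifies them. *)
have E : \forall s \near s0, F (h s) = cmap b (g s).
  apply: filterS (closed_ball_near s0 r0) => s sr.
  have := @mvt_bound _ _ (fun s => F (h s) - cmap b (g s)) (fun=> 0) s0 s 0 (lexx _).
  have E0 : F (h s0) = cmap b (g s0) by rewrite /F h0 /= cmapK // gs0.
  rewrite E0 subrr subr0 mul0r => H; apply/eqP; rewrite -subr_eq0 -normr_le0.
  apply: H => x sx.
  have /Hr[d1 d2 d3 d4] : `|x - s0| <= r.
    move: sx sr; rewrite ler_norml ltr_norml.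
    by case: (lerP s0 s) => ? /andP[? ?] /andP[? ?]; apply/andP; split; lra.
  split; last by rewrite normr0.
  have dFh : differentiable (F \o h) x by exact: differentiable_comp.
  rewrite -(subrr (derive1 (F \o h) x)) {2}d4 !derive1E.
  by apply: is_deriveB; apply: derivableP; apply/derivable1_diffP.
have cc := curve_smooth_continuous Cc.
exists c; split => //.
  have B1 : \forall s \near s0, cdom b (f (c s)).
    have cfc : {for s0, continuous (f \o c)}.
      by apply: continuous_comp => //; rewrite cs0.
    by apply: (near_comp cfc); apply: chart_near; rewrite /= cs0.
  have B2 : \forall s \near s0, cdom b (g s).
    by apply: (near_comp (curve_smooth_continuous Cg)); apply: chart_near; rewrite gs0.
  near=> s.
  have b1 : cdom b (f (c s)) by near: s.
  have b2 : cdom b (g s) by near: s.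
  have e : F (h s) = cmap b (g s) by near: s.
  by rewrite -(cmapK b1) -(cmapK b2) -e.
have Cn := curve_smooth_near Cc.
have Hcc := near_join Hc.
near=> s.
have [s1 s2] : cdom a (cinv a (h s)) /\ cmap a (cinv a (h s)) = h s by near: s.
split => //; exists (derive1 (cmap b \o g) s).
rewrite (velocity_chart _ Aa) //; last by near: s.
congr chart_field; rewrite /c /= s2 (_ : derive1 (_ \o _) s = derive1 h s); first by near: s.
apply: near_derive1.
have : \forall z \near s, cdom a (cinv a (h z)) /\ cmap a (cinv a (h z)) = h z by near: s.
by apply: filterS => z [].
Unshelve. all: by end_near. Qed.

End ChartFields.

(** * Piecewise smooth curves and their lengths *)

Section Intervals.
Context {R : realType}.

(** Continuous induction. The local hypothesis covers pairs on both sides of s, so that the supremum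
    of the reachable points can be both reached and passed. *)
Lemma interval_chain (Rel : R -> R -> Prop) (a b : R) : a <= b ->
  (forall x y z, Rel x y -> Rel y z -> Rel x z) ->
  (forall s, a <= s <= b -> exists2 d, 0 < d & forall s1 s2,
     s - d < s1 -> s1 <= s2 -> s2 < s + d -> a <= s1 -> s2 <= b -> Rel s1 s2) ->
  Rel a b.
Proof.
move=> ab tr loc.
pose S := [set s | a <= s <= b /\ Rel a s].
have Sa : S a.
  split; first by rewrite lexx.
  have [d d0 H] : exists2 d, 0 < d & forall s1 s2,
    a - d < s1 -> s1 <= s2 -> s2 < a + d -> a <= s1 -> s2 <= b -> Rel s1 s2.
    by apply: loc; rewrite lexx.
  by apply: H => //; lra.
have hS : has_sup S by split; [exists a|exists b => s [/andP[]]].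
have aS : a <= sup S by apply: ub_le_sup => //; exact: hS.2.
have Sb : sup S <= b by apply: ge_sup; [exact: hS.1|move=> s [/andP[]]].
have [d d0 H] : exists2 d, 0 < d & forall s1 s2,
    sup S - d < s1 -> s1 <= s2 -> s2 < sup S + d -> a <= s1 -> s2 <= b -> Rel s1 s2.
  by apply: loc; rewrite aS Sb.
have [s1 [/andP[as1 s1b] Rs1] ds1] := sup_adherent d0 hS.
have s1S : s1 <= sup S by apply: ub_le_sup; [exact: hS.2|split => //; rewrite as1].
(* This point turns out to lie in S, hence not beyond sup S; so the minimum must be b. *)
pose s2 := Num.min b (sup S + d / 2).
have s2b : s2 <= b by rewrite ge_min lexx.
have s2d : s2 <= sup S + d / 2 by rewrite ge_min lexx orbT.
have Rs2 : Rel a s2.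
  apply: tr Rs1 _; apply: H => //; last by lra.
  by rewrite le_min s1b /=; lra.
have : s2 <= sup S.
  apply: ub_le_sup; [exact: hS.2|split => //; rewrite s2b andbT le_min ab /=; lra].
have [bs|sb] := leP b (sup S + d / 2).
  by move: Rs2; rewrite /s2 (min_idPl bs).
by rewrite /s2 (min_idPr (ltW sb)); lra.
Qed.

End Intervals.

(** The classes of E are open; a point in the closure of a class has a neighbourhood inside its own
    class, so the two classes meet and coincide. Classes are therefore closed as well. *)
Lemma connected_equiv (T : topologicalType) (E : T -> T -> Prop) :
  connected [set: T] -> (forall x, E x x) -> (forall x y, E x y -> E y x) ->
  (forall x y z, E x y -> E y z -> E x z) ->
  (forall x, \forall y \near x, E x y) -> forall x y, E x y.
Proof.
move=> cT rE sE tE lE x y.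
suff S : [set y | E x y] = setT by have : [set y | E x y] y by rewrite S.
apply: cT; first by exists x; exact: rE.
  exists [set y | E x y]; last by rewrite setTI.
  rewrite openE => z /= Exz; apply: filterS (lE z) => w; exact: tE.
exists [set y | E x y]; last by rewrite setTI.
move=> z /= cz; have [w [/= Exw Ezw]] := cz _ (lE z).
by apply: tE Exw _; exact: sE.
Qed.

Section Curves.
Context {R : realType} {n : nat} {A : manifold R n}.
Implicit Types (Q : A -> 'rV[R]_n -> Prop) (c : R -> A).

(** Smoothness of the extension at a and at b spreads to neighbourhoods of them, which yields the
    margin e. With this form arcs can be handled one parameter at a time. *)
Lemma arcP Q c (a b : R) : a <= b -> smooth_arc Q c a b <->
  exists s, forall t, a <= t <= b ->
    [/\ curve_smooth_at s t, s t = c t & Q (s t) (velocity s t)].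
Proof.
move=> ab; split=> [[s [e [e0 Cs H]]]|[s H]].
  exists s => t tab; have [st Qt] := H t tab; split => //.
  have oD : open [set t | a - e < t < b + e].
    rewrite (_ : [set _ | _] = `]a - e, b + e[%classic); first exact: interval_open.
    by apply/seteqP; split => z /=; rewrite in_itv.
  by apply: ((smooth_curve_onP _ oD).1 Cs); move: tab => /= /andP[? ?]; apply/andP; split; lra.
have [|Csa _ _] := H a; first by rewrite lexx.
have [|Csb _ _] := H b; first by rewrite lexx andbT.
have [e1 e10 H1] := near_closed_ball (curve_smooth_near Csa).
have [e2 e20 H2] := near_closed_ball (curve_smooth_near Csb).
exists s, (Num.min e1 e2); split; first by rewrite lt_min e10.
  apply/smooth_curve_onP.
    rewrite (_ : [set _ | _] = `]a - Num.min e1 e2, b + Num.min e1 e2[%classic);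
      first exact: interval_open.
    by apply/seteqP; split => t /=; rewrite in_itv.
  move=> t /andP[t1 t2].
  have h1 : Num.min e1 e2 <= e1 by rewrite ge_min lexx.
  have h2 : Num.min e1 e2 <= e2 by rewrite ge_min lexx orbT.
  have [ta|ta] := ltrP t a; first by apply: H1; rewrite ler_norml; apply/andP; split; lra.
  have [tb|tb] := ltrP b t; first by apply: H2; rewrite ler_norml; apply/andP; split; lra.
  by have [] := H t; rewrite ?ta ?tb.
by move=> t /H[].
Qed.

Lemma arc_eq Q c d (a b : R) : a <= b ->
  (forall t, a <= t <= b -> c t = d t) -> smooth_arc Q c a b -> smooth_arc Q d a b.
Proof.
move=> ab cd /(arcP _ _ ab)[s Hs]; apply/arcP => //; exists s => t tab.
by have [? ? ?] := Hs t tab; rewrite -cd.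
Qed.

Lemma pw_smooth_lt Q c (a b : R) : pw_smooth Q c a b -> a < b.
Proof. by elim => // a' b' d _ + _; exact: lt_trans. Qed.

Lemma pw_smooth_eq Q c d (a b : R) :
  (forall t, a <= t <= b -> c t = d t) -> pw_smooth Q c a b -> pw_smooth Q d a b.
Proof.
move=> + H; elim: H d => [a' b' ab arc|a' b' e H1 IH1 H2 IH2] d cd.
  by apply: pw_smooth_arc => //; apply: arc_eq arc => //; exact: ltW.
have h1 := pw_smooth_lt H1; have h2 := pw_smooth_lt H2.
apply: (@pw_smooth_cat _ _ _ _ _ _ b').
  by apply: IH1 => t /andP[t1 t2]; apply: cd; rewrite t1 (le_trans t2) // ltW.
by apply: IH2 => t /andP[t1 t2]; apply: cd; rewrite t2 (le_trans _ t1) // ltW.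
Qed.

Lemma pw_smoothW Q (Q' : A -> 'rV[R]_n -> Prop) c (a b : R) :
  (forall x v, Q x v -> Q' x v) -> pw_smooth Q c a b -> pw_smooth Q' c a b.
Proof.
move=> QQ'; elim => [a' b' ab [s [e [e0 Cs H]]]|a' b' e _ H1 _ H2].
  apply: pw_smooth_arc => //; exists s, e; split => // t /H[? ?]; split => //; exact: QQ'.
exact: pw_smooth_cat H1 H2.
Qed.

Lemma affine_smooth (k be t : R) :
  smooth_at (fun s : R => k * s + be) t /\
  differentiable (fun s : R => k * s + be) t /\
  derive1 (fun s : R => k * s + be) t = k.
Proof.
have C : smooth_at (fun s : R => k * s + be) t.
  near=> s => i; apply: nCk_at; apply: nCkD; last exact: nCk_cst.
  by apply: nCkM; [exact: nCk_cst|exact: nCk_id].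
split => //; split; first exact: smooth_at_differentiable.
have D : is_derive t (1 : R) (( *%R k) + cst be) (k *: 1 + 0).
  by apply: is_deriveD; exact: is_deriveZ.
rewrite derive1E -[X in derive X _ _]/(( *%R k) + cst be) derive_val.
by rewrite addr0 [_ *: _]mulr1.
Unshelve. all: by end_near. Qed.

Lemma curve_affine c (k be t : R) : curve_smooth_at c (k * t + be) ->
  curve_smooth_at (fun s => c (k * s + be)) t /\
  velocity (fun s => c (k * s + be)) t = k *: velocity c (k * t + be).
Proof.
move=> [cc [a [Aa act Ca]]].
have [Cp [dp p']] := affine_smooth k be t.
split; first split.
- by apply: (@continuous_comp _ _ _ (fun s => k * s + be) c) => //; exact: smooth_at_continuous.
- by exists a; split => //; exact: (smooth_at_comp has_coordsR Cp Ca).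
- rewrite /velocity.
  have dc : differentiable (cmap (chart_at (c (k * t + be))) \o c) (k * t + be).
    apply: smooth_at_differentiable; apply: curve_smooth_chart; first by split; last by exists a.
      exact: chart_at_atlas.
    exact: chart_at_dom.
  have := @derive1_chain _ _ _ (fun s => k * s + be) _ t dp dc.
  rewrite p' => ->; by rewrite diff1E.
Qed.

(** k = -1 reverses a path, for symmetry of being joined; k = 1 shifts the parameter, for
    concatenation. Reversal exchanges the end points, hence the conditional. *)
Lemma pw_smooth_affine Q c (k be a b : R) : k = 1 \/ k = -1 ->
  (forall x v, Q x v -> Q x (k *: v)) -> pw_smooth Q c a b ->
  let a' := k * (a - be) in let b' := k * (b - be) in
  if k == 1 then pw_smooth Q (fun s => c (k * s + be)) a' b'
  else pw_smooth Q (fun s => c (k * s + be)) b' a'.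
Proof.
move=> k1 Qk H /=.
have kk : k * k = 1 by case: k1 => ->; rewrite ?mulr1 // mulrNN mulr1.
have arc a' b' : a' < b' -> smooth_arc Q c a' b' -> forall x y, x < y ->
    (forall t, x <= t <= y -> a' <= k * t + be <= b') ->
    smooth_arc Q (fun s => c (k * s + be)) x y.
  move=> ab /(arcP _ _ (ltW ab))[s Hs] x y xy xyab; apply/arcP; first exact: ltW.
  exists (fun z => s (k * z + be)) => t /xyab /Hs[Cs st Qs].
  by have [Cs' ->] := curve_affine Cs; split => //; exact: Qk.
elim: H => [a' b' ab Harc|a' b' e _ IH1 _ IH2].
  case: ifPn => [/eqP k_1|kn1].
    apply: pw_smooth_arc; first by rewrite k_1; lra.
    apply: arc Harc _ _ _ _ => //; first by rewrite k_1; lra.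
    by move=> t; rewrite k_1 => /andP[? ?]; apply/andP; split; lra.
  have k_1 : k = -1 by case: k1 kn1 => ->; rewrite ?eqxx.
  apply: pw_smooth_arc; first by rewrite k_1; lra.
  apply: arc Harc _ _ _ _ => //; first by rewrite k_1; lra.
  by move=> t; rewrite k_1 => /andP[? ?]; apply/andP; split; lra.
by move: IH1 IH2; case: ifP => _ H1 H2; [exact: pw_smooth_cat H1 H2|exact: pw_smooth_cat H2 H1].
Qed.

(** Covers at once [hjoined theta], where Q is horizontality, and ordinary path-connectedness, where
    Q is trivial. *)
Definition joined Q (x y : A) := exists c a b, [/\ pw_smooth Q c a b, c a = x & c b = y].

Lemma joined_refl Q (x : A) : Q x 0 -> joined Q x x.
Proof.
move=> Qx; exists (fun=> x), 0, 1; split => //; apply: pw_smooth_arc; first exact: ltr01.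
apply/arcP => //; exists (fun=> x) => t _; split => //; first exact: curve_smooth_cst.
by rewrite velocity_cst.
Qed.

Lemma joined_sym Q (x y : A) : (forall x v, Q x v -> Q x (- v)) ->
  joined Q x y -> joined Q y x.
Proof.
move=> QN [c [a [b [H <- <-]]]].
have := @pw_smooth_affine Q c (-1) 0 a b (or_intror erefl) _ H.
have h : (-1 : R) < 1 by lra.
rewrite /= (lt_eqF h).
move=> H'; exists (fun s => c (-1 * s + 0)), (-1 * (b - 0)), (-1 * (a - 0)).
split; first by apply: H' => z v /QN; rewrite scaleN1r.
  by rewrite addr0 subr0 mulrA mulrNN mulr1 mul1r.
by rewrite addr0 subr0 mulrA mulrNN mulr1 mul1r.
Qed.

(* The factor 1 makes this an instance of [pw_smooth_affine]. *)
Definition glue c d (b b' : R) (t : R) : A := if t <= b then c t else d (1 * t + (b' - b)).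

Lemma glue_pw Q c d (a b a' b' : R) :
  pw_smooth Q c a b -> pw_smooth Q d a' b' -> c b = d a' ->
  [/\ pw_smooth Q (glue c d b a') a b,
      pw_smooth Q (glue c d b a') b (b + (b' - a')),
      forall t, a <= t <= b -> glue c d b a' t = c t &
      forall t, b <= t <= b + (b' - a') -> glue c d b a' t = d (1 * t + (a' - b))].
Proof.
move=> H1 H2 cd.
have h1 t : a <= t <= b -> glue c d b a' t = c t by rewrite /glue => /andP[_ ->].
have h2 t : b <= t <= b + (b' - a') -> glue c d b a' t = d (1 * t + (a' - b)).
  move=> /andP[tb _]; rewrite /glue; case: ifPn => // tb'.
  have -> : t = b by apply/eqP; rewrite eq_le tb tb'.
  by rewrite cd; congr d; ring.
split => //; first by apply: pw_smooth_eq H1 => t /h1.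
have := @pw_smooth_affine Q d 1 (a' - b) a' b' (or_introl erefl) _ H2.
rewrite /= eqxx !mul1r => H.
apply: (@pw_smooth_eq _ (fun s => d (1 * s + (a' - b)))); first by move=> t /h2.
have -> : b = a' - (a' - b) by ring.
have -> : a' - (a' - b) + (b' - a') = b' - (a' - (a' - (a' - b))) by ring.
have -> : (a' - (a' - (a' - b))) = a' - b by ring.
by apply: H => z v; rewrite scale1r.
Qed.

Lemma joined_trans Q (x y z : A) : joined Q x y -> joined Q y z -> joined Q x z.
Proof.
move=> [c [a [b [H1 <- <-]]]] [d [a' [b' [H2 da' <-]]]].
have ab := pw_smooth_lt H1; have ab' := pw_smooth_lt H2.
have [H3 H4 h1 h2] := @glue_pw Q c d a b a' b' H1 H2 (esym da').
exists (glue c d b a'), a, (b + (b' - a')); split.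
- exact: pw_smooth_cat H3 H4.
- by rewrite h1 // lexx ltW.
- by rewrite h2; [congr d; ring|apply/andP; split; lra].
Qed.

Lemma joined_near (x : A) : \forall y \near x, joined (fun _ _ => True) x y.
Proof.
pose a := chart_at x.
have Aa : atlas a := chart_at_atlas x; have ax : cdom a x := chart_at_dom x.
have [e e0 He] := near_closed_ball (crange_near ax).
have H : \forall y \near x, `|cmap a y - cmap a x| < e.
  by have := near_comp (cmap_cvg ax) (closed_ball_near (cmap a x) e0); apply: filterS.
apply: filterS2 H (chart_near ax) => y ye ay.
pose l (s : R) : 'rV[R]_n := cmap a x + s *: (cmap a y - cmap a x).
exists (cinv a \o l), 0, 1; split; last 2 first.
- by rewrite /= /l scale0r addr0 cmapK.
- by rewrite /= /l scale1r addrC subrK cmapK.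
apply: pw_smooth_arc; first exact: ltr01.
apply/arcP => //; exists (cinv a \o l) => t /andP[t0 t1]; split => //.
have [d1 d2] : cdom a (cinv a (l t)) /\ cmap a (cinv a (l t)) = l t.
  apply: He; rewrite /l addrAC subrr add0r normrZ ger0_norm //.
  by rewrite (le_trans _ (ltW ye)) // ler_piMl.
by apply: (@curve_smooth_cinv _ _ _ a (cinv a (l t)) l t Aa d1 (esym d2) _).1;
  exact: (line_smooth _ _ _).1.
Qed.

Lemma connected_joined (x y : A) : connected [set: A] -> joined (fun _ _ => True) x y.
Proof.
move=> cA; apply: (connected_equiv cA) => [z|z w|z w r|z].
- exact: joined_refl.
- exact: joined_sym.
- exact: joined_trans.
- exact: joined_near.
Qed.

End Curves.

(** * Lengths and Riemannian distances *)

Section Length.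
Context {R : realType} {n : nat} {A : manifold R n}.
Implicit Types (g : tensor2 A) (Q : A -> 'rV[R]_n -> Prop) (c : R -> A).

Definition speed2 g c (t : R) : R := g (c t) (velocity c t) (velocity c t).

(** The regularity from which measurability and finiteness of lengths follow. Stating it for tensors
    in general lets the results apply to [bundle_metric] directly, without a proof of [riemannian]
    for it. *)
Definition speed_continuous g := forall c t, curve_smooth_at c t ->
  {for t, continuous (speed2 g c)}.

Let mu := @lebesgue_measure R.

Lemma curve_lengthE g c (a b : R) :
  curve_length g c a b = (\int[mu]_(t in `[a, b]) (Num.sqrt (speed2 g c t))%:E)%E.
Proof. by []. Qed.

Lemma curve_length_ge0 g c (a b : R) : (0 <= curve_length g c a b)%E.
Proof. by apply: integral_ge0 => t _; rewrite lee_fin sqrtr_ge0. Qed.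

Lemma speed_within g c (a b : R) : speed_continuous g ->
  (forall t, a <= t <= b -> curve_smooth_at c t) ->
  {within `[a, b], continuous (fun t => Num.sqrt (speed2 g c t))}.
Proof.
move=> sg Cc; apply: continuous_in_subspaceT => t; rewrite inE /= in_itv => /Cc /sg H.
by apply: continuous_comp H _; exact: sqrt_continuous.
Qed.

Lemma speed_measurable g c (a b : R) : speed_continuous g ->
  (forall t, a <= t <= b -> curve_smooth_at c t) ->
  measurable_fun `[a, b] (fun t => Num.sqrt (speed2 g c t)).
Proof.
move=> sg Cc; apply: subspace_continuous_measurable_fun => //.
exact: speed_within.
Qed.

(** The interval is open because the velocity at an end point depends on values outside [a, b]; the
    two end points do not affect the integral. *)
Lemma speed2_eq g c d (a b : R) : (forall t, a <= t <= b -> c t = d t) ->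
  {in `]a, b[, (fun t => Num.sqrt (speed2 g c t)) =1 (fun t => Num.sqrt (speed2 g d t))}.
Proof.
move=> cd t; rewrite in_itv /= => /andP[ta tb].
have E : \forall s \near t, c s = d s.
  have : \forall s \near t, s \in `]a, b[ by apply: near_in_itvoo; rewrite in_itv /= ta.
  by apply: filterS => s; rewrite in_itv /= => /andP[? ?]; apply: cd; rewrite !ltW.
by rewrite /speed2 (velocity_near_eq E) (nbhs_singleton E).
Qed.

Lemma arc_measurable g Q c (a b : R) : speed_continuous g -> a <= b ->
  smooth_arc Q c a b -> measurable_fun `[a, b] (fun t => Num.sqrt (speed2 g c t)).
Proof.
move=> sg ab /(arcP _ _ ab)[s Hs].
have ms : measurable_fun `[a, b] (fun t => Num.sqrt (speed2 g s t)).
  by apply: speed_measurable => // t /Hs[].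
apply: (@measurable_fun_itv_cc _ _ _ false true).
have E : {in `]a, b[, (fun t => Num.sqrt (speed2 g s t)) =1 (fun t => Num.sqrt (speed2 g c t))}.
  by apply: speed2_eq => t /Hs[].
apply: (eq_measurable_fun (fun t => Num.sqrt (speed2 g s t))); first by move=> t; rewrite inE => /E.
by apply: measurable_funS ms => //; exact: subset_itv_oo_cc.
Qed.

Lemma curve_length_eq g c d (a b : R) :
  (forall t, a <= t <= b -> c t = d t) ->
  measurable_fun `[a, b] (fun t => Num.sqrt (speed2 g c t)) ->
  curve_length g c a b = curve_length g d a b.
Proof.
move=> cd mc; have E := speed2_eq g cd.
have mc' : measurable_fun `]a, b[ (fun t => Num.sqrt (speed2 g c t)).
  by apply: measurable_funS mc => //; exact: subset_itv_oo_cc.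
apply: (@eq_integral_itv_bounded _ a b (fun t => Num.sqrt (speed2 g d t))
  (fun t => Num.sqrt (speed2 g c t)) true false mc' _ E).
by apply: eq_measurable_fun mc' => t; rewrite inE => /E.
Qed.

Lemma length_split g c (a b d : R) : a <= b -> b <= d ->
  measurable_fun `[a, b] (fun t => Num.sqrt (speed2 g c t)) ->
  measurable_fun `[b, d] (fun t => Num.sqrt (speed2 g c t)) ->
  measurable_fun `[a, d] (fun t => Num.sqrt (speed2 g c t)) /\
  curve_length g c a d = (curve_length g c a b + curve_length g c b d)%E.
Proof.
move=> ab bd m1 m2.
have U : `[a, d]%classic = `[a, b]%classic `|` `]b, d]%classic.
  by rewrite -itv_bndbnd_setU // bnd_simp.
have m2' : measurable_fun `]b, d] (fun t => Num.sqrt (speed2 g c t)).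
  by apply: measurable_funS m2 => //; exact: subset_itv_oc_cc.
have m : measurable_fun `[a, d] (fun t => Num.sqrt (speed2 g c t)).
  by rewrite U; apply/measurable_funU.
split => //; rewrite !curve_lengthE U ge0_integral_setU //.
- by congr (_ + _)%E; apply: integral_itv_obnd_cbnd; exact/measurable_EFinP.
- by rewrite -U; exact/measurable_EFinP.
- apply/disj_setPS => t [] /=; rewrite !in_itv /= => /andP[_ tb] /andP[bt _].
  by move: (lt_le_trans bt tb); rewrite ltxx.
Qed.

Lemma pw_measurable g Q c (a b : R) : speed_continuous g -> pw_smooth Q c a b ->
  measurable_fun `[a, b] (fun t => Num.sqrt (speed2 g c t)).
Proof.
move=> sg; elim => [a' b' ab H|a' b' d H1 m1 H2 m2].
  exact: arc_measurable (ltW ab) H.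
have ab := ltW (pw_smooth_lt H1); have bd := ltW (pw_smooth_lt H2).
exact: (length_split ab bd m1 m2).1.
Qed.

Lemma pw_length_cat g Q Q' c (a b d : R) : speed_continuous g ->
  pw_smooth Q c a b -> pw_smooth Q' c b d ->
  curve_length g c a d = (curve_length g c a b + curve_length g c b d)%E.
Proof.
move=> sg H1 H2.
have ab := ltW (pw_smooth_lt H1); have bd := ltW (pw_smooth_lt H2).
exact: (length_split ab bd (pw_measurable sg H1) (pw_measurable sg H2)).2.
Qed.

Lemma arc_length_fin g c (a b : R) : speed_continuous g ->
  (forall t, a <= t <= b -> curve_smooth_at c t) -> (curve_length g c a b < +oo)%E.
Proof.
move=> sg Cc; have /integrableP[_] := continuous_compact_integrable (@segment_compact _ a b)
  (speed_within sg Cc).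
apply: le_lt_trans; rewrite curve_lengthE le_eqVlt; apply/orP; left; apply/eqP.
by apply: eq_integral => t _ /=; rewrite ger0_norm // sqrtr_ge0.
Qed.

Lemma pw_length_fin g Q c (a b : R) : speed_continuous g -> pw_smooth Q c a b ->
  (curve_length g c a b < +oo)%E.
Proof.
move=> sg; elim => [a' b' ab /[dup] H /(arcP _ _ (ltW ab))[s Hs]|a' b' d H1 l1 H2 l2].
  rewrite (@curve_length_eq _ _ s); [|by move=> t /Hs[]|exact: arc_measurable (ltW ab) H].
  by apply: arc_length_fin => // t /Hs[].
by rewrite (pw_length_cat sg H1 H2) lte_add_pinfty.
Qed.

Lemma length_shift g Q c (be a b : R) : speed_continuous g -> pw_smooth Q c a b ->
  curve_length g (fun t => c (1 * t + be)) (a - be) (b - be) = curve_length g c a b.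
Proof.
move=> sg.
pose cs := fun t => c (1 * t + be).
(* Measurability is added to the claim because adding the lengths of two pieces with [length_split]
   requires it. *)
suff H : pw_smooth Q c a b -> measurable_fun `[a - be, b - be] (fun t =>
  Num.sqrt (speed2 g cs t)) /\
    curve_length g cs (a - be) (b - be) = curve_length g c a b by move=> /H[].
elim => [a' b' ab /[dup] Harc /(arcP _ _ (ltW ab))[s Hs]|a' b' d H1 [m1 l1] H2 [m2 l2]]; last first.
  have ab := pw_smooth_lt H1; have bd := pw_smooth_lt H2.
  have ab' : a' - be <= b' - be by lra.
  have bd' : b' - be <= d - be by lra.
  have [m l] := length_split ab' bd' m1 m2.
  split; first exact: m.
  exact: etrans l (etrans (f_equal2 (fun x y => (x + y)%E) l1 l2) (esym (pw_length_cat sg H1 H2))).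
have ab' : a' - be <= b' - be by lra.
pose ss := fun t => s (1 * t + be).
have Css t : a' - be <= t <= b' - be -> curve_smooth_at ss t /\
    velocity ss t = 1 *: velocity s (1 * t + be).
  move=> /andP[? ?]; apply: curve_affine; case: (Hs (1 * t + be)) => //.
  by rewrite mul1r; apply/andP; split; lra.
have mss : measurable_fun `[a' - be, b' - be] (fun t => Num.sqrt (speed2 g ss t)).
  by apply: speed_measurable => // t /Css[].
have Ess t : a' - be <= t <= b' - be -> ss t = cs t.
  move=> /andP[? ?]; rewrite /ss /cs; case: (Hs (1 * t + be)) => //.
  by rewrite mul1r; apply/andP; split; lra.
split.
  apply: (@measurable_fun_itv_cc _ _ _ false true).
  apply: (eq_measurable_fun (fun t => Num.sqrt (speed2 g ss t))).
    by move=> t; rewrite inE => /(speed2_eq g Ess).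
  by apply: measurable_funS mss => //; exact: subset_itv_oo_cc.
rewrite -(curve_length_eq Ess mss) (@curve_length_eq _ c s); last 2 first.
- by move=> t /Hs[].
- exact: arc_measurable (ltW ab) Harc.
have Ef : (fun x : R => 1 * x + be)^`()%classic = (fun=> 1 : R).
  by apply/funext => t; have [_ []] := affine_smooth 1 be t.
have Da t : derivable (fun x : R => 1 * x + be) t 1.
  by apply/derivable1_diffP; have [_ []] := affine_smooth 1 be t.
have Ca t : {for t, continuous (fun x : R => 1 * x + be)}.
  by apply: differentiable_continuous; apply/derivable1_diffP.
have ea : 1 * (a' - be) + be = a' by ring.
have eb : 1 * (b' - be) + be = b' by ring.
have := @integration_by_substitution_increasing _ (fun x => 1 * x + be)
  (fun t => Num.sqrt (speed2 g s t)) (a' - be) (b' - be) ab'.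
rewrite ea eb !curve_lengthE => ->.
- apply: eq_integral => t; rewrite inE /= in_itv /= => /Css[_ E].
  by rewrite Ef !fctE mulr1 /speed2 E scale1r.
- by move=> x y _ _ xy; rewrite !mul1r ltrD2r.
- rewrite Ef.
  by move=> x _; exact: cvg_cst.
- rewrite Ef.
  exact: is_cvg_cst.
- rewrite Ef.
  exact: is_cvg_cst.
- split; first by move=> x _; exact: Da.
    by apply: cvg_at_right_filter; exact: Ca.
  by apply: cvg_at_left_filter; exact: Ca.
- by apply: speed_within => // t /Hs[].
Qed.

Lemma riem_dist_ge0 g (x y : A) : (0 <= riem_dist g x y)%E.
Proof.
apply/ereal_infP => l [c [a [b [_ _ _ ->]]]]; exact: curve_length_ge0.
Qed.

Lemma riem_dist_le g Q c (a b : R) : pw_smooth Q c a b ->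
  (riem_dist g (c a) (c b) <= curve_length g c a b)%E.
Proof.
move=> H; apply: ereal_inf_lbound; exists c, a, b; split => //.
by apply: pw_smoothW H.
Qed.

Lemma curve_length_cst g (x : A) (a b : R) : (forall y, g y 0 0 = 0) ->
  curve_length g (fun=> x) a b = 0%E.
Proof.
move=> g0; apply: integral0_eq => t _.
by rewrite velocity_cst g0 sqrtr0.
Qed.

Lemma riem_dist_triangle g (x y z : A) : speed_continuous g ->
  (riem_dist g x z <= riem_dist g x y + riem_dist g y z)%E.
Proof.
move=> sg.
have key l1 l2 : [set l | exists c a b, [/\ pw_smooth (fun _ _ => True) c a b, c a = x, c b = y &
      l = curve_length g c a b]] l1 ->
    [set l | exists c a b, [/\ pw_smooth (fun _ _ => True) c a b, c a = y, c b = z &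
      l = curve_length g c a b]] l2 -> (riem_dist g x z <= l1 + l2)%E.
  move=> [c [a [b [H1 <- cb ->]]]] [d [a' [b' [H2 da <- ->]]]].
  have ab := pw_smooth_lt H1; have ab' := pw_smooth_lt H2.
  have cd : c b = d a' by rewrite cb.
  have [H3 H4 h1 h2] := glue_pw H1 H2 cd.
  have e1 : glue c d b a' a = c a by rewrite h1 // lexx ltW.
  have e2 : glue c d b a' (b + (b' - a')) = d b'.
    by rewrite h2; [congr d; ring|apply/andP; split; lra].
  rewrite -e1 -e2; apply: le_trans (riem_dist_le g (pw_smooth_cat H3 H4)) _.
  rewrite (pw_length_cat sg H3 H4).
  rewrite (curve_length_eq h1 (pw_measurable sg H3)) (curve_length_eq h2 (pw_measurable sg H4)).
  have := length_shift (a' - b) sg H2.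
  have -> : a' - (a' - b) = b by ring.
  have -> : b' - (a' - b) = b + (b' - a') by ring.
  move=> ->; exact: lexx.
apply/lee_addgt0Pr => e e0.
have [->|ry] := eqVneq (riem_dist g x y) +oo%E;
  first by rewrite !addye ?leey // gt_eqF // (lt_le_trans _ (riem_dist_ge0 _ _ _)) // ltNy0.
have [->|rz] := eqVneq (riem_dist g y z) +oo%E.
  by rewrite addey ?addye ?leey // gt_eqF // (lt_le_trans _ (riem_dist_ge0 _ _ _)) // ltNy0.
have fy : riem_dist g x y \is a fin_num.
  by rewrite ge0_fin_numE ?riem_dist_ge0 // ltey.
have fz : riem_dist g y z \is a fin_num.
  by rewrite ge0_fin_numE ?riem_dist_ge0 // ltey.
have e2 : 0 < e / 2 by rewrite divr_gt0.
have [l1 S1 L1] := lb_ereal_inf_adherent e2 fy.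
have [l2 S2 L2] := lb_ereal_inf_adherent e2 fz.
apply: le_trans (key l1 l2 S1 S2) _.
apply: le_trans (leeD (ltW L1) (ltW L2)) _.
by rewrite addeACA -EFinD -splitr.
Qed.

End Length.

Lemma pw_smooth_map {R : realType} {m n} {A : manifold R m} {B : manifold R n}
    (F : A -> B) (Q : A -> 'rV[R]_m -> Prop) (Q' : B -> 'rV[R]_n -> Prop)
    (c : R -> A) (a b : R) :
  (forall c t, curve_smooth_at c t -> Q (c t) (velocity c t) ->
     curve_smooth_at (F \o c) t /\ Q' (F (c t)) (velocity (F \o c) t)) ->
  pw_smooth Q c a b -> pw_smooth Q' (F \o c) a b.
Proof.
move=> H; elim => [a' b' ab /(arcP _ _ (ltW ab))[s Hs]|a' b' d _ p1 _ p2];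
  last exact: pw_smooth_cat p1 p2.
apply: pw_smooth_arc => //; apply/arcP; first exact: ltW.
exists (F \o s) => t /Hs[Cs st Qs]; have [Cf Qf] := H s t Cs Qs.
by split => //=; rewrite st.
Qed.

(** F is tested on smooth curves instead of being differentiated, and only on those with velocities
    in Q: this fits both the coset map, on all curves, and right translations, on horizontal
    ones. *)
Lemma pw_transport {R : realType} {m n} {A : manifold R m} {B : manifold R n}
    (gA : tensor2 A) (gB : tensor2 B) (F : A -> B)
    (Q : A -> 'rV[R]_m -> Prop) (c : R -> A) (a b : R) :
  speed_continuous gA -> speed_continuous gB ->
  (forall c t, curve_smooth_at c t -> Q (c t) (velocity c t) ->
     curve_smooth_at (F \o c) t /\ speed2 gB (F \o c) t <= speed2 gA c t) ->
  pw_smooth Q c a b ->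
  pw_smooth (fun _ _ => True) (F \o c) a b /\
  (curve_length gB (F \o c) a b <= curve_length gA c a b)%E.
Proof.
move=> sA sB H; elim => [a' b' ab /[dup] Harc /(arcP _ _ (ltW ab))[s Hs]|a' b' d H1 [p1 l1] H2
  [p2 l2]]; last first.
  split; first exact: pw_smooth_cat p1 p2.
  by rewrite (pw_length_cat sA H1 H2) (pw_length_cat sB p1 p2) leeD.
have HFs t : a' <= t <= b' -> curve_smooth_at (F \o s) t /\ speed2 gB (F \o s) t <= speed2 gA s t.
  by move=> /Hs[Cs _ Qs]; exact: H.
have E t : a' <= t <= b' -> s t = c t by move=> /Hs[].
have EF t : a' <= t <= b' -> (F \o s) t = (F \o c) t by move=> /E /= ->.
have mF : measurable_fun `[a', b'] (fun t => Num.sqrt (speed2 gB (F \o s) t)).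
  by apply: speed_measurable => // t /HFs[].
have mA : measurable_fun `[a', b'] (fun t => Num.sqrt (speed2 gA s t)).
  by apply: speed_measurable => // t /Hs[].
split.
  apply: pw_smooth_arc => //; apply/arcP; first exact: ltW.
  by exists (F \o s) => t tab; split => //; [exact: (HFs t tab).1|exact: EF].
rewrite -(curve_length_eq EF mF) -(curve_length_eq E mA) !curve_lengthE.
apply: ge0_le_integral => //.
- exact/measurable_EFinP.
- exact/measurable_EFinP.
- move=> t; rewrite /= in_itv /= => /HFs[_ h]; rewrite lee_fin.
  exact: ler_wsqrtr.
Qed.

(** * Riemannian metrics and submersions *)

Section MetricCharts.
Context {R : realType} {n : nat} {A : manifold R n}.


Definition gram (g : tensor2 A) (a : chart R A n) (y : 'rV[R]_n) : 'M[R]_n :=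
  \matrix_(i, j) g (cinv a y) (chart_field a y (delta_mx 0 i)) (chart_field a y (delta_mx 0 j)).

Lemma scalar_sum (V : lmodType R) (f : V -> R) k (v : 'I_k -> V) (r : 'I_k -> R) :
  scalar f -> f (\sum_i r i *: v i) = \sum_i r i * f (v i).
Proof.
move=> lf; pose l : {scalar V} := HB.pack f (GRing.isLinear.Build _ _ _ _ f lf).
rewrite -[f]/(l : V -> R) linear_sum; apply: eq_bigr => i _.
by rewrite linearZ.
Qed.

Lemma chart_field_sum (a : chart R A n) (y v : 'rV[R]_n) :
  chart_field a y v = \sum_i v 0 i *: chart_field a y (delta_mx 0 i).
Proof.
rewrite {1}(row_sum_delta v) /chart_field linear_sum.
by apply: eq_bigr => i _; rewrite linearZ.
Qed.

Lemma gramE (g : tensor2 A) (a : chart R A n) (y v w : 'rV[R]_n) :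
  (forall x v, scalar (g x v)) -> (forall x v w, g x v w = g x w v) ->
  (v *m gram g a y *m w^T) 0 0 = g (cinv a y) (chart_field a y v) (chart_field a y w).
Proof.
move=> sg cg; rewrite (chart_field_sum _ _ w) (scalar_sum _ _ (sg _ _)) mxE.
apply: eq_bigr => j _; rewrite !mxE mulrC; congr (_ * _).
rewrite (chart_field_sum _ _ v) cg (scalar_sum _ _ (sg _ _)).
by apply: eq_bigr => i _; rewrite mxE cg.
Qed.

Lemma gram_smooth (g : tensor2 A) (a : chart R A n) (x : A) : riemannian g ->
  atlas a -> cdom a x -> smooth_at (gram g a) (cmap a x).
Proof.
move=> [_ _ _ Cg] Aa ax; apply: smooth_at_mx => i j.
under eq_fun do rewrite mxE.
apply: Cinf_smooth_at (Cg a Aa (delta_mx 0 i) (delta_mx 0 j)).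
by apply: open_nbhs_nbhs; split; [exact: crange_open|exists x].
Qed.

Lemma gram_posdef (g : tensor2 A) (a : chart R A n) (x : A) : riemannian g ->
  atlas a -> cdom a x -> posdef (gram g a (cmap a x)).
Proof.
move=> [sg cg pg _] Aa ax z z0; rewrite gramE //; apply: pg.
by apply: contra_neq z0; exact: chart_field_inj.
Qed.

Lemma gram_sym (g : tensor2 A) (a : chart R A n) (y : 'rV[R]_n) : riemannian g ->
  (gram g a y)^T = gram g a y.
Proof. by move=> [_ cg _ _]; apply/matrixP => i j; rewrite !mxE cg. Qed.

(** In one fixed chart the squared speed is h' Gram(h) h'^T, a continuous expression near t. *)
Lemma speed_continuous_riemannian (g : tensor2 A) : riemannian g -> speed_continuous g.
Proof.
move=> rg c t Cc; have [sg cg _ _] := rg.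
pose a := chart_at (c t).
have Aa : atlas a := chart_at_atlas _; have act : cdom a (c t) := chart_at_dom _.
have Ca := curve_smooth_chart Cc Aa act.
pose h := cmap a \o c.
have H : \forall s \near t, (derive1 h s *m gram g a (h s) *m (derive1 h s)^T) 0 0 = speed2 g c s.
  have H1 := near_comp (curve_smooth_continuous Cc) (chart_near act).
  have H2 := curve_smooth_near Cc.
  near=> s.
  have as_ : cdom a (c s) by near: s.
  have Cs : curve_smooth_at c s by near: s.
  by rewrite gramE // /speed2 (velocity_chart Cs Aa as_) /h /= cmapK.
have K : nCk 0 (fun s => (derive1 h s *m gram g a (h s) *m (derive1 h s)^T) 0 0) t.
  apply: nCk_coord; apply: nCk_mulmx; last first.
    by apply: nCk_trmx; apply: smooth_atW; exact: smooth_at_derive1.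
  apply: nCk_mulmx; first by apply: smooth_atW; exact: smooth_at_derive1.
  apply: (nCk_comp (has_coords_mx _ _) (smooth_atW 0 Ca)); apply: smooth_atW.
  exact: gram_smooth.
exact: nCk_continuous (nCk_near_eq H K).
Unshelve. all: by end_near. Qed.

(** [tmap] refers to the preferred charts at x and f x. To compare it with the derivative in
    arbitrary charts, the curve with coordinates cmap a x + s v is pushed forward by f and its
    velocity computed in both ways. *)
Lemma diff_chart {m} {B : manifold R m} (f : A -> B) (x : A) (a : chart R A n)
    (b : chart R B m) (v : 'rV[R]_n) :
  smooth f -> atlas a -> cdom a x -> atlas b -> cdom b (f x) ->
  chart_field b (cmap b (f x)) ('d (cmap b \o f \o cinv a) (cmap a x) v) =
  tmap f x (chart_field a (cmap a x) v).
Proof.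
move=> sf Aa ax Ab bfx.
pose l (s : R) : 'rV[R]_n := cmap a x + s *: v.
have l0 : l 0 = cmap a x by rewrite /l scale0r addr0.
have [Cl dl] := line_smooth (cmap a x) v 0.
have [Cc Hc] := curve_smooth_cinv Aa ax l0 Cl.
have c0 : (cinv a \o l) 0 = x by rewrite /= l0 cmapK.
have ac0 : cdom a ((cinv a \o l) 0) by rewrite c0.
have [Cfc vfc] := curve_smooth_comp Cc (smooth_at_of _ sf).
rewrite c0 in vfc.
have El : derive1 (cmap a \o (cinv a \o l)) 0 = v.
  rewrite -[RHS]dl; apply: near_derive1; apply: filterS Hc => s /= [_ ->] //.
rewrite (velocity_chart Cc Aa ac0) El c0 in vfc.
rewrite -vfc (velocity_chart Cfc Ab) /=; last by rewrite l0 cmapK.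
rewrite l0 cmapK //; congr chart_field.
have [cf Cf] := smooth_at_of x sf.
have dF := smooth_at_differentiable (Cf a b Aa Ab ax bfx).
rewrite -l0 in dF.
have E := derive1_chain (smooth_at_differentiable Cl) dF.
by rewrite dl scale0r addr0 in E; rewrite -E.
Qed.

End MetricCharts.

(** With the inverse Gram matrix in [rinv], the field of [local_lift] is g-orthogonal to the fibres.
    Smoothness of that field uses surjectivity and positivity on a whole neighbourhood, which the
    set N secures. *)
Lemma submersion_lift {R : realType} {n m : nat} {A : manifold R n} {B : manifold R m}
    (g : tensor2 A) (f : A -> B) (x0 : A) (c : R -> B) (s0 : R) :
  riemannian g -> smooth f -> (forall x w, exists v, tmap f x v = w) ->
  curve_smooth_at c s0 -> c s0 = f x0 ->
  exists h : R -> A, [/\ curve_smooth_at h s0, h s0 = x0,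
    \forall s \near s0, f (h s) = c s &
    \forall s \near s0, forall k, tmap f (h s) k = 0 -> g (h s) (velocity h s) k = 0].
Proof.
move=> rg sf surj Cc cs0; have [sg cg _ _] := rg.
pose a := chart_at x0; pose b := chart_at (f x0).
have Aa : atlas a := chart_at_atlas _; have ax : cdom a x0 := chart_at_dom _.
have Ab : atlas b := chart_at_atlas _; have bfx : cdom b (f x0) := chart_at_dom _.
pose F := cmap b \o f \o cinv a.
have [cf Cf] := smooth_at_of x0 sf.
have CF : smooth_at F (cmap a x0) := Cf a b Aa Ab ax bfx.
pose N := [set y | cdom a (cinv a y) /\ cdom b (f (cinv a y)) /\ cmap a (cinv a y) = y].
have HN : \forall y \near cmap a x0, N y.
  have H1 := crange_near ax.
  have H2 := cinv_near ax (near_comp cf (chart_near bfx)).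
  by apply: filterS2 H1 H2 => y [? ?] ?.
have sur y : N y -> forall v : 'rV_m, exists w : 'rV_n, w *m 'J F y = v.
  move=> [ay [bfy Ey]] v.
  have [w Hw] := surj (cinv a y) (chart_field b (cmap b (f (cinv a y))) v).
  have [w' Hw'] := chart_field_surj w Aa ay.
  exists w'; rewrite mul_jacobian; apply/eqP; rewrite -subr_eq0; apply/eqP.
  apply: (chart_field_inj Ab bfy); rewrite /chart_field linearB /= -!/(chart_field _ _ _).
  have D := diff_chart w' sf Aa ay Ab bfy.
  by rewrite Ey in D Hw'; rewrite D Hw' Hw subrr.
have pos y : N y -> posdef (gram g a y) by move=> [ay [_ Ey]]; rewrite -Ey; exact: gram_posdef.
pose L y := rinv (invmx (gram g a y)) ('J F y).
have CL : smooth_at L (cmap a x0).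
  have /smooth_at_nCk CG := gram_smooth rg Aa ax.
  have /smooth_at_nCk CJ := jacobian_smooth CF.
  apply/smooth_at_nCk; near=> y => k.
  have Ny : N y by near: y.
  apply: nCk_rinv.
  - by apply: posdef_inv; [exact: gram_sym|exact: pos].
  - exact: sur.
  - apply: nCk_invmx; first by apply: posdef_unit; exact: pos.
    by move: k; near: y.
  - by move: k; near: y.
have HL : \forall y \near cmap a x0, forall v, 'd (cmap b \o f \o cinv a) y (v *m L y) = v.
  apply: filterS HN => y Ny v; rewrite -mul_jacobian rinvK //; last exact: sur.
  by apply: posdef_inv; [exact: gram_sym|exact: pos].
have [h [Ch h0 fh Hh]] := local_lift sf Aa ax Ab bfx CL HL Cc cs0.
exists h; split => //.
have HNh : \forall s \near s0, N (cmap a (h s)).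
  apply: (@near_comp _ _ (cmap a \o h)); last by rewrite /= h0.
  by apply: continuous_comp; [exact: curve_smooth_continuous|rewrite h0; exact: cmap_cvg].
near=> s => k fk.
have [ahs [v Ev]] : cdom a (h s) /\ exists v,
  velocity h s = chart_field a (cmap a (h s)) (v *m L (cmap a (h s))) by near: s.
have Ns : N (cmap a (h s)) by near: s.
have [k' Hk'] := chart_field_surj k Aa ahs.
have bfhs : cdom b (f (h s)) by case: Ns => _ []; rewrite cmapK.
rewrite Ev -Hk' -{1}(cmapK ahs) -gramE // rinv_orth ?mxE //; first exact: pos.
rewrite mul_jacobian; apply: (chart_field_inj Ab bfhs).
by rewrite /F diff_chart // Hk'.
Unshelve. all: by end_near. Qed.

Lemma tmap0 {R : realType} {a b} {A : manifold R a} {B : manifold R b} (f : A ->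
  B) (x : A) : tmap f x 0 = 0.
Proof. by rewrite /tmap linear0. Qed.

Lemma scalarD {R : realType} (V : lmodType R) (f : V -> R) (u v : V) :
  scalar f -> f (u + v) = f u + f v.
Proof. by move=> /(_ 1 u v); rewrite scale1r mul1r. Qed.

Lemma scalar0 {R : realType} (V : lmodType R) (f : V -> R) : scalar f -> f 0 = 0.
Proof. by move=> /(_ (-1) 0 0); rewrite scaler0 addr0 mulN1r addNr. Qed.

Lemma scalarN {R : realType} (V : lmodType R) (f : V -> R) (v : V) :
  scalar f -> f (- v) = - f v.
Proof.
by move=> lf; have := lf (-1) v 0; rewrite scaleN1r addr0 (scalar0 lf) addr0 mulN1r.
Qed.

(** * Bi-invariant metrics on Lie groups *)

Section LieGroups.
Context {R : realType} {k : nat} {G : lie_group R k}.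
Local Notation "g * h" := (lmul g h).
Local Notation "g ^-1" := (linv g).
Local Notation one := (lone G).

Lemma lmulVr (g : G) : g * g^-1 = one.
Proof.
by rewrite -[LHS]lmul1 -{1}(lmulV (g^-1)) -lmulA (lmulA (g^-1)) lmulV lmul1 lmulV.
Qed.

Lemma lmulr1 (g : G) : g * one = g.
Proof. by rewrite -(lmulV g) lmulA lmulVr lmul1. Qed.

Lemma lmulVK (g h : G) : g * (g^-1 * h) = h.
Proof. by rewrite lmulA lmulVr lmul1. Qed.

Lemma curve_smooth_mul (g h : R -> G) (t : R) :
  curve_smooth_at g t -> curve_smooth_at h t ->
  curve_smooth_at (fun s => g s * h s) t /\
  velocity (fun s => g s * h s) t =
    tmap (fun x => x * h t) (g t) (velocity g t) +
    tmap (fun y => g t * y) (h t) (velocity h t).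
Proof.
move=> Cg Ch; apply: (@curve_smooth_comp2 _ _ _ _ _ _ _ (fun x y => x * y)) => //.
exact/smooth2_at_of/lmul_smooth.
Qed.

Lemma curve_smooth_inv (g : R -> G) (t : R) :
  curve_smooth_at g t -> curve_smooth_at (fun s => (g s)^-1) t.
Proof.
move=> Cg; apply: (@curve_smooth_comp _ _ _ _ _ (fun x => x^-1) g t Cg _).1.
exact/smooth_at_of/linv_smooth.
Qed.

(** Up to a constant, h is the inverse of g. Differentiating the product shows that the right
    translate of g' is minus the left translate of h', and both translations are isometries. *)
Lemma speed2_mul_const (b : tensor2 G) (g h : R -> G) (t : R) (x : G) :
  biinvariant b -> curve_smooth_at g t -> curve_smooth_at h t ->
  (\forall s \near t, g s * h s = x) -> speed2 b g t = speed2 b h t.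
Proof.
move=> [rb lb rightb] Cg Ch gh; have [sb cb _ _] := rb.
have [_ V] := curve_smooth_mul Cg Ch.
have := velocity_near_eq gh; rewrite V velocity_cst => /eqP.
rewrite addr_eq0 => /eqP E.
rewrite /speed2 -(rightb (h t) (g t)) -[in RHS](lb (g t) (h t)) E.
by rewrite (scalarN _ (sb _ _)) cb (scalarN _ (sb _ _)) opprK.
Qed.

Lemma speed2_left (b : tensor2 G) (g : R -> G) (t : R) (x : G) :
  biinvariant b -> curve_smooth_at g t -> speed2 b (fun s => x * g s) t = speed2 b g t.
Proof.
move=> [rb lb _] Cg.
have [_ V] := curve_smooth_mul (curve_smooth_cst x t) Cg.
by rewrite /speed2 V velocity_cst tmap0 add0r; exact: lb.
Qed.

End LieGroups.

Section Submersions.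
Context {R : realType} {n m : nat} {A : manifold R n} {B : manifold R m}.
Context (gA : tensor2 A) (gB : tensor2 B) (f : A -> B).
Hypotheses (rA : riemannian gA) (sub : riemannian_submersion gA gB f).

(** The horizontal part w of v is obtained as the initial velocity of the horizontal lift of the
    image of a curve with velocity v. Then v - w is vertical, and Pythagoras applies. *)
Lemma submersion_le (x : A) (v : 'rV[R]_n) :
  gB (f x) (tmap f x v) (tmap f x v) <= gA x v v.
Proof.
have [sf surj iso] := sub; have [sg cg pg _] := rA.
have [c [Cc c0 cv]] := velocity_surj x v.
have [Cfc Vfc] := curve_smooth_comp Cc (smooth_at_of (c 0) sf).
have fc0 : (f \o c) 0 = f x by rewrite /= c0.
have [h [Ch h0 fh Hh]] := submersion_lift rA sf surj Cfc fc0.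
have {}Hh := nbhs_singleton Hh.
have [_ Vfh] := curve_smooth_comp Ch (smooth_at_of (h 0) sf).
have E : tmap f x (velocity h 0) = tmap f x v.
  by rewrite -h0 -Vfh h0 -cv -c0 -Vfc; exact: velocity_near_eq fh.
set w := velocity h 0 in Hh E; rewrite h0 in Hh.
rewrite -E iso //.
have kv : tmap f x (v - w) = 0 by rewrite /tmap linearB /= -!/(tmap _ _ _) E subrr.
have -> : gA x v v = gA x w w + gA x (v - w) (v - w).
  have gw : gA x w (v - w) = 0 by exact: Hh.
  rewrite -{1 2}(subrK w v); move: (v - w) gw => d gw.
  rewrite (scalarD _ _ (sg x (d + w))) !(cg x (d + w)) !(scalarD _ _ (sg _ _)).
  by rewrite (cg x d w) gw addr0 add0r addrC.
rewrite lerDl; have [d0|d0] := eqVneq (v - w) 0; last exact/ltW/pg.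
by rewrite d0 (scalar0 (sg _ _)).
Qed.

End Submersions.

(** * Principal connections and holonomy *)

Section Bundle.
Context {R : realType} {p m k : nat} {P : manifold R p} {M : manifold R m} {G : lie_group R k}.
Context (E : principal_bundle P M G).
Context (theta : P -> {linear 'rV[R]_p -> 'rV[R]_k}).
Hypothesis htheta : principal_connection E theta.
Local Notation pi := (bproj E).
Local Notation one := (lone G).

Lemma bactK (x : P) (g : G) : bact E (bact E x g) (linv g) = x.
Proof. by rewrite -bactM lmulVr bact1. Qed.

Lemma bactVK (x : P) (g : G) : bact E (bact E x (linv g)) g = x.
Proof. by rewrite -bactM lmulV bact1. Qed.

Lemma bproj_surj (z : M) : exists x, pi x = z.
Proof.
have [U [chi [psi [[_ Uz _ _] [_ H _]]]]] := btrivial E z.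
by exists (psi z one); have [] := H z one Uz.
Qed.

Lemma fiber_transitive (x y : P) : pi x = pi y -> exists g, y = bact E x g.
Proof.
move=> xy; have [U [chi [psi [[_ Uz _ _] [H1 H2 H3]]]]] := btrivial E (pi x).
exists (lmul (linv (chi x)) (chi y)).
rewrite -[LHS]H1 -?xy // -[RHS]H1 ?bproj_act // H3 //.
by rewrite lmulVK xy.
Qed.

Lemma curve_smooth_act (c : R -> P) (g : R -> G) (t : R) :
  curve_smooth_at c t -> curve_smooth_at g t ->
  curve_smooth_at (fun s => bact E (c s) (g s)) t /\
  velocity (fun s => bact E (c s) (g s)) t =
    tmap (fun x => bact E x (g t)) (c t) (velocity c t) +
    tmap (fun y => bact E (c t) y) (g t) (velocity g t).
Proof.
move=> Cc Cg; apply: (@curve_smooth_comp2 _ _ _ _ _ _ _ (fun x y => bact E x y)) => //.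
exact/smooth2_at_of/bact_smooth.
Qed.

Lemma horizontal_act (c : R -> P) (g : G) (t : R) :
  curve_smooth_at c t -> horizontal theta (c t) (velocity c t) ->
  curve_smooth_at (fun s => bact E (c s) g) t /\
  horizontal theta (bact E (c t) g) (velocity (fun s => bact E (c s) g) t).
Proof.
move=> Cc Hc; have [C V] := curve_smooth_act Cc (curve_smooth_cst g t).
split => //; rewrite /horizontal V velocity_cst tmap0 addr0.
by have [_ -> _] := htheta; rewrite Hc /Ad tmap0.
Qed.

Lemma horizontal0 (x : P) : horizontal theta x 0.
Proof. by rewrite /horizontal linear0. Qed.

Lemma hjoined_refl (x : P) : hjoined theta x x.
Proof. exact: joined_refl (horizontal0 x). Qed.

Lemma hjoined_sym (x y : P) : hjoined theta x y -> hjoined theta y x.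
Proof.
by apply: joined_sym => z v; rewrite /horizontal linearN => ->; rewrite oppr0.
Qed.

Lemma hjoined_trans (x y z : P) :
  hjoined theta x y -> hjoined theta y z -> hjoined theta x z.
Proof. exact: joined_trans. Qed.

Lemma hjoined_act (x y : P) (g : G) :
  hjoined theta x y -> hjoined theta (bact E x g) (bact E y g).
Proof.
move=> [c [a [b [H <- <-]]]]; exists (fun s => bact E (c s) g), a, b; split => //.
apply: (@pw_smooth_map _ _ _ _ _ (fun x => bact E x g)) H => d t Cd Hd.
exact: horizontal_act.
Qed.

Lemma hjoined_arc (h : R -> P) (s1 s2 : R) : s1 <= s2 ->
  (forall t, s1 <= t <= s2 -> curve_smooth_at h t /\ horizontal theta (h t) (velocity h t)) ->
  hjoined theta (h s1) (h s2).
Proof.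
rewrite le_eqVlt => /predU1P[->|s12] H; first exact: hjoined_refl.
exists h, s1, s2; split => //; apply: pw_smooth_arc => //; apply/arcP; first exact: ltW.
by exists h => t /H[].
Qed.

(** Writing g(s) = g(t) h(s) with h(t) = 1 turns the curve into y h(s) with y = x g(t). Its velocity
    at t is a fundamental vector, from which theta recovers h'(t), and left invariance gives the
    speed of g. *)
Lemma vertical_speed (b : tensor2 G) (x : P) (g : R -> G) (t : R) :
  biinvariant b -> curve_smooth_at g t ->
  let w := theta (bact E x (g t)) (tmap (fun y => bact E x y) (g t) (velocity g t)) in
  b one w w = speed2 b g t.
Proof.
move=> hb Cg /=.
have [_ V] := curve_smooth_act (curve_smooth_cst x t) Cg.
rewrite velocity_cst tmap0 add0r in V.
pose y := bact E x (g t); pose h s := lmul (linv (g t)) (g s).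
have [Ch _] := curve_smooth_mul (curve_smooth_cst (linv (g t)) t) Cg.
have [_ V'] := curve_smooth_act (curve_smooth_cst y t) Ch.
rewrite velocity_cst tmap0 add0r lmulV in V'.
have EE : (fun s => bact E x (g s)) = (fun s => bact E y (h s)).
  by apply/funext => s; rewrite /y /h -bactM lmulVK.
have [_ _ vth] := htheta.
rewrite -V EE V' vth -(speed2_left (linv (g t)) hb Cg).
by rewrite /speed2 lmulV.
Qed.

Lemma bundle_speed (gM : tensor2 M) (b : tensor2 G) (c : R -> P) (t : R) :
  curve_smooth_at c t ->
  speed2 (bundle_metric E theta gM b) c t =
  speed2 gM (pi \o c) t + b one (theta (c t) (velocity c t)) (theta (c t) (velocity c t)).
Proof.
move=> Cc; have [_ V] := curve_smooth_comp Cc (smooth_at_of (c t) (bproj_smooth E)).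
by rewrite /speed2 V.
Qed.

Lemma theta_smooth (a : chart R P p) (x : P) (v : 'rV[R]_p) : atlas a -> cdom a x ->
  smooth_at (fun y => theta (cinv a y) (chart_field a y v)) (cmap a x).
Proof.
move=> Aa ax; have [Ct _ _] := htheta; apply: Cinf_smooth_at (Ct a Aa v).
by apply: open_nbhs_nbhs; split; [exact: crange_open|exists x].
Qed.

Definition theta_mx (a : chart R P p) (y : 'rV[R]_p) : 'M[R]_(p, k) :=
  \matrix_(i, j) theta (cinv a y) (chart_field a y (delta_mx 0 i)) 0 j.

Lemma theta_mxE (a : chart R P p) (y v : 'rV[R]_p) :
  v *m theta_mx a y = theta (cinv a y) (chart_field a y v).
Proof.
apply/rowP => j; rewrite mxE chart_field_sum linear_sum summxE.
by apply: eq_bigr => i _; rewrite linearZ !mxE.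
Qed.

Lemma theta_mx_smooth (a : chart R P p) (x : P) : atlas a -> cdom a x ->
  smooth_at (theta_mx a) (cmap a x).
Proof.
move=> Aa ax; apply: smooth_at_mx => i j; under eq_fun do rewrite mxE.
exact/smooth_at_coord/theta_smooth.
Qed.

Lemma bundle_speed_continuous (gM : tensor2 M) (b : tensor2 G) :
  riemannian gM -> riemannian b -> speed_continuous (bundle_metric E theta gM b).
Proof.
move=> rM rb c t Cc; have [sb cb _ _] := rb.
pose a := chart_at (c t).
have Aa : atlas a := chart_at_atlas _; have act : cdom a (c t) := chart_at_dom _.
have Ca := curve_smooth_chart Cc Aa act.
pose h := cmap a \o c.
(* All values of theta lie in the same space, so their contribution is a quadratic form with a
   constant matrix. *)
pose B : 'M[R]_k := \matrix_(i, j) b one (delta_mx 0 i) (delta_mx 0 j).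
have BE v : b one v v = (v *m B *m v^T) 0 0.
  rewrite {2}(row_sum_delta v) (scalar_sum _ _ (sb _ _)) mxE.
  apply: eq_bigr => j _; rewrite !mxE mulrC; congr (_ * _).
  rewrite {1}(row_sum_delta v) cb (scalar_sum _ _ (sb _ _)).
  by apply: eq_bigr => i _; rewrite mxE cb.
pose w s := derive1 h s *m theta_mx a (h s).
have H : \forall s \near t, speed2 gM (pi \o c) s + (w s *m B *m (w s)^T) 0 0 =
    speed2 (bundle_metric E theta gM b) c s.
  have H1 := near_comp (curve_smooth_continuous Cc) (chart_near act).
  have H2 := curve_smooth_near Cc.
  near=> s.
  have as_ : cdom a (c s) by near: s.
  have Cs : curve_smooth_at c s by near: s.
  rewrite bundle_speed // BE; suff -> : theta (c s) (velocity c s) = w s by [].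
  by rewrite /w theta_mxE (velocity_chart Cs Aa as_) /h /= cmapK.
have Cw : nCk 0 w t.
  apply: nCk_mulmx; first by apply: smooth_atW; exact: smooth_at_derive1.
  apply: (nCk_comp (has_coords_mx _ _) (smooth_atW 0 Ca)); apply: smooth_atW.
  exact: theta_mx_smooth.
have K : nCk 0 (fun s => speed2 gM (pi \o c) s + (w s *m B *m (w s)^T) 0 0) t.
  apply: nCkD.
    apply/nCk0P; apply: filterS (curve_smooth_near Cc) => s Cs.
    apply: speed_continuous_riemannian rM _ _ _.
    exact: (curve_smooth_comp Cs (smooth_at_of (c s) (bproj_smooth E))).1.
  apply: nCk_coord; apply: nCk_mulmx; last exact: nCk_trmx.
  by apply: nCk_mulmx => //; exact: nCk_cst.
exact: nCk_continuous (nCk_near_eq H K).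
Unshelve. all: by end_near. Qed.

(** The local section z |-> psi z (chi x) passes through x, and it carries a curve with velocity w
    to a lift of it. *)
Lemma bproj_submersion (x : P) (w : 'rV[R]_m) : exists v, tmap pi x v = w.
Proof.
have [U [chi [psi [[oU Uz _ sp] [H1 H2 H3]]]]] := btrivial E (pi x).
have [c [Cc c0 cv]] := velocity_surj (pi x) w.
have Cp : map2_smooth_at psi (c 0) (chi x).
  apply: (smooth2_on_at _ sp); rewrite c0.
  exists (U, setT); first by split; [exact: open_nbhs_nbhs|exact: filterT].
  by move=> [y g] [].
have [Cd Vd] := curve_smooth_comp2 Cc (curve_smooth_cst (chi x) 0) Cp.
have [_ V] := curve_smooth_comp Cd (smooth_at_of _ (bproj_smooth E)).
have x0 : psi (c 0) (chi x) = x by rewrite c0 H1.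
exists (velocity (fun s => psi (c s) (chi x)) 0).
rewrite -{1}x0 -V -cv; apply: velocity_near_eq.
have Uc : \forall s \near 0, U (c s).
  apply: (near_comp (curve_smooth_continuous Cc)); rewrite c0.
  exact: open_nbhs_nbhs.
by apply: filterS Uc => s Us /=; have [] := H2 (c s) (chi x) Us.
Qed.

Lemma vertical_tmap (x : P) (xi : 'rV[R]_k) :
  tmap pi x (tmap (fun g => bact E x g) one xi) = 0.
Proof.
have [c [Cc c0 cv]] := velocity_surj one xi.
have [Cd Vd] := curve_smooth_act (curve_smooth_cst x 0) Cc.
rewrite velocity_cst tmap0 add0r c0 cv in Vd.
have [_ V] := curve_smooth_comp Cd (smooth_at_of _ (bproj_smooth E)).
have Ec : pi \o (fun s => bact E x (c s)) = (fun=> pi x).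
  by apply/funext => s /=; rewrite bproj_act.
by rewrite Ec velocity_cst Vd c0 bact1 in V.
Qed.

Lemma horizontal_lift (x0 : P) (c : R -> M) (s0 : R) :
  curve_smooth_at c s0 -> c s0 = pi x0 ->
  exists h : R -> P, h s0 = x0 /\ \forall s \near s0,
    [/\ curve_smooth_at h s, pi (h s) = c s & horizontal theta (h s) (velocity h s)].
Proof.
move=> Cc cs0; have sf := bproj_smooth E.
pose a := chart_at x0; pose b := chart_at (pi x0).
have Aa : atlas a := chart_at_atlas _; have ax : cdom a x0 := chart_at_dom _.
have Ab : atlas b := chart_at_atlas _; have bfx : cdom b (pi x0) := chart_at_dom _.
pose F := cmap b \o pi \o cinv a.
have [cf Cf] := smooth_at_of x0 sf.
have CF : smooth_at F (cmap a x0) := Cf a b Aa Ab ax bfx.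
pose N := [set y | cdom a (cinv a y) /\ cdom b (pi (cinv a y)) /\ cmap a (cinv a y) = y].
have HN : \forall y \near cmap a x0, N y.
  have H1 := crange_near ax.
  have H2 := cinv_near ax (near_comp cf (chart_near bfx)).
  by apply: filterS2 H1 H2 => y [? ?] ?.
(* Projection and connection form are treated as a single linear map. The equality p = m + k is not
   part of the data, so J y is inverted on the right with [rinv], for the standard inner product,
   rather than as a square matrix. *)
pose J y : 'M[R]_(p, m + k) := row_mx (jacobian F y) (theta_mx a y).
have sur y : N y -> forall v : 'rV_(m + k), exists w : 'rV_p, w *m J y = v.
  move=> [ay [bfy Ey]] v; pose x := cinv a y.
  have [w Hw] := bproj_submersion x (chart_field b (cmap b (pi x)) (lsubmx v)).
  (* Adding a fundamental vector corrects the value of theta without changing the projection. *)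
  pose u := w + tmap (fun g => bact E x g) one (rsubmx v - theta x w).
  have [w' Hw'] := chart_field_surj u Aa ay.
  exists w'; rewrite mul_mx_row mul_jacobian theta_mxE -[RHS]hsubmxK; congr row_mx.
    apply/eqP; rewrite -subr_eq0; apply/eqP.
    apply: (chart_field_inj Ab bfy); rewrite /chart_field linearB /= -!/(chart_field _ _ _).
    have D := diff_chart w' sf Aa ay Ab bfy.
    rewrite Ey in D Hw'; rewrite D Hw' /u {1}/tmap linearD /= -!/(tmap _ _ _).
    by rewrite Hw vertical_tmap addr0 subrr.
  rewrite Ey in Hw'; rewrite Hw' linearD /=.
  by have [_ _ ->] := htheta; rewrite addrC subrK.
(* [v *m L y] is a vector projecting to v and killed by theta. *)
pose L y := row_mx 1%:M 0 *m rinv 1%:M (J y).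
have CL : smooth_at L (cmap a x0).
  have CJ : smooth_at J (cmap a x0).
    apply: smooth_at_mx => i j; rewrite /J.
    case: (split_ordP j) => j' ->.
      under eq_fun do rewrite row_mxEl.
      exact/smooth_at_coord/jacobian_smooth.
    under eq_fun do rewrite row_mxEr.
    exact/smooth_at_coord/theta_mx_smooth.
  move/smooth_at_nCk: CJ => CJ.
  apply/smooth_at_nCk; near=> y => i.
  have Ny : N y by near: y.
  apply: nCk_mulmx; first exact: nCk_cst.
  apply: nCk_rinv; [exact: posdef1|exact: sur|exact: nCk_cst|].
  by move: i; near: y.
have LE y (v : 'rV[R]_m) : N y -> v *m L y *m J y = row_mx v 0.
  move=> Ny; rewrite /L mulmxA rinvK; [|exact: posdef1|exact: sur].
  by rewrite mul_mx_row mulmx1 mulmx0.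
have HL : \forall y \near cmap a x0, forall v, 'd (cmap b \o pi \o cinv a) y (v *m L y) = v.
  apply: filterS HN => y Ny v; rewrite -mul_jacobian.
  by have := LE y v Ny; rewrite /J mul_mx_row => /eq_row_mx[].
have [h [Ch h0 fh Hh]] := local_lift sf Aa ax Ab bfx CL HL Cc cs0.
exists h; split => //.
have HNh : \forall s \near s0, N (cmap a (h s)).
  apply: (@near_comp _ _ (cmap a \o h)); last by rewrite /= h0.
  by apply: continuous_comp; [exact: curve_smooth_continuous|rewrite h0; exact: cmap_cvg].
have Chn := curve_smooth_near Ch.
near=> s.
have [ahs [v Ev]] : cdom a (h s) /\ exists v,
  velocity h s = chart_field a (cmap a (h s)) (v *m L (cmap a (h s))) by near: s.
have Ns : N (cmap a (h s)) by near: s.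
split; [by near: s|by near: s|].
rewrite /horizontal Ev -{1}(cmapK ahs) -theta_mxE.
by have := LE _ v Ns; rewrite /J mul_mx_row => /eq_row_mx[].
Unshelve. all: by end_near. Qed.

End Bundle.

(** * The correspondence between P and G/Hol_u *)

Section Holonomy.
Context {R : realType} {p m k : nat} {P : manifold R p} {M : manifold R m} {G : lie_group R k}.
Context (E : principal_bundle P M G).
Context (theta : P -> {linear 'rV[R]_p -> 'rV[R]_k}).
Hypothesis htheta : principal_connection E theta.
Local Notation pi := (bproj E).
Local Notation act := (bact E).
Local Notation one := (lone G).
Local Notation "x ~> y" := (hjoined theta x y) (at level 70).

(** The chained relation quantifies over all points x above the starting value, so successive local
    lifts fit together by transitivity of [hjoined]. *)
Lemma path_lift (c : R -> M) (a b : R) (x : P) :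
  pw_smooth (fun _ _ => True) c a b -> pi x = c a -> exists2 y, x ~> y & pi y = c b.
Proof.
move=> H; elim: H x => [a' b' ab /(arcP _ _ (ltW ab))[s Hs]|a' b' d _ IH1 _ IH2] x xa; last first.
  have [y xy /IH2[z yz zd]] := IH1 x xa.
  by exists z => //; exact: hjoined_trans xy yz.
have [sa sb] : s a' = c a' /\ s b' = c b'.
  by split; [have [] := Hs a'|have [] := Hs b']; rewrite ?lexx ?(ltW ab).
rewrite -sb; rewrite -sa in xa; move: x xa.
apply: (@interval_chain _ (fun s1 s2 => forall x, pi x = s s1 ->
  exists2 y, x ~> y & pi y = s s2) a' b' (ltW ab)).
  move=> s1 s2 s3 H1 H2 x /H1[y xy /H2[z yz zd]].
  by exists z => //; exact: hjoined_trans xy yz.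
move=> s0 /Hs[Cs _ _]; have [x0 px0] := bproj_surj E (s s0).
have [h [h0 Hh]] := horizontal_lift htheta Cs (esym px0).
have [r r0 {}Hh] := near_closed_ball Hh.
exists r => // s1 s2 rs1 s12 s2r _ _ x xs1.
have inr t : s1 <= t <= s2 -> `|t - s0| <= r.
  by move=> /andP[? ?]; rewrite ler_norml; apply/andP; split; lra.
have [Ch1 ph1 _] := Hh s1 (inr _ (introT andP (conj (lexx _) s12))).
have [Ch2 ph2 _] := Hh s2 (inr _ (introT andP (conj s12 (lexx _)))).
(* The single local lift h is moved by g so as to start at x; its interval of definition is
   unchanged. *)
have [g ->] : exists g, x = act (h s1) g by apply: fiber_transitive; rewrite ph1.
exists (act (h s2) g); last by rewrite bproj_act.
apply: (hjoined_act htheta); apply: hjoined_arc => // t /inr /Hh[].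
by [].
Qed.

Context (u : P).

Lemma holonomy_reduction (hM : connected [set: M]) (x : P) : exists g, u ~> act x g.
Proof.
have [c [a [b [H ca cb]]]] := connected_joined (pi u) (pi x) hM.
have [y uy yx] := path_lift H (esym ca).
have [g yg] : exists g, y = act x g by apply: fiber_transitive; rewrite yx.
by exists g; rewrite -yg.
Qed.

(** Translating by h joins u h to x g h. Hence the elements of G carrying x into the holonomy bundle
    form a single left coset of Hol_u, which makes [coset_rel] single-valued. *)
Lemma holonomy_mulr (x : P) (g h : G) : u ~> act x g ->
  (u ~> act x (lmul g h) <-> holonomy_group E theta u h).
Proof.
move=> ug; have uhgh := hjoined_act htheta h ug; rewrite -bactM in uhgh.
split=> [ugh|uh]; last exact: hjoined_trans uh uhgh.
exact: hjoined_trans ugh (hjoined_sym uhgh).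
Qed.

Context {q : nat} {Q : manifold R q} (pr : G -> Q).
Hypothesis hQ : coset_manifold (holonomy_group E theta u) pr.

(* The point z of G / Hol_u is the image of x under the map P -> G / Hol_u
   whose fibres are the translates of the holonomy bundle. *)
Definition coset_rel (x : P) (z : Q) := exists2 g, u ~> act x g & z = pr g.

Lemma coset_relP (x : P) (g : G) : coset_rel x (pr g) <-> u ~> act x g.
Proof.
have [_ _ prE _] := hQ; split; last by exists g.
move=> [h uh /prE Hgh]; have Hgh' := (prE g h).1 ((prE g h).2 Hgh).
have := holonomy_mulr (lmul (linv h) g) uh; rewrite lmulVK => ->.
by apply/prE; apply/esym/prE.
Qed.

Lemma coset_rel_fun (x : P) (z z' : Q) : coset_rel x z -> coset_rel x z' -> z = z'.
Proof.
have [_ _ prE _] := hQ.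
move=> [g ug ->] [h uh ->]; apply/prE.
by apply/(holonomy_mulr _ ug); rewrite lmulVK.
Qed.

Lemma coset_rel_surj (z : Q) : exists x, coset_rel x z.
Proof.
have [_ sur _ _] := hQ; have [g <-] := sur z.
by exists (act u (linv g)); apply/coset_relP; rewrite bactVK; exact: hjoined_refl.
Qed.

Context (b : tensor2 G) (hb : biinvariant b) (gM : tensor2 M) (hgM : riemannian gM).
Context (gT : tensor2 Q) (hgT : riemannian gT) (hsub : riemannian_submersion b gT pr).
Local Notation gP := (bundle_metric E theta gM b).

Let rb : riemannian b. Proof. by case: hb. Qed.

Let scP : speed_continuous gP.
Proof. exact: bundle_speed_continuous. Qed.

Let scT : speed_continuous gT.
Proof. exact: speed_continuous_riemannian. Qed.

Lemma tensor0 {n} {A : manifold R n} (g : tensor2 A) (x : A) : riemannian g -> g x 0 0 = 0.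
Proof. by move=> [sg _ _ _]; exact: scalar0 (sg x 0). Qed.

Lemma riemannian_ge0 {n} {A : manifold R n} (g : tensor2 A) (x : A) v : riemannian g ->
  0 <= g x v v.
Proof.
move=> rg; have [->|v0] := eqVneq v 0; first by rewrite tensor0.
by have [_ _ pg _] := rg; exact/ltW/pg.
Qed.

(* With h the horizontal lift of the projection of c through [c t], write
   [c = h g]: then [F c = pr (g^-1 g1)] for a constant g1, so only the vertical
   part of the velocity of c contributes to the speed of [F c]. *)
Lemma coset_map_curve (F : P -> Q) (c : R -> P) (t : R) :
  (forall x, coset_rel x (F x)) -> curve_smooth_at c t ->
  curve_smooth_at (F \o c) t /\ speed2 gT (F \o c) t <= speed2 gP c t.
Proof.
move=> HF Cc; have [spr _ _ _] := hQ.
have [Cpc _] := curve_smooth_comp Cc (smooth_at_of _ (bproj_smooth E)).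
have [h [h0 Hh]] := horizontal_lift htheta Cpc erefl.
have [U [chi [psi [[oU Uz schi _] [T1 T2 T3]]]]] := btrivial E (pi (c t)).
have Uc : \forall s \near t, U (pi (c s)).
  by apply: (near_comp (curve_smooth_continuous Cpc)); exact: open_nbhs_nbhs.
have [Ch0 _ hor0] := nbhs_singleton Hh.
have schi_at : map_smooth_at chi (c t).
  apply: smooth_on_at schi.
  apply: (near_comp (smooth_at_of (c t) (bproj_smooth E)).1).
  exact: open_nbhs_nbhs.
have [Cchc _] := curve_smooth_comp Cc schi_at.
have schi_h : map_smooth_at chi (h t) by rewrite h0.
have [Cchh _] := curve_smooth_comp Ch0 schi_h.
(* The element of G carrying h s to c s; expressed through the trivialisation, it is smooth at t. *)
pose g s := lmul (linv (chi (h s))) (chi (c s)).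
have Cg : curve_smooth_at g t.
  by apply: (curve_smooth_mul (curve_smooth_inv Cchh) Cchc).1.
have ch : \forall s \near t, c s = act (h s) (g s).
  apply: filterS2 Uc Hh => s Us [_ ps _]; rewrite /= in ps.
  rewrite -(T1 (c s)) // -[RHS]T1; last by rewrite bproj_act ps.
  by rewrite bproj_act ps T3 ?ps // lmulVK.
have [_ [g1 ug1 _]] : True /\ coset_rel (c t) (F (c t)) by [].
pose l s := lmul (linv (g s)) g1.
have Cl : curve_smooth_at l t.
  exact: (curve_smooth_mul (curve_smooth_inv Cg) (curve_smooth_cst g1 t)).1.
have Fl : \forall s \near t, pr (l s) = F (c s).
  have [r r0 Hr] := near_closed_ball Hh.
  apply: filterS2 ch (closed_ball_near t r0) => s chs sr.
  apply: coset_rel_fun (HF _); apply/coset_relP.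
  (* The action of [l s] takes c s to h s g1, which the translate by g1 of the horizontal curve h
     joins to h t g1 = c t g1. *)
  rewrite chs -bactM /l lmulVK.
  apply: hjoined_trans ug1 _; apply: (hjoined_act htheta); rewrite -h0.
  have seg s1 s2 : s1 <= s2 -> `|s1 - t| <= r -> `|s2 - t| <= r -> h s1 ~> h s2.
    rewrite !ler_norml => s12 /andP[? ?] /andP[? ?].
    apply: hjoined_arc => // z /andP[? ?].
    by have [] : [/\ curve_smooth_at h z, pi (h z) = (pi \o c) z & horizontal theta (h z)
      (velocity h z)]
      by apply: Hr; rewrite ler_norml; apply/andP; split; lra.
  have [ts|st] := leP t s.
    by apply: seg => //; [rewrite subrr normr0 ltW|exact: ltW].
  by apply: hjoined_sym; apply: seg; [exact: ltW|exact: ltW|rewrite subrr normr0 ltW].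
have [Cprl Vprl] := curve_smooth_comp Cl (smooth_at_of (l t) spr).
split; first by apply: curve_smooth_near_eq Cprl; exact: Fl.
have -> : speed2 gT (F \o c) t = speed2 gT (pr \o l) t.
  by rewrite /speed2 -(velocity_near_eq Fl) /= -(nbhs_singleton Fl).
apply: (@le_trans _ _ (speed2 b l t)).
  by rewrite /speed2 Vprl /=; exact: submersion_le.
have -> : speed2 b l t = speed2 b g t.
  by apply/esym/(speed2_mul_const hb Cg Cl (x := g1)); near=> s; rewrite /l lmulVK.
rewrite (bundle_speed E theta gM b Cc) -(vertical_speed htheta (h t) hb Cg).
have [_ Vc] := curve_smooth_act E Ch0 Cg.
have E1 : theta (c t) (velocity c t) =
    theta (act (h t) (g t)) (tmap (fun y => act (h t) y) (g t) (velocity g t)).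
  rewrite (velocity_near_eq ch) Vc (nbhs_singleton ch) linearD.
  have [_ Ath _] := htheta.
  by rewrite [X in X + _]Ath hor0 /Ad tmap0 add0r.
by rewrite E1 lerDr riemannian_ge0.
Unshelve. all: by end_near. Qed.

Lemma riem_dist_coset (x x' : P) (z z' : Q) : connected [set: M] ->
  coset_rel x z -> coset_rel x' z' -> (riem_dist gT z z' <= riem_dist gP x x')%E.
Proof.
move=> cM xz xz'.
have /choice[F HF] y : exists z, coset_rel y z.
  by have [g ug] := holonomy_reduction cM y; exists (pr g), g.
rewrite (coset_rel_fun xz (HF x)) (coset_rel_fun xz' (HF x')).
apply/ereal_infP => _ [c [a1 [b1 [H <- <- ->]]]].
have [|H' l] := @pw_transport _ _ _ _ _ gP gT F (fun _ _ => True) c a1 b1 scP scT _ H.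
  by move=> d t Cd _; exact: coset_map_curve.
exact: le_trans (riem_dist_le gT H') l.
Qed.

Lemma riem_dist_refl (x : P) : riem_dist gP x x = 0%E.
Proof.
apply/eqP; rewrite eq_le riem_dist_ge0 andbT.
have H : pw_smooth (fun _ _ => True) (fun=> x) 0 (1 : R).
  apply: pw_smooth_arc; first exact: ltr01.
  by apply/arcP => //; exists (fun=> x) => t _; split => //; exact: curve_smooth_cst.
apply: le_trans (riem_dist_le gP H) _.
rewrite curve_length_cst // => y; rewrite /bundle_metric tmap0 linear0 !tensor0 ?addr0 //.
Qed.

(** Recording a bound on the distance instead of a curve in P lets the pieces be combined by the
    triangle inequality, with no gluing of lifts. *)
Lemma coset_path_lift (c : R -> Q) (a1 b1 : R) (x : P) :
  pw_smooth (fun _ _ => True) c a1 b1 -> coset_rel x (c a1) ->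
  exists2 y, coset_rel y (c b1) & (riem_dist gP x y <= curve_length gT c a1 b1)%E.
Proof.
move=> H; elim: H x => [a' b' ab /[dup] Harc /(arcP _ _ (ltW ab))[s Hs]|a' b' d H1 IH1 H2 IH2]
  x xa; last first.
  have [y /IH2[z zd yz] xy] := IH1 x xa.
  exists z => //; rewrite (pw_length_cat scT H1 H2).
  by apply: le_trans (riem_dist_triangle x y z scP) _; exact: leeD.
have [sa sb] : s a' = c a' /\ s b' = c b'.
  by split; [have [] := Hs a'|have [] := Hs b']; rewrite ?lexx ?(ltW ab).
have Es t : a' <= t <= b' -> s t = c t by move=> /Hs[].
have ms s1 s2 : a' <= s1 -> s2 <= b' -> measurable_fun `[s1, s2] (fun t =>
  Num.sqrt (speed2 gT s t)).
  move=> as1 s2b; apply: speed_measurable => // t /andP[? ?].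
  by have [] := Hs t; rewrite // (le_trans as1) //= (le_trans _ s2b).
rewrite -(curve_length_eq Es (ms _ _ (lexx _) (lexx _))).
rewrite -sb; rewrite -sa in xa; move: x xa.
pose Rel s1 s2 := [/\ a' <= s1, s1 <= s2, s2 <= b' & forall x, coset_rel x (s s1) ->
  exists2 y, coset_rel y (s s2) & (riem_dist gP x y <= curve_length gT s s1 s2)%E].
suff [] : Rel a' b' by [].
apply: (@interval_chain _ Rel a' b' (ltW ab)).
  move=> s1 s2 s3 [as1 s12 _ H1] [as2 s23 s3b H2]; split => //; first exact: le_trans s23.
  move=> x /H1[y /H2[z zd yz] xy]; exists z => //.
  have [_ ->] := length_split s12 s23 (ms _ _ as1 (le_trans s23 s3b)) (ms _ _ as2 s3b).
  by apply: le_trans (riem_dist_triangle x y z scP) _; exact: leeD.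
move=> s0 /Hs[Cs _ _]; have [spr prsur prE _] := hQ; have [g0 pg0] := prsur (s s0).
have [_ subm iso] := hsub.
(* The lift passes through an arbitrary g0 above s s0, chosen before x, so the radius below is the
   same for all x. *)
have [h [Ch h0 prh hor]] := submersion_lift rb spr subm Cs (esym pg0).
have HH : \forall t \near s0, [/\ curve_smooth_at h t, \forall t' \near t, pr (h t') = s t' &
    forall v, tmap pr (h t) v = 0 -> b (h t) (velocity h t) v = 0].
  have H1 := curve_smooth_near Ch; have H2 := near_join prh.
  by near=> t; split; near: t.
have [r r0 {}HH] := near_closed_ball HH.
exists r => // s1 s2 rs1 s12 s2r as1 s2b; split => // x xs1.
move: s12; rewrite le_eqVlt => /predU1P[s12|s12].
  exists x; first by rewrite -s12.
  by rewrite riem_dist_refl; exact: curve_length_ge0.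
have inr t : s1 <= t <= s2 -> `|t - s0| <= r.
  by move=> /andP[? ?]; rewrite ler_norml; apply/andP; split; lra.
have Hin t : s1 <= t <= s2 -> [/\ curve_smooth_at h t, \forall t' \near t, pr (h t') = s t' &
    forall v, tmap pr (h t) v = 0 -> b (h t) (velocity h t) v = 0] by move=> /inr /HH.
have prs t : s1 <= t <= s2 -> pr (h t) = s t by move=> /Hin[_ /nbhs_singleton].
have s11 : s1 <= s1 <= s2 by rewrite lexx ltW.
have s22 : s1 <= s2 <= s2 by rewrite lexx ltW.
have uxh : u ~> act x (h s1) by apply/coset_relP; rewrite prs.
(* Since g t h t = h s1 for all t, the point y t h t stays equal to x h(s1), which is in the
   holonomy bundle; so y t corresponds to pr (h t) = s t. The curve y is vertical, and gM
   contributes nothing to its speed. *)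
pose g t := lmul (h s1) (linv (h t)).
pose y t := act x (g t).
have ys1 : y s1 = x by rewrite /y /g lmulVr bact1.
have Cg t : s1 <= t <= s2 -> curve_smooth_at g t.
  move=> /Hin[Cht _ _].
  exact: (curve_smooth_mul (curve_smooth_cst (h s1) t) (curve_smooth_inv Cht)).1.
have gh t : lmul (g t) (h t) = h s1 by rewrite /g -lmulA lmulV lmulr1.
have Cy t : s1 <= t <= s2 -> curve_smooth_at y t.
  by move=> /Cg Cgt; exact: (curve_smooth_act E (curve_smooth_cst x t) Cgt).1.
have yrel t : s1 <= t <= s2 -> coset_rel (y t) (s t).
  by move=> st; rewrite -prs //; apply/coset_relP; rewrite /y -bactM gh.
exists (y s2); first exact: yrel.
have Hy : pw_smooth (fun _ _ => True) y s1 s2.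
  by apply: pw_smooth_arc => //; apply/arcP; [exact: ltW|exists y => t /Cy].
rewrite -{1}ys1; apply: le_trans (riem_dist_le gP Hy) _.
rewrite !curve_lengthE le_eqVlt; apply/orP; left; apply/eqP.
apply: eq_integral => t; rewrite inE /= in_itv /= => st; congr (Num.sqrt _)%:E.
have [Cht prht hort] := Hin t st.
have [_ Vy] := curve_smooth_act E (curve_smooth_cst x t) (Cg t st).
rewrite velocity_cst tmap0 add0r in Vy.
have Epi : pi \o y = (fun=> pi x) by apply/funext => z; rewrite /= bproj_act.
rewrite (bundle_speed E theta gM b (Cy t st)) Epi {1}/speed2 velocity_cst tensor0 // add0r.
rewrite Vy (vertical_speed htheta x hb (Cg t st)).
(* The speed of g equals that of h because g h is constant, and the speed of h equals that of s
   because h is horizontal for the Riemannian submersion [pr]. *)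
rewrite (speed2_mul_const hb (Cg t st) Cht (x := h s1)); last by near=> z.
have [_ Vprh] := curve_smooth_comp Cht (smooth_at_of (h t) spr).
rewrite /speed2 -(velocity_near_eq prht) -(nbhs_singleton prht).
by rewrite (_ : (fun t' => pr (h t')) = pr \o h) // Vprh iso.
Unshelve. all: by end_near. Qed.

(** The length of a horizontal curve depends only on its projection to M, which right translation
    leaves unchanged. *)
Lemma riem_dist_act (x y : P) (S : set P) (g : G) :
  (riem_dist gP (act x g) (act y g) <= cc_dist gP (horizontal theta) S x y)%E.
Proof.
apply/ereal_infP => _ [c [a1 [b1 [H _ <- <- ->]]]].
have [|H' l] := @pw_transport _ _ _ _ _ gP gP (fun x =>
  act x g) (horizontal theta) c a1 b1 scP scP _ H.
  move=> d t Cd Hd; have [C' H'] := horizontal_act htheta g Cd Hd; split => //.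
  rewrite (bundle_speed E theta gM b C') (bundle_speed E theta gM b Cd) /=.
  rewrite H' Hd (_ : pi \o _ = pi \o d) //.
  by apply/funext => z; rewrite /= bproj_act.
exact: le_trans (riem_dist_le gP H') l.
Qed.

Lemma riem_dist_le_coset (x x' : P) (z z' : Q) : 
  coset_rel x z -> coset_rel x' z' ->
  (riem_dist gP x x' <= riem_dist gT z z' +
     diameter (holonomy_bundle theta u) (cc_dist gP (horizontal theta)
       (holonomy_bundle theta u)))%E.
Proof.
move=> xz xz'; set D := diameter _ _.
have Dge (y : P) : coset_rel y z' -> (riem_dist gP y x' <= D)%E.
  move=> yz'; have [g ug zg] := xz'; rewrite zg in yz'; move/coset_relP: yz' => uy.
  (* Both y g and x' g lie in the holonomy bundle, so y and x' are the translates by g^-1 of two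
     points whose Carnot-Caratheodory distance is at most D. *)
  rewrite -(bactK E y g) -(bactK E x' g).
  apply: le_trans (riem_dist_act _ _ (holonomy_bundle theta u) _) _.
  by apply: ereal_sup_ubound; exists (act y g), (act x' g).
have D0 : (0 <= D)%E by apply: le_trans (riem_dist_ge0 gP x' x') (Dge x' xz').
have key l : [set l | exists c a b, [/\ pw_smooth (fun _ _ => True) c a b, c a = z, c b = z' &
      l = curve_length gT c a b]] l -> (riem_dist gP x x' <= l + D)%E.
  move=> [c [a1 [b1 [H ca cb ->]]]]; rewrite -ca in xz.
  have [y yz xy] := coset_path_lift H xz; rewrite cb in yz.
  apply: le_trans (riem_dist_triangle x y x' scP) _.
  by apply: leeD => //; exact: Dge.
have [->|rz] := eqVneq (riem_dist gT z z') +oo%E.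
  by rewrite addye ?leey // gt_eqF // (lt_le_trans _ D0) // ltNy0.
have fz : riem_dist gT z z' \is a fin_num by rewrite ge0_fin_numE ?riem_dist_ge0 // ltey.
apply/lee_addgt0Pr => e e0.
have [l S1 L1] := lb_ereal_inf_adherent e0 fz.
apply: le_trans (key l S1) _.
by rewrite addeAC; apply: leeD => //; exact: ltW.
Qed.

Lemma coset_dist_fin (z z' : Q) : connected [set: G] -> (riem_dist gT z z' < +oo)%E.
Proof.
move=> cG; have [spr sur _ _] := hQ.
have cQ : connected [set: Q].
  have -> : [set: Q] = pr @` setT.
    by apply/seteqP; split => // y _; have [g <-] := sur y; exists g.
  apply: connected_continuous_connected => //.
  by apply: continuous_subspaceT => g; exact: (smooth_at_of g spr).1.
have [c [a1 [b1 [H <- <-]]]] := connected_joined z z' cQ.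
exact: le_lt_trans (riem_dist_le gT H) (pw_length_fin scT H).
Qed.

End Holonomy.

Theorem corollary3 (R : realType) (k m p q : nat)
  (G : lie_group R k) (hGcompact : compact [set: G])
  (hGconnected : connected [set: G])
  (M : manifold R m) (hMcompact : compact [set: M])
  (hMconnected : connected [set: M])
  (P : manifold R p) (E : principal_bundle P M G)
  (b : tensor2 G) (hb : biinvariant b)
  (T : R) (hT : 0 < T)
  (gM : R -> tensor2 M)
  (hgM : forall t : R, 0 <= t < T -> riemannian (gM t))
  (theta : P -> {linear 'rV[R]_p -> 'rV[R]_k})
  (htheta : principal_connection E theta)
  (u : P) (hHol : closed (holonomy_group E theta u))
  (Q : manifold R q) (pr : G -> Q)
  (hQ : coset_manifold (holonomy_group E theta u) pr)
  (gT : tensor2 Q) (hgT : riemannian gT)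
  (hgTinv : translation_invariant pr gT)
  (hgTsub : riemannian_submersion b gT pr)
  (t : R) (ht : 0 <= t < T) :
  (GH_dist (riem_dist (bundle_metric E theta (gM t) b)) (riem_dist gT) <=
   (2^-1)%:E *
   diameter (holonomy_bundle theta u)
     (cc_dist (bundle_metric E theta (gM t) b) (horizontal theta)
        (holonomy_bundle theta u)))%E.
Proof.
have rM := hgM t ht.
rewrite /GH_dist; apply: lee_wpmul2l; first by rewrite lee_fin invr_ge0.
set D := diameter _ _.
pose C := [set xz : P * Q | coset_rel E theta u pr xz.1 xz.2].
apply: (@le_trans _ _ (distortion (riem_dist (bundle_metric E theta (gM t) b)) (riem_dist gT) C)).
  apply: ereal_inf_lbound; exists C => //; split=> [x|z].
    by have [g ug] := holonomy_reduction htheta u hMconnected x; exists (pr g), g.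
  exact: coset_rel_surj.
apply: ge_ereal_sup => _ [x [x' [z [z' [xz xz' ->]]]]]; rewrite /= in xz xz'.
have h1 := riem_dist_coset htheta hQ hb rM hgT hgTsub hMconnected xz xz'.
have h2 := riem_dist_le_coset htheta hQ hb rM hgT hgTsub xz xz'; rewrite -/D in h2.
have h3 := coset_dist_fin hQ hgT z z' hGconnected.
have h4 := riem_dist_ge0 gT z z'.
have fz : riem_dist gT z z' \is a fin_num by rewrite ge0_fin_numE.
(* The coset map does not increase distances, so the difference is nonnegative and only the upper
   bound remains; finiteness of the distance on G/H permits moving it across the inequality. *)
rewrite gee0_abs ?sube_ge0 ?fz ?orbT //.
by rewrite leeBlDr // addeC.
Qed.
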